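(* For $i=1,2$ let $K_i$ be a number field and $S_i$ a finite set of primes of $K_i$ containing the archimedean primes. Let $\sigma\colon G_{K_1,S_1}\xrightarrow{\sim}G_{K_2,S_2}$ be a topological isomorphism, and for a finite subextension $L_1$ of $K_{1,S_1}/K_1$ let $L_2$ be the finite subextension of $K_{2,S_2}/K_2$ corresponding to $L_1$ via $\sigma$. Suppose that for every finite subextension $L_1$ of $K_{1,S_1}/K_1$ there is a bijection $\sigma_{*,L_1}\colon|\operatorname{Spec}\mathcal O_{L_1,S_1}|\to|\operatorname{Spec}\mathcal O_{L_2,S_2}|$ on closed points such that these bijections are compatible for varying $L_1$, satisfy $\sigma(D_{\bar{\mathfrak p}})=D_{\sigma_*(\bar{\mathfrak p})}$ for all primes $\bar{\mathfrak p}$ of $K_{1,S_1}$ not over $S_1$, where $\sigma_*$ is the inverse limit of the $\sigma_{*,L_1}$, and preserve the residue characteristic and the absolute inertia degrees of primes. If $K_1/\mathbb Q$ is normal, then $K_1\cong K_2$.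
   Context: For a number field $K$ and a finite set $S$ of primes of $K$ containing all archimedean primes, $K_S$ is the maximal extension of $K$ unramified outside $S$, $G_{K,S}=\mathrm{Gal}(K_S/K)$, and $K_{i,S_i}=(K_i)_{S_i}$. For a finite subextension $L$ of $K_S/K$, $\mathcal O_{L,S}$ is the ring of integers of $L$ away from the primes above $S$. $|X|$ is the set of closed points of a scheme $X$. $D_{\bar{\mathfrak p}}\subseteq G_{K,S}$ is the decomposition subgroup of a prime $\bar{\mathfrak p}$ of $K_S$. *)

(* Defs.v *)
From HB Require Import structures.
From mathcomp Require Import all_boot all_order all_algebra all_field.
From mathcomp Require Import boolp classical_sets functions cardinality.
From mathcomp Require Import topology.

Set Implicit Arguments.
Unset Strict Implicit.
Unset Printing Implicit Defensive.

Import Order.TTheory GRing.Theory Num.Theory.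
Local Open Scope classical_set_scope.
Local Open Scope ring_scope.

(* A number field is a [K : fieldExtType rat].  Its algebraic closure is algC,
   via a chosen embedding [iota : {rmorphism K -> algC}]; K is then identified
   with [range iota].  Algebraic extensions of K, their subrings and the ideals
   of these subrings are subsets of algC. *)

Definition is_subfield (L : set algC) : Prop :=
  [/\ L 1,
      (forall x y, L x -> L y -> L (x - y))
    & (forall x y, L x -> L y -> L (x / y))].

Definition finite_over (k L : set algC) : Prop :=
  exists (n : nat) (e : 'I_n -> algC),
    (forall i, L (e i)) /\
    forall x, L x -> exists c : 'I_n -> algC,
      (forall i, k (c i)) /\ x = \sum_i c i * e i.

Definition finite_subext (k M L : set algC) : Prop :=
  [/\ is_subfield L, k `<=` L, L `<=` M & finite_over k L].

Definition hom_on (L : set algC) (f : algC -> algC) : Prop :=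
  [/\ f 1 = 1,
      (forall x y, L x -> L y -> f (x + y) = f x + f y)
    & (forall x y, L x -> L y -> f (x * y) = f x * f y)].

Definition normal_over_rat (K : fieldExtType rat) : Prop :=
  forall p : {poly rat}, irreducible_poly p ->
    (exists x : K, root (map_poly (in_alg K) p) x) ->
    exists rs : seq K,
      map_poly (in_alg K) p %= \prod_(r <- rs) ('X - r%:P).

Definition is_ideal (A I : set algC) : Prop :=
  [/\ I `<=` A, I 0,
      (forall x y, I x -> I y -> I (x + y))
    & (forall a x, A a -> I x -> I (a * x))].

Definition prime_ideal (A P : set algC) : Prop :=
  [/\ is_ideal A P, ~ P 1
    & forall x y, A x -> A y -> P (x * y) -> P x \/ P y].

Definition maximal_ideal (A P : set algC) : Prop :=
  [/\ is_ideal A P, ~ P 1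
    & forall J, is_ideal A J -> P `<=` J -> J = P \/ J = A].

Definition closed_points (A : set algC) : set (set algC) :=
  [set P | maximal_ideal A P].

Definition ideal_mul (I J : set algC) : set algC :=
  [set x | exists (n : nat) (a b : 'I_n -> algC),
     (forall i, I (a i) /\ J (b i)) /\ x = \sum_i a i * b i].

Definition ideal_exp (A I : set algC) (n : nat) : set algC :=
  iter n (ideal_mul I) A.

Definition residue_char (P : set algC) (p : nat) : Prop :=
  prime p /\ P p%:R.

(* f = [A / P : F_p]: the classes of e_0, ..., e_(f-1) form a basis of A / P over
   F_p, scalars being represented by the integers 0, ..., p - 1. *)
Definition abs_inertia_degree (A P : set algC) (f : nat) : Prop :=
  exists p : nat, residue_char P p /\
  exists e : 'I_f -> algC,
    (forall i, A (e i)) /\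
    forall x, A x -> exists! c : {ffun 'I_f -> 'I_p},
      P (x - \sum_i (c i : nat)%:R * e i).

Definition integers (L : set algC) : set algC := [set x | L x /\ x \in Aint].

Definition finite_primes (L : set algC) : set (set algC) :=
  [set P | prime_ideal (integers L) P /\ exists2 x, P x & x != 0].

Definition prime_below (k P : set algC) : set algC := P `&` integers k.

(* The ramification index of P over p: the largest e such that p O_L is
   contained in P ^ e *)
Definition ramification_index (L p P : set algC) (e : nat) : Prop :=
  let pO := ideal_mul p (integers L) in
  pO `<=` ideal_exp (integers L) P e /\
  ~ (pO `<=` ideal_exp (integers L) P e.+1).

(* Primes of K: a finite prime is given by the corresponding ideal of the ring
   of integers of [range iota]; an archimedean one by a class {tau, tau^*} of
   embeddings of K in the algebraically closed field algC, a subfield of the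
   complex numbers. *)

Variant place (K : fieldExtType rat) : Type :=
  | FinPlace of set algC
  | ArchPlace of set (K -> algC).
Arguments FinPlace {K} _.
Arguments ArchPlace {K} _.

Definition is_archimedean (K : fieldExtType rat) (v : place K) : Prop :=
  if v is ArchPlace T then
    exists tau : {rmorphism K -> algC},
      T = [set (tau : K -> algC); (fun x => (tau x)^*)]
  else False.

Definition is_place (K : fieldExtType rat) (iota : {rmorphism K -> algC})
    (v : place K) : Prop :=
  if v is FinPlace p then finite_primes (range iota) p else is_archimedean v.

Definition prime_set (K : fieldExtType rat) (iota : {rmorphism K -> algC})
    (S : set (place K)) : Prop :=
  [/\ finite_set S, S `<=` is_place iota & @is_archimedean K `<=` S].

(* L / K is unramified at v, for a finite extension L of [range iota].  At a
   finite prime, the residue extensions are extensions of finite fields, hence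
   separable; at an archimedean one, the condition is that the primes of L above
   a real prime are real. *)
Definition unramified_at (K : fieldExtType rat) (iota : {rmorphism K -> algC})
    (L : set algC) (v : place K) : Prop :=
  match v with
  | FinPlace p =>
      forall P, finite_primes L P -> prime_below (range iota) P = p ->
        ramification_index L p P 1
  | ArchPlace T =>
      forall tau, T tau -> (forall x, tau x \is Num.real) ->
      forall f, hom_on L f -> (forall x, f (iota x) = tau x) ->
      forall y, L y -> f y \is Num.real
  end.

Definition unramified_outside (K : fieldExtType rat)
    (iota : {rmorphism K -> algC}) (S : set (place K)) (L : set algC) : Prop :=
  forall v, is_place iota v -> ~ S v -> unramified_at iota L v.

(* K_S: the compositum of the finite extensions of K unramified outside S; these
   form a directed system, so that the compositum is their union. *)
Definition max_unramified_ext (K : fieldExtType rat)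
    (iota : {rmorphism K -> algC}) (S : set (place K)) : set algC :=
  [set x | exists L, [/\ finite_subext (range iota) setT L,
                         unramified_outside iota S L & L x]].

(* O_{L,S}: the elements of L that lie in the localization of O_L at P for every
   finite prime P of L not above S. *)
Definition S_integers (K : fieldExtType rat) (iota : {rmorphism K -> algC})
    (S : set (place K)) (L : set algC) : set algC :=
  [set x | L x /\
     forall P, finite_primes L P ->
       ~ S (FinPlace (prime_below (range iota) P)) ->
       exists a b, [/\ integers L a, integers L b, ~ P b & x = a / b]].

(* Elements of Gal(M / k): automorphisms of M are extended by the identity
   outside M, so that two of them are equal as functions iff they agree on M. *)
Definition is_gal (M k : set algC) (f : algC -> algC) : Prop :=
  [/\ set_bij M M f, hom_on M f,
      (forall x, k x -> f x = x) & (forall x, ~ M x -> f x = x)].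

Record galois_aut (M k : set algC) : Type :=
  Gal { gal_fun :> algC -> algC; galP : is_gal M k gal_fun }.

HB.instance Definition _ (M k : set algC) := gen_eqMixin (galois_aut M k).
HB.instance Definition _ (M k : set algC) := gen_choiceMixin (galois_aut M k).

Section GalGroup.
Variables M k : set algC.

Lemma gal_inj (g h : galois_aut M k) : (forall x, g x = h x) -> g = h.
Proof.
case: g h => [g gP] [h hP] /= /funext gh.
by move: gP hP; rewrite gh => gP hP; rewrite (Prop_irrelevance gP hP).
Qed.

Lemma is_gal_mem f x : is_gal M k f -> M (f x) <-> M x.
Proof.
case=> -[fM _ _] _ _ fid; split=> [Mfx|]; last exact: fM.
by apply: contrapT => nMx; apply: (nMx); rewrite -(fid _ nMx).
Qed.

Lemma is_gal_id : is_gal M k id.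
Proof. by split=> //; split=> // x Mx; exists x. Qed.

Lemma is_gal_comp f g : is_gal M k f -> is_gal M k g -> is_gal M k (f \o g).
Proof.
move=> fP gP; have gM x := is_gal_mem x gP.
case: fP gP => fb [f1 fD fX] fk fid [gb [g1 gD gX] gk gid].
split; first exact: set_bij_comp gb fb.
- split=> [|x y Mx My|x y Mx My] /=; first by rewrite g1.
    by rewrite gD // fD //; apply/gM.
  by rewrite gX // fX //; apply/gM.
- by move=> x kx /=; rewrite gk // fk.
by move=> x nMx /=; rewrite gid // fid.
Qed.

Lemma is_gal_bij f : is_gal M k f -> bijective f.
Proof.
move=> fP; have fM x := is_gal_mem x fP.
case: fP => -[_ finj fsurj] _ _ fid.
apply/(Bijective (g := fun y => xget y [set x | f x = y])) => [x|y].
  case: (xgetP (f x) [set z | f z = f x]) => [z _ /= fzx|/(_ x erefl) []].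
  have [Mx|nMx] := pselect (M x).
    apply: (finj _ _ _ _ fzx); apply/mem_set => //.
    by apply/fM; rewrite fzx; apply/fM.
  have nMz : ~ M z by move=> Mz; apply/nMx/fM; rewrite -fzx; apply/fM.
  by rewrite -(fid z) // fzx fid.
case: (xgetP y [set z | f z = y]) => [z _ //|nf].
by have [/fsurj[x _ /nf]|/fid/nf] := pselect (M y).
Qed.

Lemma is_gal_inv f g : is_gal M k f -> cancel f g -> cancel g f -> is_gal M k g.
Proof.
move=> fP fK gK; have fM x := is_gal_mem x fP.
have gM x : M (g x) <-> M x by rewrite -{2}(gK x) fM.
case: fP => _ [f1 fD fX] fk fid; split.
- split=> [x /gM // | x y _ _ /(can_inj gK) // | x Mx].
  by exists (f x); [apply/fM | rewrite fK].
- split=> [|x y Mx My|x y Mx My]; first by rewrite -{1}f1 fK.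
    by rewrite -{1}(gK x) -{1}(gK y) -fD ?fK //; apply/gM.
  by rewrite -{1}(gK x) -{1}(gK y) -fX ?fK //; apply/gM.
- by move=> x kx; rewrite -{1}(fk x kx) fK.
by move=> x nMx; rewrite -{1}(fid x nMx) fK.
Qed.

Lemma gal_inv_exists (g : galois_aut M k) :
  {h : galois_aut M k | cancel g h /\ cancel h g}.
Proof.
apply: cid; have [h gK hK] := is_gal_bij (galP g).
by exists (Gal (is_gal_inv (galP g) gK hK)).
Qed.

Definition gal_one : galois_aut M k := Gal is_gal_id.
Definition gal_mul (g h : galois_aut M k) : galois_aut M k :=
  Gal (is_gal_comp (galP g) (galP h)).
Definition gal_inv (g : galois_aut M k) : galois_aut M k := sval (gal_inv_exists g).

Lemma gal_mulA : associative gal_mul. Proof. by move=> f g h; apply: gal_inj. Qed.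
Lemma gal_mul1 : left_id gal_one gal_mul. Proof. by move=> g; apply: gal_inj. Qed.
Lemma gal_mulr1 : right_id gal_one gal_mul.
Proof. by move=> g; apply: gal_inj. Qed.
Lemma gal_mulV : left_inverse gal_one gal_inv gal_mul.
Proof.
move=> g; apply: gal_inj => x /=.
by rewrite /gal_inv; case: gal_inv_exists => h [] /=.
Qed.
Lemma gal_mulrV : right_inverse gal_one gal_inv gal_mul.
Proof.
move=> g; apply: gal_inj => x /=.
by rewrite /gal_inv; case: gal_inv_exists => h [] /=.
Qed.

End GalGroup.

HB.instance Definition _ (M k : set algC) :=
  isGroup.Build (galois_aut M k) (@gal_mulA M k) (@gal_mul1 M k) (@gal_mulr1 M k)
    (@gal_mulV M k) (@gal_mulrV M k).

HB.instance Definition _ (M k : set algC) :=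
  isPointed.Build (galois_aut M k) (gal_one M k).

(* Krull topology: generated by the cosets g Gal(M / L), for g in Gal(M / k) and
   L / k a finite subextension of M / k. *)
HB.instance Definition _ (M k : set algC) :=
  @isSubBaseTopological.Build (galois_aut M k) (galois_aut M k * set algC)%type
    [set i | finite_subext k M i.2]
    (fun i => [set h : galois_aut M k | forall x, i.2 x -> h x = i.1 x]).

Definition GKS (K : fieldExtType rat) (iota : {rmorphism K -> algC})
    (S : set (place K)) : Type :=
  galois_aut (max_unramified_ext iota S) (range iota).

HB.instance Definition _ (K : fieldExtType rat) (iota : {rmorphism K -> algC})
    (S : set (place K)) := Group.on (GKS iota S).
HB.instance Definition _ (K : fieldExtType rat) (iota : {rmorphism K -> algC})
    (S : set (place K)) := PointedTopological.on (GKS iota S).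

Definition KS_subext (K : fieldExtType rat) (iota : {rmorphism K -> algC})
    (S : set (place K)) (L : set algC) : Prop :=
  finite_subext (range iota) (max_unramified_ext iota S) L.

(* The decomposition group of a prime P of K_S not over S, that is, of a closed
   point of Spec O_{K_S,S} *)
Definition decomposition_group (K : fieldExtType rat)
    (iota : {rmorphism K -> algC}) (S : set (place K)) (P : set algC) :
    set (GKS iota S) :=
  [set g : GKS iota S | gal_fun g @` P = P].
Arguments decomposition_group {K} iota S P.

Section Correspondence.
Variables (K1 K2 : fieldExtType rat).
Variables (iota1 : {rmorphism K1 -> algC}) (iota2 : {rmorphism K2 -> algC}).
Variables (S1 : set (place K1)) (S2 : set (place K2)).

(* L_2: the fixed field in K_{2,S_2} of sigma(Gal(K_{1,S_1} / L_1)) *)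
Definition corresponding_ext (sigma : GKS iota1 S1 -> GKS iota2 S2)
    (L1 : set algC) : set algC :=
  [set x | max_unramified_ext iota2 S2 x /\
     forall g : GKS iota1 S1, (forall y, L1 y -> gal_fun g y = y) ->
       gal_fun (sigma g) x = x].

(* The inverse limit of maps |Spec O_{L_1,S_1}| -> |Spec O_{L_2,S_2}|, where a
   closed point P of Spec O_{K_S,S} is identified with the compatible family
   of its restrictions to the O_{L,S}, of which P is the union. *)
Definition lim_star (star : set algC -> set algC -> set algC)
    (P : set algC) : set algC :=
  \bigcup_(L1 in KS_subext iota1 S1) star L1 (P `&` S_integers iota1 S1 L1).

End Correspondence.

(* Main.v *)
(* The field fixed by G_{K_2,S_2} is K_2, so that sigma_{*,K_1} matches the closed
   points of the two rings of S-integers, together with their residue characteristics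
   and absolute degrees. Write K_i = Q(t_i), with f_i the minimal polynomial of t_i.
   For almost all p, the points of degree 1 above p correspond to the roots of f_i
   modulo p, and f_i splits completely modulo p iff all points above p have degree 1.
   As K_1 is normal, f_1 splits modulo p as soon as it has a root, and then f_2 splits
   as well, hence p splits completely in K_1 K_2; likewise, if f_2 has a root modulo p
   then f_1 splits.

   Chebotarev's theorem is replaced by a weaker bound with an elementary proof: if
   g splits completely modulo every large p modulo which f has a root, then
   deg g < 2 deg f. For (f_1, K_1 K_2) it yields [K_1 K_2 : K_1] < 2, whence K_2 is
   contained in K_1; for (f_2, f_1) it yields [K_1 : K_2] < 2, whence K_1 = K_2.

   For the bound, consider finite sets I of large primes with a root r_p modulo p
   chosen for every p in I, and let |I| be the product of I. For g, the number of
   choices with |I| <= x is O(x): by the pigeonhole principle some polynomial h with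
   small coefficients vanishes at all the r_p, and its norm N(h), the product of its
   values at the roots of g, is a multiple of |I| of size O(|I|). For f, the number
   of choices with |I| of order x is at least of order x, because many polynomials
   with coefficients of size x^(1/deg f) have a squarefree norm. Summing over dyadic
   ranges, with rho(I) the number of choices for the set I, the sum of rho_g(I)/|I|
   over |I| <= x is O(log x), and that of rho_f(I)/|I| is at least of order log x. If
   g splits whenever f has a root and deg g >= 2 deg f, then
   2^#I rho_f(I) <= rho_g(I); sorting the pairs (I, J) by their symmetric
   difference, the square of the second sum is O of the first at x^2, a
   contradiction.

   The fixed field of G_{K,S} is K because every automorphism of algC over K
   preserves K_S, and because K_S is a field: a finite extension L of K is unramified
   at p iff some power of the Frobenius is the identity on O_L / p O_L, and this
   property passes to composita. *)
Require Import Defs.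
From HB Require Import structures.
From mathcomp Require Import all_boot all_order all_algebra all_field.
From mathcomp Require Import zify ring lra.

Set Implicit Arguments.
Unset Strict Implicit.
Unset Printing Implicit Defensive.

Import Order.TTheory GRing.Theory Num.Theory.
Local Open Scope ring_scope.

(** * Norms from companion matrices *)

(** The degree bound is an elementary form of a comparison of poles: the two estimates of order log
    x stand for the simple poles at 1 of the zeta functions of the fields of f and g, and the factor
    2^#I would bound the square of the first by the second. A ratio below 2 suffices because the
    degrees to be computed are integers.

    Everything rests on whether p divides N(h) not at all, once, or at least twice. Modulo p^2 there
    is no splitting of f to compute with, so N is a determinant in a companion matrix, which reduces
    along every ring morphism; its dimension is a parameter independent of [size f], which avoids
    casts. Two common roots of f and h modulo p lower the rank by two, while a single one lies in
    F_p and lifts: these two cases recover the choice from its polynomial and drive the squarefree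
    sieve.

    Complete splitting of p passes to K_1 K_2 without ideals, through the additive condition that
    t^p - t is p times an algebraic integer. Finite primes are handled by pigeonhole arguments in
    Z[t], which contains D O_L for some D > 0. *)

Definition compmx (R : nzRingType) (n : nat) (f : {poly R}) : 'M[R]_n.+1 :=
  \matrix_(i, j) if (i == n :> nat) then - f`_j else (i.+1 == j :> nat)%:R.
Arguments compmx {R} n f.

(* The product of the values of g at the roots of f, for f monic of size n + 2. *)
Definition norm (R : comNzRingType) (n : nat) (f g : {poly R}) : R :=
  \det (horner_mx (compmx n f) g).
Arguments norm {R} n f g.

Lemma char_poly_compmx (R : comNzRingType) (n : nat) (f : {poly R}) :
  f \is monic -> size f = n.+2 -> char_poly (compmx n f) = f.
Proof.
move=> fmon szf.
have E d : (size f).-1 = d -> char_poly (\matrix_(i < d, j < d)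
    if (i == d.-1 :> nat) then - f`_j else (i.+1 == j :> nat)%:R) = f.
  by move=> <-; exact: companionmxK.
by rewrite -[RHS](E n.+1) ?szf.
Qed.

Lemma map_compmx (R S : comNzRingType) (h : {rmorphism R -> S}) n (f : {poly R}) :
  map_mx h (compmx n f) = compmx n (map_poly h f).
Proof.
by apply/matrixP => i j; rewrite !mxE coef_map (fun_if h) rmorphN rmorph_nat.
Qed.

Lemma map_norm (R S : comNzRingType) (h : {rmorphism R -> S}) n (f g : {poly R}) :
  h (norm n f g) = norm n (map_poly h f) (map_poly h g).
Proof. by rewrite /norm -det_map_mx map_horner_mx map_compmx. Qed.

Section Norm.
Variables (R : comNzRingType) (n : nat) (f : {poly R}).
Hypotheses (fmon : f \is monic) (szf : size f = n.+2).
Local Notation A := (horner_mx (compmx n f)).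

Lemma normM g h : norm n f (g * h) = norm n f g * norm n f h.
Proof. by rewrite /norm rmorphM det_mulmx. Qed.

Lemma normC c : norm n f c%:P = c ^+ n.+1.
Proof. by rewrite /norm horner_mx_C det_scalar. Qed.

Lemma norm_XsubC c : norm n f ('X - c%:P) = (-1) ^+ n.+1 * f.[c].
Proof.
rewrite /norm rmorphB /= horner_mx_X horner_mx_C -{2}(char_poly_compmx fmon szf).
have -> : (char_poly (compmx n f)).[c] = \det (c%:M - compmx n f).
  rewrite -[LHS]horner_evalE /char_poly -det_map_mx; congr (\det _).
  apply/matrixP => i j; rewrite !mxE /= horner_evalE hornerD hornerN !hornerE.
  by rewrite hornerMn hornerX.
by rewrite -opprB -scaleN1r detZ.
Qed.

Definition powcol (r : R) : 'cV[R]_n.+1 := \col_i r ^+ i.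

(** The column of powers of a root r is an eigenvector of the companion matrix for the eigenvalue r,
    over any commutative ring: in the last row, f(r) = 0 supplies r^(n+1). *)
Lemma horner_mx_powcol r g : f.[r] = 0 -> A g *m powcol r = g.[r] *: powcol r.
Proof.
move=> fr0.
have CX : compmx n f *m powcol r = r *: powcol r.
  apply/colP => i; rewrite !mxE.
  have [ein|nin] := eqVneq (i : nat) n.
    under eq_bigr do rewrite !mxE ein eqxx.
    move: fr0; rewrite horner_coef szf big_ord_recr /=.
    have -> : f`_n.+1 = 1 by have := monicP fmon; rewrite lead_coefE szf.
    rewrite mul1r addrC => /eqP; rewrite addr_eq0 => /eqP; rewrite ein -exprS => ->.
    by rewrite -sumrN; apply: eq_bigr => j _; rewrite mulNr.
  have lin : (i.+1 < n.+1)%N by have := ltn_ord i; rewrite !ltnS leq_eqVlt (negPf nin).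
  rewrite (bigD1 (Ordinal lin)) //= !mxE (negPf nin) eqxx mul1r big1 ?addr0 ?exprS //.
  move=> j; rewrite -val_eqE /= => ji; rewrite !mxE (negPf nin) eq_sym (negPf ji).
  by rewrite mul0r.
elim/poly_ind: g => [|g c IH]; first by rewrite rmorph0 mul0mx horner0 scale0r.
rewrite rmorphD rmorphM /= horner_mx_X horner_mx_C mulmxDl -mulmxA CX.
by rewrite -scalemxAr IH mul_scalar_mx !hornerE scalerDl scalerA [r * _]mulrC.
Qed.

(** The first column is replaced by the eigenvector attached to r. As the top entry of this vector
    is r^0 = 1, the case [M = 1] is unitriangular, a change of basis of determinant 1. *)
Definition basis_at (r : R) (M : 'M[R]_n.+1) : 'M[R]_n.+1 :=
  \matrix_(i, j) if j == 0 then r ^+ i else M i j.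

Lemma det_basis_at1 r : \det (basis_at r 1) = 1.
Proof.
rewrite det_trig; last first.
  apply/is_trig_mxP => i j lij; rewrite !mxE.
  have [j0|_] := eqVneq j 0; first by rewrite j0 ltn0 in lij.
  by rewrite -val_eqE /= (ltn_eqF lij).
rewrite big1 // => i _; rewrite !mxE; have [->|_] := eqVneq i 0; first by rewrite expr0.
by rewrite eqxx.
Qed.

(** After the change of basis [basis_at r 1] the first column is g(r) times the eigenvector, and
    multilinearity pulls g(r) out. The cofactor is explicit, so that it can be studied modulo p when
    r is a root modulo p^2. *)
Lemma norm_root r g : f.[r] = 0 ->
  norm n f g = g.[r] * \det (basis_at r (A g)).
Proof.
move=> fr0; rewrite /norm -[LHS]mulr1 -(det_basis_at1 r) -det_mulmx.
have E : A g *m basis_at r 1 = \matrix_(i, j)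
   if j == 0 then g.[r] * r ^+ i else A g i j.
  apply/matrixP => i j; rewrite !mxE; have [j0|nj0] := eqVneq j 0.
    have /colP/(_ i) := horner_mx_powcol g fr0; rewrite !mxE => <-.
    by apply: eq_bigr => k _; rewrite !mxE j0 eqxx.
  rewrite (bigD1 j) //= !mxE (negPf nj0) eqxx mulr1 big1 ?addr0 // => k kj.
  by rewrite !mxE (negPf nj0) (negPf kj) mulr0.
rewrite {}E -!(det_tr (\matrix_(i, j) _)).
rewrite (determinant_multilinear (A := (\matrix_(i, j) _)^T)
  (B := (basis_at r (A g))^T) (C := (basis_at r (A g))^T) (i0 := 0)
  (b := g.[r]) (c := 0)).
- by rewrite mul0r addr0 det_tr.
- by apply/rowP => j; rewrite !mxE /= mul0r addr0.
- by apply/matrixP => i j; rewrite !mxE eq_sym (negPf (neq_lift _ _)).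
- by apply/matrixP => i j; rewrite !mxE eq_sym (negPf (neq_lift _ _)).
Qed.

End Norm.

Notation zpoly R := (map_poly (intmul (1 : R))).

Lemma norm_prod (F : closedFieldType) n (f g : {poly F}) rs :
  f = \prod_(x <- rs) ('X - x%:P) -> size f = n.+2 ->
  norm n f g = \prod_(x <- rs) g.[x].
Proof.
move=> Df szf.
have szrs : size rs = n.+1 by apply/eqP; rewrite -eqSS -szf Df size_prod_XsubC.
have fmon : f \is monic by rewrite Df monic_prod_XsubC.
have [s ->] := closed_field_poly_normal g.
have prodc c : \prod_(x <- rs) c = c ^+ n.+1 :> F.
  by rewrite big_const_seq count_predT szrs iter_mulr_1.
rewrite -mul_polyC normM normC; under [in RHS]eq_bigr do rewrite hornerCM.
rewrite big_split /= prodc; congr (_ * _).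
elim: s => [|y s IH].
  by rewrite !big_nil (normC _ f 1) expr1n big1 // => x _; rewrite hornerC.
transitivity (\prod_(x <- rs) (('X - y%:P).[x] * (\prod_(z <- s) ('X - z%:P)).[x])).
  rewrite big_cons normM IH big_split; congr (_ * _).
  rewrite norm_XsubC // Df horner_prod -prodc -big_split /=.
  by apply: eq_bigr => x _; rewrite !hornerE mulN1r opprB.
by apply: eq_bigr => x _; rewrite big_cons hornerM.
Qed.

Lemma dvdz_Zp (D : nat) (z : int) : (1 < D)%N -> (D %| z)%Z = (z%:~R == 0 :> 'Z_D).
Proof.
move=> D1; have E m : (m%:R == 0 :> 'Z_D) = (D %| m)%N.
  by rewrite Zp_nat -val_eqE /= Zp_cast.
case: z => m; first by rewrite -[_%:~R]/(m%:R) E.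
by rewrite NegzE -[LHS]/(D %| m.+1)%N rmorphN oppr_eq0; exact/esym/E.
Qed.

(** This is [norm_root] read in Z/D. The essential case is D = p^2, where the ring is not a
    domain. *)
Lemma norm_congr (D : nat) n (f g : {poly int}) (r : int) :
  (1 < D)%N -> f \is monic -> size f = n.+2 -> (D %| f.[r])%Z ->
  (D %| norm n f g - g.[r] * \det (basis_at r (horner_mx (compmx n f) g)))%Z.
Proof.
move=> D1 fmon szf Dfr; rewrite dvdz_Zp //.
pose h := intmul (1 : 'Z_D) : {rmorphism int -> 'Z_D}.
rewrite rmorphB rmorphM /= -[X in X - _]/(h _) map_norm.
rewrite (@norm_root _ _ _ _ _ (h r)).
- rewrite horner_map subr_eq0; apply/eqP; congr (_ * _).
  rewrite -[RHS]/(h _) -det_map_mx; congr (\det _); apply/matrixP => i j.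
  by rewrite !mxE -map_compmx -map_horner_mx (fun_if h) rmorphXn mxE.
- exact: monic_map.
- by rewrite size_map_poly_id0 // (monicP fmon) rmorph1 oner_eq0.
by rewrite horner_map; apply/eqP; rewrite -dvdz_Zp.
Qed.

Lemma det_two_rows (d : nat) (M : 'M[int]_d) (p : int) (i j : 'I_d) : i != j ->
  (forall k, (p %| M i k)%Z) -> (forall k, (p %| M j k)%Z) -> (p ^+ 2 %| \det M)%Z.
Proof.
move=> ij Mi Mj; pose D : 'rV[int]_d := \row_k (if k \in [:: i; j] then p else 1).
pose M' : 'M[int]_d := \matrix_(k, l)
  if k \in [:: i; j] then (M k l %/ p)%Z else M k l.
have -> : M = diag_mx D *m M'.
  apply/matrixP => k l; rewrite mul_diag_mx !mxE !inE.
  have [->|ki] := eqVneq k i; first by rewrite /= mulrC divzK.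
  have [->|kj] := eqVneq k j; first by rewrite /= mulrC divzK.
  by rewrite mul1r.
rewrite det_mulmx det_diag dvdz_mulr //.
rewrite (bigD1 i) //= (bigD1 j) 1?eq_sym //= !mxE !inE !eqxx orbT /= mulrA -expr2.
exact: dvdz_mulr.
Qed.

Lemma intr_Fp_surj p (x : 'F_p) : (x : nat)%:Z%:~R = x.
Proof. exact: natr_Zp. Qed.

(** An integral lift B of the matrix that brings M modulo p to echelon form has determinant prime to
    p, and the last two rows of B M are divisible by p. *)
Lemma det_corank2 (p : nat) (n : nat) (M : 'M[int]_n.+1) : prime p ->
  (\rank (map_mx (intmul (1 : 'F_p)) M) + 2 <= n.+1)%N -> (p%:Z ^+ 2 %| \det M)%Z.
Proof.
move=> pp; pose h : {rmorphism int -> 'F_p} := intmul (1 : 'F_p).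
rewrite -[intmul _]/(h : _ -> _); set Mp := map_mx _ M => rk.
have hp := dvdz_pcharf (pchar_Fp pp).
pose B : 'M[int]_n.+1 := \matrix_(i, j) (invmx (col_ebase Mp) i j : nat)%:Z.
have hB : map_mx h B = invmx (col_ebase Mp).
  by apply/matrixP => i j; rewrite !mxE; exact: intr_Fp_surj.
have dB : ~~ (p %| \det B)%Z.
  have -> : (p %| \det B)%Z = (h (\det B) == 0) by exact: hp.
  rewrite -det_map_mx hB -unitfE -unitmxE.
  by rewrite unitmx_inv col_ebase_unit.
have rows (k l : 'I_n.+1) : (\rank Mp <= k)%N -> (p %| (B *m M) k l)%Z.
  move=> rk_k.
  have -> : (p %| (B *m M) k l)%Z = (h ((B *m M) k l) == 0) by exact: hp.
  have -> : h ((B *m M) k l) = (map_mx h (B *m M)) k l by rewrite [RHS]mxE.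
  rewrite map_mxM /= hB -/Mp -{2}(mulmx_ebase Mp) -mulmxA mulKmx ?col_ebase_unit //.
  rewrite mxE big1 // => m _; rewrite mxE ltnNge rk_k andbF mul0r //.
(* The row before the last; the rank hypothesis forces n >= 1, so that it differs from the last
   one. *)
have n1 : (n.-1 < n.+1)%N by lia.
have := @det_two_rows _ (B *m M) p (Ordinal n1) ord_max.
rewrite det_mulmx Gauss_dvdzr; last first.
  rewrite coprimezE abszX coprimeXl //= prime_coprime //.
apply.
- by rewrite -val_eqE /=; lia.
- by move=> k; apply: rows => /=; lia.
- by move=> k; apply: rows => /=; lia.
Qed.

Lemma horner_taylor1 (R : comNzRingType) (f : {poly R}) (a h : R) :
  exists c, f.[a + h] = f.[a] + h * f^`().[a] + h ^+ 2 * c.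
Proof.
elim/poly_ind: f => [|f c [d IH]]; first by exists 0; rewrite deriv0 !horner0; ring.
exists (d * (a + h) + f^`().[a]).
rewrite derivD derivM derivX derivC !hornerE IH; ring.
Qed.

Lemma hensel_lift (p : nat) (f : {poly int}) (r : int) : prime p ->
  (p %| f.[r])%Z -> ~~ (p %| f^`().[r])%Z ->
  exists s : int, (p %| s - r)%Z /\ (p%:Z ^+ 2 %| f.[s])%Z.
Proof.
move=> pp /dvdzP[m fr] f'r.
have cop : coprimez p (f^`().[r]) by rewrite coprimezE /= prime_coprime.
have [u [v]] := Bezoutz p (f^`().[r]); rewrite (eqP cop) => uv.
(* A Newton step: f(r) = m p, and v inverts f'(r) modulo p. *)
exists (r + p%:Z * (- m * v)); split; first by rewrite addrAC subrr add0r dvdz_mulr.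
have [c ->] := horner_taylor1 f r (p%:Z * (- m * v)).
rewrite fr; apply/dvdzP; exists (m * u + (m * v) ^+ 2 * c).
rewrite -{1}[m]mulr1 -uv; ring.
Qed.

Section ModP.
Variables (p : nat) (K : closedFieldType) (iota : {rmorphism 'F_p -> K}).
Hypothesis pp : prime p.

Lemma dvdz_closure (z : int) : (p %| z)%Z = (z%:~R == 0 :> K).
Proof.
apply: dvdz_pcharf; rewrite (fmorph_pchar iota); exact: pchar_Fp.
Qed.

Lemma intr_frob_fixed (x : K) : x ^+ p = x -> exists r : int, r%:~R = x.
Proof.
move=> xp; have : root (map_poly iota ('X^p - 'X)) x.
  by rewrite rmorphB /= map_polyXn map_polyX /root !hornerE xp subrr.
have -> : 'X^p - 'X = \prod_y ('X - y%:P) :> {poly 'F_p}.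
  by rewrite -finField_genPoly card_Fp.
rewrite rmorph_prod /= /root horner_prod prodf_seq_eq0.
case/hasP => y _ /=; rewrite map_polyXsubC !hornerE subr_eq0 => /eqP ->.
by exists (y : nat); rewrite -(rmorph_int iota) intr_Fp_surj.
Qed.

Lemma root_zpoly_frob (g : {poly int}) (x : K) :
  (zpoly K g).[x] = 0 -> (zpoly K g).[x ^+ p] = 0.
Proof.
have pK : p \in [pchar K] by rewrite (fmorph_pchar iota); exact: pchar_Fp.
move=> gx; have := congr1 (pFrobenius_aut pK) gx; rewrite rmorph0 => <-.
rewrite -(horner_map (pFrobenius_aut pK)) /= pFrobenius_autE -map_poly_comp.
by congr (_.[_]); apply: eq_map_poly => z; rewrite [RHS]rmorph_int.
Qed.

Variables (n : nat) (f : {poly int}) (rs : seq K).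
Hypotheses (fmon : f \is monic) (szf : size f = n.+2).
Hypothesis frs : zpoly K f = \prod_(x <- rs) ('X - x%:P).

Lemma size_zpoly : size (zpoly K f) = n.+2.
Proof. by rewrite size_map_poly_id0 // (monicP fmon) oner_eq0. Qed.

Lemma monic_zpoly : zpoly K f \is monic.
Proof. exact: monic_map. Qed.

Lemma norm_zpoly g : (norm n f g)%:~R = \prod_(x <- rs) (zpoly K g).[x].
Proof.
rewrite -(norm_prod (zpoly K g) frs size_zpoly).
exact: (map_norm (intmul (1 : K))).
Qed.

Lemma mem_rs x : (x \in rs) = ((zpoly K f).[x] == 0).
Proof. by rewrite frs -rootE root_prod_XsubC. Qed.

Lemma size_rs : size rs = n.+1.
Proof. by apply/eqP; rewrite -eqSS -size_zpoly frs size_prod_XsubC. Qed.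

Lemma dvd_norm g : (p %| norm n f g)%Z = has (fun x => (zpoly K g).[x] == 0) rs.
Proof. by rewrite dvdz_closure norm_zpoly prodf_seq_eq0. Qed.

Lemma dvd_norm_deriv_uniq : ~~ (p %| norm n f f^`())%Z -> uniq rs.
Proof.
rewrite dvd_norm -separable_prod_XsubC -frs unlock => /hasPn H.
apply: Pdiv.ClosedField.root_coprimep => x fx; rewrite deriv_map; apply: H.
by rewrite mem_rs -rootE.
Qed.

(** Two distinct common roots give two independent eigenvectors for the eigenvalue 0 of the reduced
    matrix. Its rank over F_p does not change in K, so that its corank is at least 2. *)
Lemma dvd2_norm g x y : x \in rs -> y \in rs -> x != y ->
  (zpoly K g).[x] = 0 -> (zpoly K g).[y] = 0 -> (p%:Z ^+ 2 %| norm n f g)%Z.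
Proof.
move=> xrs yrs xy gx gy; apply: det_corank2 => //.
rewrite -(mxrank_map iota) -map_mx_comp.
have -> : map_mx (iota \o intmul 1) (horner_mx (compmx n f) g) =
   horner_mx (compmx n (zpoly K f)) (zpoly K g).
  rewrite -map_compmx -map_horner_mx; apply: eq_map_mx => z /=.
  by rewrite rmorph_int.
pose G := row_mx (powcol n x) (powcol n y).
have G2 : \rank G = 2%N.
  rewrite -mxrank_tr; apply/eqP; rewrite -/(row_free G^T) -kermx_eq0.
  apply/rowV0P => u /sub_kermxP; rewrite /G tr_row_mx => uG.
  have E k : (k < n.+1)%N -> u 0 0 * x ^+ k + u 0 1 * y ^+ k = 0.
    move=> kn; have /rowP/(_ (Ordinal kn)) := uG.
    rewrite !mxE big_ord_recl big_ord1 !mxE.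
    case: splitP => // j _; rewrite !mxE; case: splitP => [|j' _]; first by case=> [[]].
    by rewrite !mxE /= => <-; congr (_ + u 0 _ * _); apply: val_inj.
  have n1 : (1 < n.+1)%N.
    rewrite -size_rs; move: xrs yrs xy; case: (rs) => [|a [|b s]] //=.
    by rewrite !inE => /eqP -> /eqP ->; rewrite eqxx.
  have := E 0%N isT; have := E 1%N n1; rewrite !expr0 !expr1 !mulr1 => E1 E0.
  have u1 : u 0 1 = 0.
    have : u 0 1 * (y - x) = 0.
      transitivity ((u 0 0 * x + u 0 1 * y) - x * (u 0 0 + u 0 1)); first ring.
      by rewrite E1 E0 mulr0 subr0.
    by move/eqP; rewrite mulf_eq0 subr_eq0 [y == x]eq_sym (negPf xy) orbF => /eqP.
  have u0 : u 0 0 = 0 by move: E0; rewrite u1 addr0.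
  apply/rowP => j; rewrite mxE; case: j => [[|[|]]] //= lt2.
    by rewrite -[RHS]u0; congr (u 0 _); apply: val_inj.
  by rewrite -[RHS]u1; congr (u 0 _); apply: val_inj.
have AG : horner_mx (compmx n (zpoly K f)) (zpoly K g) *m G = 0.
  have rt z : z \in rs -> (zpoly K f).[z] = 0 by rewrite mem_rs => /eqP.
  rewrite /G mul_mx_row !(horner_mx_powcol monic_zpoly size_zpoly) ?rt //.
  by rewrite gx gy !scale0r row_mx0.
by have := mulmx0_rank_max AG; rewrite G2.
Qed.

(** Modulo p^2 one has N(g) = g(r) d with d the cofactor of [norm_root], so it suffices that d is
    prime to p. This holds because the roots of f modulo p are distinct and g vanishes at no other
    root than x. *)
Lemma dvd2_norm_lift g (r : int) : uniq rs -> r%:~R \in rs ->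
  (forall y, y \in rs -> (zpoly K g).[y] = 0 -> y = r%:~R) ->
  (p%:Z ^+ 2 %| f.[r])%Z -> (p%:Z ^+ 2 %| norm n f g)%Z -> (p%:Z ^+ 2 %| g.[r])%Z.
Proof.
move=> urs; set x := r%:~R => xrs gx fr.
have rt z : z \in rs -> (zpoly K f).[z] = 0 by rewrite mem_rs => /eqP.
have p2 : (1 < p ^ 2)%N by rewrite -(exp1n 2) ltn_exp2r // prime_gt1.
have E : p%:Z ^+ 2 = (p ^ 2)%N by rewrite expr2 expnS expn1 PoszM.
have := norm_congr g p2 fmon szf; rewrite -E => /(_ _ fr); set d := \det _ => cong Ng.
have : (p%:Z ^+ 2 %| g.[r] * d)%Z by rewrite -(rpredBl _ Ng).
rewrite Gauss_dvdzl // coprimezE abszX coprimeXl //= prime_coprime //.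
rewrite -[X in ~~ X]/(p %| d)%Z dvdz_closure.
pose A := horner_mx (compmx n (zpoly K f)) (zpoly K g).
have -> : d%:~R = \det (basis_at x A).
  pose h : {rmorphism int -> K} := intmul (1 : K).
  rewrite -[LHS]/(h _) -det_map_mx; congr (\det _).
  apply/matrixP => i j; rewrite !mxE /A -map_compmx -map_horner_mx.
  by rewrite (fun_if h) rmorphXn mxE.
(* A row w that kills [basis_at x A] is orthogonal to the powers of x, and w A vanishes outside its
   first entry. Since w A is then orthogonal to the powers of x as well, and their first entry is 1,
   w A = 0. *)
apply/det0P => -[w w0 wB].
have wA j : (w *m A) 0 j = (w *m basis_at x A) 0 j +
    (if j == 0 then (w *m A) 0 j - (w *m powcol n x) 0 0 else 0).
  have [j0|nj0] := eqVneq j 0.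
    rewrite addrC -[LHS]addr0 -addrA; congr (_ + _); apply/esym/eqP.
    rewrite addrC subr_eq0; apply/eqP; rewrite !mxE.
    by apply: eq_bigr => k _; rewrite !mxE j0 eqxx.
  by rewrite addr0 !mxE; apply: eq_bigr => k _; rewrite !mxE (negPf nj0).
have wx : w *m powcol n x = 0.
  apply/matrixP => i j; rewrite !ord1 [RHS]mxE; have /rowP/(_ 0) := wB; rewrite [RHS]mxE => <-.
  by rewrite !mxE; apply: eq_bigr => k _; rewrite !mxE.
have wA0 : w *m A = 0.
  have z j : j != 0 -> (w *m A) 0 j = 0.
    by move=> /negPf j0; rewrite wA wB j0 addr0 mxE.
  apply/rowP => j; rewrite [RHS]mxE; have [->|/z //] := eqVneq j 0.
  have := congr1 (fun B => (B *m powcol n x) 0 0) (erefl (w *m A)).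
  rewrite -{1}mulmxA (horner_mx_powcol monic_zpoly size_zpoly) ?rt //.
  rewrite -scalemxAr wx scaler0 mxE mxE big_ord_recl big1 ?addr0 => [|i _].
    by rewrite [powcol _ _ _ _]mxE expr0 mulr1.
  by rewrite z ?mul0r.
(* The polynomial with coefficient vector w has degree at most n and vanishes at the n + 1 roots of
   f: for y other than x, w A = 0 says that g(y) times its value at y is zero, and g(y) is not. *)
have Wy y : y \in rs -> (rVpoly w).[y] = 0.
  move=> yrs; have -> : (rVpoly w).[y] = (w *m powcol n y) 0 0.
    rewrite (horner_coef_wide _ (size_poly _ _)) mxE.
    by apply: eq_bigr => k _; rewrite coef_rVpoly_ord mxE.
  have [->|yx] := eqVneq y x; first by rewrite wx mxE.
  have := congr1 (fun B => (B *m powcol n y) 0 0) wA0.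
  rewrite -mulmxA (horner_mx_powcol monic_zpoly size_zpoly) ?rt //.
  rewrite -scalemxAr mul0mx !mxE => /eqP; rewrite mulf_eq0 => /orP[/eqP/gx|/eqP //].
  by move=> /(_ yrs) /eqP; rewrite (negPf yx).
have /eqP : rVpoly w = 0.
  apply/eqP; apply: contraT => W0.
  have := max_poly_roots W0 _ urs; rewrite size_rs ltnNge size_poly; apply.
  by apply/allP => y /Wy /eqP.
by move/eqP => W0; move: w0; rewrite -(rVpolyK w) W0 linear0 eqxx.
Qed.

(* If g and h have a single common root x with f modulo p, then x comes from F_p and
   lifts to a root r of f modulo p^2; N(g) is then g(r) times a unit modulo p^2, so that
   p^2 divides g(r), and likewise h(r). *)
Lemma dvd2_normB g h : ~~ (p %| norm n f f^`())%Z ->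
  (forall x, x \in rs -> ((zpoly K g).[x] == 0) = ((zpoly K h).[x] == 0)) ->
  (p%:Z ^+ 2 %| norm n f g)%Z -> (p%:Z ^+ 2 %| norm n f h)%Z ->
  (p%:Z ^+ 2 %| norm n f (g - h))%Z.
Proof.
move=> f' gh Ng Nh; have urs := dvd_norm_deriv_uniq f'.
have : (p %| norm n f g)%Z by apply: dvdz_trans Ng; rewrite expr2 dvdz_mulr.
rewrite dvd_norm => /hasP[x xrs /eqP gx].
have hx : (zpoly K h).[x] = 0 by apply/eqP; rewrite -gh // gx.
have ghB z : (zpoly K g).[z] = 0 -> (zpoly K h).[z] = 0 ->  (zpoly K (g - h)).[z] = 0.
  by move=> gz hz; rewrite rmorphB /= hornerD hornerN gz hz subrr.
have [/hasP[y yrs /andP[yx /eqP gy]]|/hasPn uq] :=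
    boolP (has (fun y => (y != x) && ((zpoly K g).[y] == 0)) rs).
  have hy : (zpoly K h).[y] = 0 by apply/eqP; rewrite -gh // gy.
  by apply: (@dvd2_norm _ y x) => //; exact: ghB.
have uqg y : y \in rs -> (zpoly K g).[y] = 0 -> y = x.
  by move=> yrs gy; apply/eqP; have := uq y yrs; rewrite gy eqxx andbT negbK.
have [r rx] : exists r : int, r%:~R = x.
  apply: intr_frob_fixed; apply: uqg; last exact: root_zpoly_frob.
  by rewrite mem_rs root_zpoly_frob //; apply/eqP; rewrite -mem_rs.
have fr : (p %| f.[r])%Z.
  by rewrite dvdz_closure -[_%:~R](horner_map (intmul 1)) /= rx -mem_rs.
have f'r : ~~ (p %| f^`().[r])%Z.
  rewrite dvdz_closure -[_%:~R](horner_map (intmul 1)) /= rx.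
  by move: f'; rewrite dvd_norm => /hasPn; apply.
have [s [sr fs]] := hensel_lift pp fr f'r.
have sx : s%:~R = x.
  by apply/eqP; rewrite -rx -subr_eq0 -rmorphB /= -dvdz_closure.
have gs : (p%:Z ^+ 2 %| g.[s])%Z.
  by apply: dvd2_norm_lift => //; rewrite sx.
have hs : (p%:Z ^+ 2 %| h.[s])%Z.
  apply: dvd2_norm_lift => //; rewrite ?sx // => y yrs hy.
  by apply: uqg => //; apply/eqP; rewrite gh // hy.
have p2 : (1 < p ^ 2)%N by rewrite -(exp1n 2) ltn_exp2r // prime_gt1.
have E : p%:Z ^+ 2 = (p ^ 2)%N by rewrite expr2 expnS expn1 PoszM.
have := norm_congr (g - h) p2 fmon szf; rewrite -E => /(_ _ fs) cong.
rewrite -[norm _ _ _](subrK ((g - h).[s] * \det (basis_at s (horner_mx (compmx n f) (g - h))))).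
by rewrite rpredD // dvdz_mulr // hornerD hornerN rpredB.
Qed.
End ModP.

(** * Sizes of norms *)

(** Says that f is the minimal polynomial of each of its roots: irreducibility in the form that
    makes norms of nonzero polynomials of smaller degree nonzero. *)
Definition zirreducible (f : {poly int}) : Prop :=
  f \is monic /\ forall (x : algC) (g : {poly int}),
    root (zpoly algC f) x -> root (zpoly algC g) x -> (size g < size f)%N -> g = 0.

Definition box_poly (n H : nat) (t : {ffun 'I_n.+1 -> 'I_H}) : {poly int} :=
  \poly_(i < n.+1) (t (inord i) : nat)%:Z.

Lemma size_box_poly n H (t : {ffun 'I_n.+1 -> 'I_H}) : (size (box_poly t) <= n.+1)%N.
Proof. exact: size_poly. Qed.

Lemma coef_box_poly n H (t : {ffun 'I_n.+1 -> 'I_H}) (i : 'I_n.+1) :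
  (box_poly t)`_i = (t i : nat)%:Z.
Proof. by rewrite coef_poly ltn_ord inord_val. Qed.

Lemma box_poly_inj n H : injective (@box_poly n H).
Proof.
move=> t u tu; apply/ffunP => i; apply: val_inj.
by have := congr1 (fun g : {poly int} => g`_i) tu; rewrite !coef_box_poly => -[].
Qed.

Lemma expnD_le a b d : ((a + b) ^ d <= 2 ^ d * (a ^ d + b ^ d))%N.
Proof.
wlog ab : a b / (a <= b)%N.
  by move=> H; case/orP: (leq_total a b) => /H //; rewrite addnC [(a ^ d + _)%N]addnC.
apply: (@leq_trans ((2 * b) ^ d)).
  by case: d => // d; rewrite leq_exp2r // mul2n -addnn leq_add2r.
by rewrite expnMn leq_mul2l leq_addl orbT.
Qed.

Lemma absz_sub_divn (a b l : nat) : (0 < l)%N -> (a %/ l = b %/ l)%N ->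
  (absz (a%:Z - b%:Z) <= l)%N.
Proof.
move=> l0 E; rewrite {1}(divn_eq a l) {1}(divn_eq b l) E.
have := ltn_pmod a l0; have := ltn_pmod b l0.
move: (a %% l)%N (b %% l)%N (_ * l)%N; lia.
Qed.

Section Bounds.
Variables (n : nat) (f : {poly int}).
Hypotheses (firr : zirreducible f) (szf : size f = n.+2).

Lemma zpoly_algC_split : exists2 rs : seq algC,
  zpoly algC f = \prod_(x <- rs) ('X - x%:P) & size rs = n.+1.
Proof.
have [rs Drs] := closed_field_poly_normal (zpoly algC f).
have [fmon _] := firr.
have mon : zpoly algC f \is monic by exact: monic_map.
rewrite (monicP mon) scale1r in Drs; exists rs => //.
apply/eqP; rewrite -eqSS -(size_prod_XsubC _ id) -Drs size_map_poly_id0 ?szf //.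
by rewrite (monicP fmon) oner_eq0.
Qed.

Lemma norm_algC rs g : zpoly algC f = \prod_(x <- rs) ('X - x%:P) ->
  (norm n f g)%:~R = \prod_(x <- rs) (zpoly algC g).[x].
Proof.
move=> Df; have szC : size (zpoly algC f) = n.+2.
  by rewrite size_map_poly_id0 // (monicP (proj1 firr)) oner_eq0.
by rewrite -(norm_prod (zpoly algC g) Df szC); exact: (map_norm (intmul (1 : algC))).
Qed.

Lemma norm_neq0 (g : {poly int}) : g != 0 -> (size g <= n.+1)%N -> norm n f g != 0.
Proof.
have [rs Df _] := zpoly_algC_split; have [fmon firr'] := firr.
move=> g0 szg; rewrite -(intr_eq0 algC) (norm_algC _ Df) prodf_seq_neq0.
apply/allP => x xrs /=; apply: contra g0 => gx; apply/eqP/(firr' x) => //.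
  by rewrite Df root_prod_XsubC.
by rewrite szf ltnS.
Qed.

Lemma horner_bound (rs : seq algC) : exists2 B : nat, (0 < B)%N &
  forall (x : algC) (g : {poly int}) (H : nat), x \in rs -> (size g <= n.+1)%N ->
    (forall i, (absz (g`_i)%R <= H)%N) -> `|(zpoly algC g).[x]| <= (B * H)%:R.
Proof.
pose s := \sum_(x <- rs) \sum_(i < n.+1) `|x| ^+ i : algC.
have s0 (r : seq algC) : 0 <= \sum_(x <- r) \sum_(i < n.+1) `|x| ^+ i.
  by apply: sumr_ge0 => x _; apply: sumr_ge0 => i _; rewrite exprn_ge0.
exists (Num.bound s).+1 => // x g H xrs szg gH.
have szg' : (size (zpoly algC g) <= n.+1)%N.
  by apply: leq_trans szg; exact: size_poly.
rewrite (horner_coef_wide _ szg') (le_trans (ler_norm_sum _ _ _)) //.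
apply: (@le_trans _ _ (\sum_(i < n.+1) H%:R * `|x| ^+ i)).
  apply: ler_sum => i _; rewrite normrM normrX ler_wpM2r ?exprn_ge0 //.
  by rewrite coef_map /= -intr_norm pmulrn ler_int -abszE; exact: gH.
rewrite -mulr_sumr mulrC natrM ler_wpM2r ?ler0n //.
apply: (@le_trans _ _ s).
  rewrite /s (big_rem x) //= lerDl; exact: s0.
apply: ltW; apply: lt_trans (archi_boundP _) _; last by rewrite ltr_nat.
exact: s0.
Qed.

Lemma prod_norm_bounds (F : numFieldType) (T : eqType) (rs : seq T) (h : T -> F) (a b : F) :
  0 <= a -> (forall x, x \in rs -> a <= `|h x| <= b) ->
  a ^+ size rs <= `|\prod_(x <- rs) h x| <= b ^+ size rs.
Proof.
move=> a0; elim: rs => [|x rs IH] H; first by rewrite big_nil normr1 expr0 lexx.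
have /andP[ax xb] := H x (mem_head _ _).
have /IH/andP[lo hi] : forall y, y \in rs -> a <= `|h y| <= b.
  by move=> y yrs; apply: H; rewrite inE yrs orbT.
by rewrite big_cons normrM !exprS !ler_pM ?exprn_ge0.
Qed.

(** The first bound multiplies the bounds at the roots. In the second, a constant term l >= 2 B H
    dominates: every value at a root has absolute value between l/2 and 2 l, which bounds the norm
    from below too. *)
Lemma norm_bounds : exists2 B : nat, (0 < B)%N &
  (forall (g : {poly int}) (H : nat), (size g <= n.+1)%N ->
     (forall i, (absz (g`_i)%R <= H)%N) -> (absz (norm n f g) <= (B * H) ^ n.+1)%N) /\
  (forall (l : nat) (g : {poly int}) (H : nat), (size g <= n.+1)%N ->
     (forall i, (absz (g`_i)%R <= H)%N) -> (2 * (B * H) <= l)%N ->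
     (l ^ n.+1 <= 2 ^ n.+1 * absz (norm n f (l%:Z%:P + g)))%N /\
     (absz (norm n f (l%:Z%:P + g)) <= (2 * l) ^ n.+1)%N).
Proof.
have [rs Df szrs] := zpoly_algC_split; have [B B0 HB] := horner_bound rs.
have absE z : (absz z)%:R = `|z%:~R| :> algC by rewrite -intr_norm pmulrn abszE.
exists B => //; split=> [g H szg gH|l g H szg gH Hl].
  rewrite -(ler_nat algC) absE (norm_algC _ Df) natrX -szrs.
  have bnd x : x \in rs -> 0 <= `|(zpoly algC g).[x]| <= (B * H)%:R.
    by move=> xrs; rewrite normr_ge0 HB.
  by case/andP: (prod_norm_bounds (lexx 0) bnd).
have bnd x : x \in rs -> (l%:R / 2) <= `|(zpoly algC (l%:Z%:P + g)).[x]| <= (2 * l)%:R.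
  move=> xrs; have := HB x g H xrs szg gH.
  rewrite rmorphD /= map_polyC /= hornerD hornerC -[l%:~R]/(l%:R); set y := _.[x] => yBH.
  have BHl : (B * H)%:R <= l%:R / 2 :> algC.
    by rewrite ler_pdivlMr ?ltr0n // -natrM ler_nat mulnC.
  apply/andP; split.
    have := lerB_normD (l%:R : algC) y; rewrite normr_nat; apply: le_trans.
    rewrite lerBrDr; apply: (@le_trans _ _ (l%:R / 2 + l%:R / 2)).
      by rewrite lerD2l (le_trans yBH).
    by rewrite -splitr.
  apply: le_trans (ler_normD _ _) _; rewrite normr_nat natrM mulr_natl mulr2n lerD2l.
  apply: le_trans yBH (le_trans BHl _); rewrite ler_pdivrMr ?ltr0n // ler_peMr ?ler0n //.
  by rewrite ler1n.
have l2 : 0 <= l%:R / 2 :> algC by rewrite divr_ge0 ?ler0n.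
have := prod_norm_bounds l2 bnd; rewrite szrs -(norm_algC _ Df) -absE.
rewrite -natrX ler_nat => /andP[lo ->]; split=> //.
rewrite -(ler_nat algC) natrM !natrX; move: lo.
by rewrite exprMn exprVn ler_pdivrMr ?exprn_gt0 ?ltr0n // mulrC.
Qed.

(** Cut the box into cells of side l. For two members of L in one cell, the norm of the difference
    is a multiple of D smaller than D, hence zero, and they coincide; so |L| is at most the number
    of cells. *)
Lemma spacing : exists2 K : nat, (0 < K)%N &
  forall (D H : nat) (L : {set {ffun 'I_n.+1 -> 'I_H}}), (0 < D)%N ->
    (forall t u, t \in L -> u \in L -> (D %| norm n f (box_poly t - box_poly u))%Z) ->
    (#|L| * D <= K * (H ^ n.+1 + D))%N.
Proof.
have [B B0 [HB _]] := norm_bounds; set d := n.+1.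
pose C := (B ^ d)%N; have C0 : (0 < C)%N by rewrite expn_gt0 B0.
(* One factor [2 ^ d] pays for the maximality of the side l, the other for expanding (H + l)^d. *)
exists (C * 4 ^ d)%N => [|D H L D0 DL]; first by rewrite muln_gt0 C0 expn_gt0.
have cardB m : #|{ffun 'I_d -> 'I_m}| = (m ^ d)%N by rewrite card_ffun !card_ord.
(* If D <= C, no side works, and the volume of the box is a sufficient bound. *)
have [DC|CD] := leqP D C.
  apply: (@leq_trans (H ^ d * C)); first by rewrite leq_mul // -cardB max_card.
  rewrite mulnC -mulnA leq_mul2l (leq_trans (leq_addr D _)) ?orbT //.
  by rewrite leq_pmull // expn_gt0.
(* The sides for which norms inside a cell stay below D; the largest is taken, so that 2 l already
   fails and D <= C (2 l)^d. *)
pose P l := (C * l ^ d < D)%N.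
have Pbound l : P l -> (l <= D)%N.
  rewrite /P => lD; apply: leq_trans (ltnW lD).
  case: l lD => // l _; rewrite (leq_trans _ (leq_pmull _ C0)) //.
  by rewrite /d expnS leq_pmulr // expn_gt0.
have P1 : P 1%N by rewrite /P exp1n muln1.
have exP : exists l, P l by exists 1%N.
case: (ex_maxnP exP Pbound) => l Pl lmax.
have l0 : (0 < l)%N by apply: lmax.
have Dl : (D <= C * (2 ^ d * l ^ d))%N.
  rewrite leqNgt -expnMn; apply/negP => /(lmax _); lia.
pose q := (H %/ l)%N.
pose F (t : {ffun 'I_d -> 'I_H}) : {ffun 'I_d -> 'I_q.+1} := [ffun i => inord (t i %/ l)%N].
have qb (t : {ffun 'I_d -> 'I_H}) i : (t i %/ l < q.+1)%N.
  by rewrite ltnS leq_div2r // ltnW // ltn_ord.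
have Finj : {in L &, injective F}.
  move=> t u tL uL /ffunP Ftu; apply: (@box_poly_inj n H).
  apply/eqP; rewrite -subr_eq0; apply: contraT => tu0.
  have szB : (size (box_poly t - box_poly u)%R <= n.+1)%N.
    by apply: leq_trans (size_polyD _ _) _; rewrite geq_max size_polyN !size_box_poly.
  have := norm_neq0 tu0 szB; have := DL t u tL uL.
  rewrite dvdzE /= => Dv N0.
  have : (absz (norm n f (box_poly t - box_poly u)%R) <= (B * l) ^ n.+1)%N.
    apply: HB => // i; have [ni|ni] := leqP n.+1 i.
      by rewrite nth_default // (leq_trans szB).
    rewrite -[i]/(val (Ordinal ni)) coefB !coef_box_poly.
    have := Ftu (Ordinal ni); rewrite !ffunE => /(congr1 (@nat_of_ord _)).
    rewrite !(inordK (qb _ _)) => E.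
    exact: absz_sub_divn E.
  rewrite expnMn => le; have := dvdn_leq _ Dv; rewrite absz_gt0 N0 => /(_ isT) leD.
  by have := leq_trans leD le; rewrite leqNgt -/C -/(P l) Pl.
have cardL : (#|L| <= q.+1 ^ d)%N.
  by rewrite -cardB -(card_in_imset Finj) max_card.
apply: (@leq_trans (q.+1 ^ d * (C * (2 ^ d * l ^ d)))); first exact: leq_mul.
have -> : (q.+1 ^ d * (C * (2 ^ d * l ^ d)) = C * 2 ^ d * (l * q.+1) ^ d)%N.
  by rewrite [((_ * _) ^ d)%N]expnMn; lia.
have lq : (l * q.+1 <= H + l)%N by rewrite mulnS addnC leq_add2r mulnC leq_divM.
apply: (@leq_trans (C * 2 ^ d * (2 ^ d * (H ^ d + l ^ d)))).
  by rewrite leq_mul2l (leq_trans _ (expnD_le _ _ _)) ?orbT // leq_exp2r.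
rewrite mulnA -[(C * 2 ^ d * 2 ^ d)%N]mulnA -expnMn leq_mul2l leq_add2l.
apply/orP; right; apply: leq_trans (ltnW Pl); exact: leq_pmull.
Qed.

End Bounds.

(** * Counting sets of primes with chosen roots *)

Lemma leq_card_fibres (T U : finType) (A : {set T}) (B : {set U}) (R : T -> U -> bool) k :
  (forall x, x \in A -> exists2 u, u \in B & R x u) ->
  (forall u, u \in B -> (#|[set x in A | R x u]| <= k)%N) -> (#|A| <= k * #|B|)%N.
Proof.
move=> AR Rk; rewrite -sum1_card.
apply: (@leq_trans (\sum_(x in A) \sum_(u in B) R x u)).
  by apply: leq_sum => x /AR[u uB xu]; rewrite (bigD1 u) //= xu.
rewrite exchange_big /= mulnC -sum_nat_const; apply: leq_sum => u /Rk.
rewrite -sum1_card big_mkcond [X in (_ <= X -> _)%N]/=; apply: leq_trans.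
rewrite [X in (X <= _)%N]big_mkcond /=; apply: leq_sum => x _.
by rewrite inE; case: (x \in A) => //=; case: (R x u).
Qed.

Lemma prod_primes_dvd (I : finType) (P : pred I) (F : I -> nat) (m : nat) :
  {in P &, injective F} -> (forall i, P i -> prime (F i) /\ F i %| m)%N ->
  (\prod_(i | P i) F i %| m)%N.
Proof.
move=> Finj FP; rewrite -big_filter.
have : {subset [seq i <- index_enum I | P i] <= P} by move=> i; rewrite mem_filter => /andP[].
have : uniq [seq i <- index_enum I | P i] by rewrite filter_uniq // index_enum_uniq.
elim: [seq _ <- _ | _] => [|i s IH] /=; first by rewrite big_nil dvd1n.
move=> /andP[si us] sP; have sP' : {subset s <= P} by move=> j js; apply: sP; rewrite inE js orbT.
have Pi : P i by apply: sP; rewrite mem_head.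
have [pi mi] := FP i Pi.
rewrite big_cons Gauss_dvd ?mi ?IH //.
rewrite prime_coprime //; apply/negP; rewrite big_seq.
elim/big_rec: _ => [|j x js nx]; first by rewrite Euclid_dvd1.
rewrite Euclid_dvdM // => /orP[|//]; have [pj _] := FP j (sP' j js).
rewrite dvdn_prime2 // => /eqP /Finj E; move: si; rewrite E ?js //; exact: sP'.
Qed.

Lemma closure_Fp (p : nat) : {K : closedFieldType & {rmorphism 'F_p -> K}}.
Proof.
by have [K [h _]] := countable_algebraic_closure 'F_p; exists K.
Qed.

Definition zroot (f : {poly int}) (p r : nat) : bool := (r < p)%N && (p %| f.[r%:Z])%Z.

(* A set I of primes p > y with a root of f modulo p for each p in I: phi p = None
   means that p is not in I. *)
Definition config (f : {poly int}) (y X : nat) : {set {ffun 'I_X -> option 'I_X}} :=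
  [set phi : {ffun 'I_X -> option 'I_X} | [forall p : 'I_X, if phi p is Some r
     then [&& (y < p)%N, prime p & zroot f p r] else true]].

Definition cprod X (phi : {ffun 'I_X -> option 'I_X}) : nat :=
  (\prod_(p < X | phi p) p)%N.

Lemma configP f y X phi : phi \in config f y X ->
  forall p r, phi p = Some r -> [/\ (y < p)%N, prime p & zroot f p r].
Proof. by rewrite inE => /forallP H p r E; have := H p; rewrite E => /and3P. Qed.

Lemma config_some f y X phi p : phi \in config f y X -> phi p ->
  exists2 r, phi p = Some r & [/\ (y < p)%N, prime p & zroot f p r].
Proof. by move=> C; case E: (phi p) => [r|//] _; exists r => //; exact: (configP C). Qed.

Lemma cprod_gt0 f y X phi : phi \in config f y X -> (0 < cprod phi)%N.
Proof.
move=> C; rewrite /cprod prodn_cond_gt0 // => p /(config_some C)[r _ [_ pp _]].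
exact: prime_gt0.
Qed.

Lemma cprod_dvd f y X phi m : phi \in config f y X ->
  (forall p r, phi p = Some r -> (p %| m)%N) -> (cprod phi %| m)%N.
Proof.
move=> C H; apply: prod_primes_dvd => [p q _ _ /val_inj //|p pP].
by have [r E [_ pp _]] := config_some C pP; split=> //; exact: H E.
Qed.

Lemma dvd_cprod f y X phi (p : 'I_X) : phi \in config f y X -> prime p ->
  (p %| cprod phi)%N = phi p :> bool.
Proof.
move=> C pp; apply/idP/idP => [|pP]; last by rewrite /cprod (bigD1 p) //= dvdn_mulr.
rewrite /cprod; elim/big_rec: _ => [|q x qP IH]; first by rewrite Euclid_dvd1.
rewrite Euclid_dvdM // => /orP[|//]; have [r _ [_ pq _]] := config_some C qP.
by rewrite dvdn_prime2 // => /eqP/val_inj ->.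
Qed.

Lemma cprod_sqfree f y X phi (p : 'I_X) : phi \in config f y X -> phi p ->
  ~~ (p ^ 2 %| cprod phi)%N.
Proof.
move=> C pP; have [r _ [_ pp _]] := config_some C pP.
rewrite /cprod (bigD1 p) //= expnS expn1 dvdn_pmul2l ?prime_gt0 //.
elim/big_rec: _ => [|q x /andP[qP qp] IH]; first by rewrite Euclid_dvd1.
rewrite Euclid_dvdM // negb_or IH andbT; have [_ _ [_ pq _]] := config_some C qP.
by rewrite dvdn_prime2 // eq_sym.
Qed.

(** * Upper bound for the number of choices of roots *)

Section Upper.
Variables (n : nat) (f : {poly int}).
Hypotheses (firr : zirreducible f) (szf : size f = n.+2).

Lemma dvd_norm_zroot (p r : nat) (g : {poly int}) : prime p -> zroot f p r ->
  (p %| g.[r%:Z])%Z -> (p %| norm n f g)%Z.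
Proof.
move=> pp /andP[_ fr] gr.
have := norm_congr g (prime_gt1 pp) (proj1 firr) szf fr.
by rewrite rpredBr // dvdz_mulr.
Qed.

Lemma dvd2_norm_zroot (p r s : nat) (g : {poly int}) : prime p -> zroot f p r ->
  zroot f p s -> r != s -> (p %| g.[r%:Z])%Z -> (p %| g.[s%:Z])%Z ->
  (p%:Z ^+ 2 %| norm n f g)%Z.
Proof.
move=> pp /andP[rp fr] /andP[sp fs] rs gr gs.
have [K iota] := closure_Fp p; have dv := dvdz_closure iota pp.
have [l Dl] := closed_field_poly_normal (zpoly K f).
have mon : zpoly K f \is monic by exact: monic_map (proj1 firr).
rewrite (monicP mon) scale1r in Dl.
have ev (h : {poly int}) (z : int) : (p %| h.[z])%Z -> (zpoly K h).[z%:~R] = 0.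
  by rewrite dv => /eqP <-; exact: (horner_map (intmul 1)).
apply: (dvd2_norm iota pp (proj1 firr) szf Dl (x := r%:Z%:~R) (y := s%:Z%:~R)).
- by rewrite (mem_rs Dl) ev.
- by rewrite (mem_rs Dl) ev.
- rewrite -subr_eq0 -rmorphB /= -dv; apply: contra rs => rs.
  by move: rs; rewrite -eqz_mod_dvd !modz_nat !modn_small.
- exact: ev.
- exact: ev.
Qed.
Lemma root_floor (d x : nat) : (0 < x)%N ->
  exists2 h, (0 < h)%N & (h ^ d.+1 <= x < h.+1 ^ d.+1)%N.
Proof.
move=> x0; pose P h := (h ^ d.+1 <= x)%N.
have P1 : P 1%N by rewrite /P exp1n.
have Pb h : P h -> (h <= x)%N.
  by apply: leq_trans; case: h => // h; rewrite expnS leq_pmulr // expn_gt0.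
have exP : exists h, P h by exists 1%N.
case: (ex_maxnP exP Pb) => h Ph hmax; exists h; first exact: hmax.
by rewrite -/(P h) Ph /= ltnNge -/(P h.+1); apply/negP => /hmax; rewrite ltnn.
Qed.

Lemma card_lt_ord (X m : nat) : (m <= X)%N -> #|[pred s : 'I_X | (s < m)%N]| = m.
Proof.
move=> mX; rewrite -sum1_card -[RHS](card_ord m) -[RHS]sum1_card.
by rewrite (big_ord_widen _ (fun=> 1%N) mX).
Qed.

Lemma absz_sub_le (a b h : nat) : (a < h.+1)%N -> (b < h.+1)%N ->
  (absz (a%:Z - b%:Z) <= h)%N.
Proof. lia. Qed.

(** Pigeonhole: the polynomials with coefficients in [0, h] outnumber the systems of residues at the
    chosen roots, of which there are |I|; two of them agree, and g is their difference. *)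
Lemma config_box_kernel y X phi h : phi \in config f y X ->
  (cprod phi < h.+1 ^ n.+1)%N ->
  exists g : {poly int}, [/\ g != 0, (size g <= n.+1)%N,
    (forall i, (absz (g`_i)%R <= h)%N) &
    (forall p r, phi p = Some r -> (p %| g.[(r : nat)%:Z])%Z)].
Proof.
move=> C Nh.
(* Outside the support the value p is a dummy, which contributes a factor 1 to the size of
   [family G]. *)
pose F (t : {ffun 'I_n.+1 -> 'I_h.+1}) : {ffun 'I_X -> 'I_X} := [ffun p : 'I_X =>
  if phi p is Some r then insubd p (absz ((box_poly t).[(r : nat)%:Z] %% (p : nat))%Z) else p].
pose G (p : 'I_X) := if phi p then [pred s : 'I_X | (s < p)%N] else pred1 p.
have modlt (z : int) (p : 'I_X) : prime p -> (absz (z %% (p : nat))%Z < p)%N.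
  move=> /prime_gt0 p0; rewrite -ltz_nat gez0_abs ?ltz_pmod //.
  by rewrite modz_ge0 // -lt0n.
have FG t : F t \in family G.
  apply/familyP => p; rewrite ffunE /G; case E: (phi p) => [r|] /=; last by rewrite inE.
  have [_ pp _] := configP C E.
  rewrite inE val_insubd; case: ifP => [_|/negP[]]; first exact: modlt.
  exact: ltn_trans (modlt _ _ pp) (ltn_ord p).
have cardG : #|family G| = cprod phi.
  rewrite card_family foldrE big_image /cprod [RHS]big_mkcond /=.
  apply: eq_bigr => p _; rewrite /G; case: (isSome _); last by rewrite card1.
  exact: card_lt_ord (ltnW (ltn_ord p)).
have /injectivePn[t [u tu Ftu]] : ~~ injectiveb F.
  apply/negP => /injectiveP Finj; move: Nh; rewrite -cardG ltnNge.
  rewrite -{1}[h.+1]card_ord -{1}[n.+1]card_ord -card_ffun -(card_codom Finj).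
  by case/negP; apply/subset_leq_card/subsetP => _ /codomP[t ->].
have sz : (size (box_poly t - box_poly u)%R <= n.+1)%N.
  by apply: leq_trans (size_polyD _ _) _; rewrite geq_max size_polyN !size_box_poly.
exists (box_poly t - box_poly u); split=> // [|i|p r E].
- by rewrite subr_eq0; apply: contra tu => /eqP/box_poly_inj ->.
- have [ni|ni] := leqP n.+1 i; first by rewrite nth_default // (leq_trans sz).
  rewrite -[i]/(val (Ordinal ni)) coefB !coef_box_poly.
  exact: absz_sub_le (ltn_ord _) (ltn_ord _).
have [_ pp _] := configP C E.
have /ffunP/(_ p) := Ftu; rewrite !ffunE E => /(congr1 val) /=.
have lt z := ltn_trans (modlt z p pp) (ltn_ord p).
rewrite !val_insubd !lt => Em; rewrite hornerD hornerN -eqz_mod_dvd.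
have ge z : (0 <= z %% (p : nat))%Z by rewrite modz_ge0 // -lt0n prime_gt0.
by apply/eqP; rewrite -[LHS]gez0_abs // -[RHS]gez0_abs // Em.
Qed.

(** A choice is recorded by the pair (g, c) with g from [config_box_kernel] and c = |N(g)| / |I| <=
    B^d. The pair gives back |I|, hence I, and then the roots: two different roots modulo p would
    make p^2 divide c |I|, whereas p > B^d >= c > 0 and p divides |I| only once. *)
Lemma config_upper : exists C y0 : nat, (0 < C)%N /\
  forall y X x, (y0 <= y)%N -> (0 < x)%N ->
  (#|[set phi in config f y X | cprod phi <= x]| <= C * x)%N.
Proof.
have [B B0 [HB _]] := norm_bounds firr szf; set d := n.+1 in HB.
(* The coefficients of g lie in [-k, k], which has at most 3 k elements, with k^d <= x; the factor
   [(B ^ d).+1] counts the cofactors c. *)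
exists (3 ^ d * (B ^ d).+1)%N, (B ^ d)%N; split=> [|y X x yB x0].
  by rewrite muln_gt0 expn_gt0.
have [k k0 /andP[kx xk]] := root_floor n x0.
pose cg (a : {ffun 'I_d -> 'I_(2 * k).+1}) : {poly int} :=
  \poly_(i < d) ((a (inord i) : nat)%:Z - k%:Z).
pose R (phi : {ffun 'I_X -> option 'I_X}) (u : {ffun 'I_d -> 'I_(2 * k).+1} * 'I_(B ^ d).+1) :=
  [&& norm n f (cg u.1) != 0, absz (norm n f (cg u.1)) == (u.2 * cprod phi)%N &
   [forall p, if phi p is Some r then (p %| (cg u.1).[(r : nat)%:Z])%Z else true]].
set A := [set phi in _ | _].
apply: (@leq_trans (1 * #|[set: {ffun 'I_d -> 'I_(2 * k).+1} * 'I_(B ^ d).+1]|)).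
  apply: (@leq_card_fibres _ _ _ _ R) => [phi|[a c] _].
    rewrite in_set => /andP[C Nx].
    have N0 := cprod_gt0 C; have [h h0 /andP[hN Nh]] := root_floor n N0.
    have [g [g0 szg gh gr]] := config_box_kernel C Nh.
    have hk : (h <= k)%N.
      by rewrite -ltnS -(@ltn_exp2r _ _ n.+1) // (leq_ltn_trans hN) // (leq_ltn_trans Nx).
    pose a : {ffun 'I_d -> 'I_(2 * k).+1} := [ffun i : 'I_d => inord (absz (g`_i + k%:Z))].
    have cga : cg a = g.
      apply/polyP => i; rewrite coef_poly; case: ltnP => id; last first.
        by rewrite nth_default // (leq_trans szg).
      have gk := leq_trans (gh i) hk.
      have lt : (absz (g`_i + k%:Z)%R < (2 * k).+1)%N by move: gk; move: (g`_i)%R; lia.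
      rewrite ffunE (inordK id) (inordK lt).
      by move: gk; move: (g`_i)%R; lia.
    have ng0 : norm n f g != 0 by apply: norm_neq0.
    have dv : (cprod phi %| absz (norm n f g))%N.
      apply: (cprod_dvd C) => p r E; have [_ pp pr] := configP C E.
      exact: (dvd_norm_zroot pp pr (gr _ _ E)).
    have le : (absz (norm n f g) %/ cprod phi < (B ^ d).+1)%N.
      rewrite ltnS leq_divLR // (leq_trans (HB g h szg gh)) // expnMn leq_mul2l.
      by rewrite hN orbT.
    exists (a, Ordinal le) => //; apply/and3P; split; rewrite /= cga //.
      by rewrite divnK.
    by apply/forallP => p; case E: (phi p) => [r|//]; exact: gr.
  rewrite leqNgt; apply/negP => /card_gt1P[phi [psi []]].
  move=> /setIdP[/setIdP[C _] R1] /setIdP[/setIdP[C' _] R2].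
  case/and3P: R1 => ng0 /eqP E1 /forallP r1; case/and3P: R2 => _ /eqP E2 /forallP r2.
  case/negP; apply/eqP/ffunP => p.
  have c0 : (0 < c)%N by rewrite lt0n; apply: contra ng0 => /eqP c0; rewrite -absz_eq0 E1 c0.
  have cE : cprod phi = cprod psi by apply/eqP; rewrite -(eqn_pmul2l c0) -E1 E2.
  case Ep: (phi p) => [r|]; last first.
    case Eq: (psi p) => [s|//]; have [_ pp _] := configP C' Eq.
    by have := dvd_cprod C pp; rewrite cE (dvd_cprod C' pp) Ep Eq.
  have [yp pp pr] := configP C Ep.
  case Eq: (psi p) => [s|]; last first.
    by have := dvd_cprod C pp; rewrite cE (dvd_cprod C' pp) Ep Eq.
  have [_ _ ps] := configP C' Eq; congr Some; apply: val_inj; apply/eqP.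
  apply: contraT => rs; have := r1 p; have := r2 p; rewrite Ep Eq => gs gr.
  have := dvd2_norm_zroot pp pr ps rs gr gs; rewrite dvdzE abszX absz_nat E1 Gauss_dvdr.
    by rewrite (negPf (cprod_sqfree C _)) // Ep.
  rewrite coprimeXl // prime_coprime //; apply/negP => /(dvdn_leq c0).
  by have := ltn_ord c; lia.
rewrite mul1n cardsT card_prod card_ffun !card_ord.
rewrite mulnAC leq_mul2r; apply/orP; right.
apply: (@leq_trans ((3 * k) ^ d)); last by rewrite expnMn leq_mul2l kx orbT.
by rewrite leq_exp2r //; lia.
Qed.
End Upper.

(** * Lower bound for the number of choices by a squarefree sieve *)

Lemma sum_inv_sqr (y s : nat) : (0 < y)%N ->
  \sum_(y.+1 <= p < s.+1) (p%:R ^+ 2)^-1 <= (y%:R)^-1 :> rat.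
Proof.
move=> y0; suff : forall s, (y <= s)%N ->
    \sum_(y.+1 <= p < s.+1) (p%:R ^+ 2)^-1 <= y%:R^-1 - s%:R^-1 :> rat.
  move=> H; have [/H le|sy] := leqP y s.
    by apply: le_trans le _; rewrite lerBlDr lerDl invr_ge0 ler0n.
  by rewrite big_geq ?invr_ge0 ?ler0n // ltnS ltnW.
elim=> [|{}s IH]; first by rewrite leqn0 => /eqP y1; rewrite y1 in y0.
rewrite leq_eqVlt => /orP[/eqP <-|]; first by rewrite subrr big_geq.
rewrite ltnS => ys; rewrite big_nat_recr ?ltnS //=.
have s0 : 0 < s%:R :> rat by rewrite ltr0n (leq_trans y0).
have s1 : 0 < s.+1%:R :> rat by rewrite ltr0n.
apply: (@le_trans _ _ (y%:R^-1 - s%:R^-1 + (s%:R^-1 - s.+1%:R^-1))); last by rewrite addrA subrK.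
apply: lerD; first exact: IH.
have -> : s%:R^-1 - s.+1%:R^-1 = (s%:R * s.+1%:R)^-1 :> rat.
  by rewrite -natr1; field; rewrite natr1 !gt_eqF.
rewrite lef_pV2 ?posrE ?exprn_gt0 ?mulr_gt0 // expr2 ler_pM2r // ler_nat.
exact: leqnSn.
Qed.

Lemma prod_primes_sqfree (m X : nat) : (0 < m < X)%N ->
  (forall p, prime p -> ~~ (p ^ 2 %| m)%N) ->
  (\prod_(p < X | prime p && (p %| m)) p)%N = m.
Proof.
move=> /andP[m0 mX] sq; rewrite -[RHS](partnT m0) (@widen_partn X.-1); last lia.
rewrite prednK; last lia.
rewrite big_mkord [LHS]big_mkcond; apply: eq_bigr => p _ /=.
have [pp|np] := boolP (prime p); last by rewrite /logn (negPf np) expn0.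
have [pm|npm] /= := boolP (p %| m)%N; last by rewrite lognE (negPf npm) !andbF expn0.
have -> : logn p m = 1%N; last by rewrite expn1.
have := sq p pp; rewrite pfactor_dvdn // -ltnNge ltnS => le.
by apply/eqP; rewrite eqn_leq le -pfactor_dvdn.
Qed.

Section Lower.
Variables (n : nat) (f : {poly int}).
Hypotheses (firr : zirreducible f) (szf : size f = n.+2).

(** When p divides N(g) exactly once, f and g have a single common root modulo p. Frobenius permutes
    the common roots, so this one lies in F_p. *)
Lemma norm_simple_root (p : nat) (g : {poly int}) : prime p ->
  (p %| norm n f g)%Z -> ~~ (p%:Z ^+ 2 %| norm n f g)%Z ->
  exists2 r, zroot f p r & (p %| g.[r%:Z])%Z.
Proof.
move=> pp Ng Ng2.
have [K iota] := closure_Fp p; have dv := dvdz_closure iota pp.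
have [l Dl] := closed_field_poly_normal (zpoly K f).
have mon : zpoly K f \is monic by exact: monic_map (proj1 firr).
rewrite (monicP mon) scale1r in Dl.
have := Ng; rewrite (dvd_norm iota pp (proj1 firr) szf Dl) => /hasP[x xl /eqP gx].
have [r rx] : exists r : int, r%:~R = x.
  apply: (intr_frob_fixed iota pp); apply/eqP; apply: contraT => xpx.
  case/negP: Ng2; apply: (dvd2_norm iota pp (proj1 firr) szf Dl _ xl xpx) => //.
    by rewrite (mem_rs Dl) (root_zpoly_frob iota pp) //; apply/eqP; rewrite -(mem_rs Dl).
  exact: (root_zpoly_frob iota pp).
have p0 : p%:Z != 0 by rewrite -lt0n prime_gt0.
pose s := absz (r %% p)%Z.
have sE : s%:Z = (r %% p)%Z by rewrite gez0_abs // modz_ge0.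
have sx : s%:Z%:~R = x.
  apply/eqP; rewrite -rx -subr_eq0 -rmorphB /= -dv sE -eqz_mod_dvd modz_mod //.
have ev (h : {poly int}) : (zpoly K h).[x] = 0 -> (p %| h.[s%:Z])%Z.
  by move=> hx; rewrite dv -[_%:~R](horner_map (intmul 1)) /= sx hx.
exists s; last exact: ev.
rewrite /zroot ev ?andbT; last by apply/eqP; rewrite -(mem_rs Dl).
by rewrite -ltz_nat sE ltz_pmod ?ltz_nat ?prime_gt0.
Qed.

(** The polynomials are sorted by the set of roots of f modulo p at which they vanish. Inside each
    of these 2^(n+1) classes [dvd2_normB] makes the norms of differences divisible by p^2, so that
    [spacing] applies with D = p^2; Q is harmless, being prime to p. *)
Lemma sqfree_sieve : exists2 K : nat, (0 < K)%N &
  forall (p H : nat) (Q : int) (w : {ffun 'I_n.+1 -> 'I_H} -> {poly int})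
    (L : {set {ffun 'I_n.+1 -> 'I_H}}), prime p ->
    ~~ (p %| norm n f f^`())%Z -> ~~ (p %| Q)%Z ->
    (forall t u, w t - w u = Q *: (box_poly t - box_poly u)) ->
    (forall t, t \in L -> (p%:Z ^+ 2 %| norm n f (w t))%Z) ->
    (#|L| * p ^ 2 <= K * (H ^ n.+1 + p ^ 2))%N.
Proof.
have [K K0 HK] := spacing firr szf.
exists (K * #|{set 'I_n.+1}|)%N => [|p H Q w L pp pf pQ wB wL].
  by rewrite muln_gt0 K0; apply/card_gt0P; exists set0.
have [F iota] := closure_Fp p.
have [l Dl] := closed_field_poly_normal (zpoly F f).
have mon : zpoly F f \is monic by exact: monic_map (proj1 firr).
rewrite (monicP mon) scale1r in Dl.
have szl := size_rs (proj1 firr) szf Dl.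
pose J t : {set 'I_n.+1} := [set j : 'I_n.+1 | (zpoly F (w t)).[l`_j] == 0].
have cl (S : {set 'I_n.+1}) :
    (#|[set t in L | J t == S]| * p ^ 2 <= K * (H ^ n.+1 + p ^ 2))%N.
  apply: HK => [|t u]; first by rewrite expn_gt0 prime_gt0.
  move=> /setIdP[tL /eqP Jt] /setIdP[uL /eqP Ju].
  have : (p%:Z ^+ 2 %| norm n f (w t - w u))%Z.
    apply: (dvd2_normB iota pp (proj1 firr) szf Dl pf) => [x xl||]; last 2 first.
    - exact: wL.
    - exact: wL.
    have jlt : (index x l < n.+1)%N by rewrite -szl index_mem.
    have := Jt; rewrite -Ju => /setP/(_ (Ordinal jlt)).
    by rewrite !inE /= nth_index.
  rewrite wB -mul_polyC normM normC Gauss_dvdzr.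
    by rewrite expr2 expnS expn1 PoszM.
  rewrite coprimezE !abszX coprimeXl // coprimeXr //= prime_coprime //.
have -> : #|L| = (\sum_(S : {set 'I_n.+1}) #|[set t in L | J t == S]|)%N.
  rewrite -sum1_card (partition_big J xpredT) //=; apply: eq_bigr => S _.
  by rewrite -sum1_card; apply: eq_bigl => t; rewrite inE.
rewrite big_distrl /=.
apply: (@leq_trans (\sum_(S : {set 'I_n.+1}) K * (H ^ n.+1 + p ^ 2))).
  by apply: leq_sum => S _; exact: cl.
by rewrite sum_nat_const mulnCA mulnA.
Qed.

(** The sieve is summed over y < p <= s: up to the factor K, the terms H^(n+1)/p^2 add up to at most
    H^(n+1)/y, and the remaining terms 1 to at most s. *)
Lemma sieve_count : exists2 K : nat, (0 < K)%N &
  forall (y s H : nat) (Q : int) (w : {ffun 'I_n.+1 -> 'I_H} -> {poly int}), (0 < y)%N ->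
    (forall p, (y < p)%N -> prime p -> ~~ (p %| norm n f f^`())%Z /\ ~~ (p %| Q)%Z) ->
    (forall t u, w t - w u = Q *: (box_poly t - box_poly u)) ->
    #|[set t | [exists p : 'I_s.+1, [&& (y < p)%N, prime p &
         ((p : nat)%:Z ^+ 2 %| norm n f (w t))%Z]]]|%:R
      <= K%:R * ((H ^ n.+1)%:R / y%:R + s%:R) :> rat.
Proof.
have [K K0 HK] := sqfree_sieve; exists K => // y s H Q w y0 good wB.
set A := [set t | _]; pose Ap p := [set t | [&& (y < p)%N, prime p &
         (p%:Z ^+ 2 %| norm n f (w t))%Z]].
have cardA : (#|A| <= \sum_(p < s.+1) #|Ap p|)%N.
  rewrite -sum1_card.
  apply: (@leq_trans (\sum_(t in A) \sum_(p < s.+1) (t \in Ap p))).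
    apply: leq_sum => t; rewrite inE => /existsP[p pt].
    by rewrite (bigD1 p) //= inE pt.
  rewrite exchange_big /=; apply: leq_sum => p _; rewrite -sum1_card.
  rewrite [X in (_ <= X)%N]big_mkcond [X in (X <= _)%N]big_mkcond /=.
  apply: leq_sum => t _.
  by case: (t \in Ap p); case: ifP.
apply: (@le_trans _ _ (\sum_(p < s.+1) #|Ap p|%:R)); first by rewrite -natr_sum ler_nat.
pose F (p : nat) : rat := if (y < p)%N then K%:R * ((H ^ n.+1)%:R * (p%:R ^+ 2)^-1 + 1) else 0.
have FAp (p : 'I_s.+1) : #|Ap p|%:R <= F p.
  rewrite /F; case: ltnP => yp; last first.
    by rewrite (_ : Ap p = set0) ?cards0 //; apply/setP => t; rewrite !inE ltnNge yp.
  have p0 : (0 < p)%N by apply: leq_trans yp.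
  have [pp|np] := boolP (prime p); last first.
    rewrite (_ : Ap p = set0) ?cards0; last first.
      by apply/setP => t; rewrite !inE (negPf np) andbF.
    by rewrite mulr_ge0 ?addr_ge0 ?mulr_ge0 ?invr_ge0 ?exprn_ge0 ?ler0n.
  have [pf pQ] := good p yp pp.
  have := HK p H Q w (Ap p) pp pf pQ wB _.
  have wL t : t \in Ap p -> ((p : nat)%:Z ^+ 2 %| norm n f (w t))%Z by rewrite inE => /and3P[].
  move=> /(_ wL); rewrite -(ler_nat rat) natrM natrM natrD [(p ^ 2)%:R]natrX => le.
  have p2 : 0 < (p%:R ^+ 2 : rat) by rewrite exprn_gt0 // ltr0n.
  rewrite -(ler_pM2r p2) (le_trans le) // -mulrA mulrDl mul1r mulfVK ?(gt_eqF p2) //.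
apply: (@le_trans _ _ (\sum_(p < s.+1) F p)).
  by apply: ler_sum => p _; exact: FAp.
rewrite -(big_mkord xpredT F).
apply: (@le_trans _ _ (\sum_(y.+1 <= p < s.+1) K%:R * ((H ^ n.+1)%:R * (p%:R ^+ 2)^-1 + 1))).
  have [sy|ys] := leqP s.+1 y.+1.
    rewrite [X in _ <= X]big_geq // big_nat big1 // => p /andP[_ ps].
    by rewrite /F ltnNge -ltnS (leq_trans ps).
  rewrite (big_cat_nat (leq0n y.+1) (ltnW ys)) /= big_nat big1 ?add0r; last first.
    by move=> p /andP[_ py]; rewrite /F ltnNge -ltnS py.
  rewrite big_nat [X in _ <= X]big_nat; apply: ler_sum => p /andP[yp _].
  by rewrite /F yp.
rewrite -mulr_sumr ler_wpM2l ?ler0n // big_split /= -mulr_sumr lerD //.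
  by rewrite ler_wpM2l ?ler0n // sum_inv_sqr.
rewrite sumr_const_nat ler_nat; lia.
Qed.

(** In the family l + Q t, with t in the box, the sieve leaves at least half of the members with
    squarefree norm. Such a norm is the product |I| of a choice made of common roots of f and the
    member. By [spacing] with D = |I|, each choice arises boundedly often. *)
Lemma config_lower : exists K y0 : nat, (0 < K)%N /\ forall y, (y0 <= y)%N ->
  exists c1 c2 H0 : nat, [/\ (0 < c1)%N, (0 < c2)%N & forall H X, (H0 <= H)%N ->
    (c2 * H ^ n.+1 < X)%N ->
    (H ^ n.+1 <= K * #|[set phi in config f y X |
       (H ^ n.+1 <= c1 * cprod phi) && (cprod phi <= c2 * H ^ n.+1)]|)%N].
Proof.
have [K1 K10 HK1] := sieve_count; have [K2 K20 HK2] := spacing firr szf.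
have [B B0 [_ HB]] := norm_bounds firr szf.
pose d := n.+1; pose K3 := (K2 * (2 ^ d).+1)%N.
have norm_f' : norm n f f^`() != 0.
  apply: (norm_neq0 firr szf); last first.
    by rewrite -ltnS -szf lt_size_deriv // -size_poly_eq0 szf.
  apply/eqP => /(congr1 (fun g : {poly int} => g`_n)); rewrite coef_deriv coef0.
  have -> : f`_n.+1 = 1 by have := monicP (proj1 firr); rewrite lead_coefE szf.
  by move/eqP; rewrite pnatr_eq0.
(* With y >= 4 [K1] the sum of inverse squares costs at most a quarter of the box; y >= |N(f')|
   keeps the primes beyond y away from N(f'). *)
exists (2 * K3)%N, (maxn (absz (norm n f f^`())) (4 * K1))%N.
split; first by rewrite !muln_gt0 K20.
move=> y; rewrite geq_max => /andP[yf yK].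
have y0 : (0 < y)%N by lia.
(* As l is 1 modulo y!, the polynomials l + Q t are 1 modulo every p <= y, so that their norms have
   only prime factors beyond y. *)
pose Q := y`!; have Q0 : (0 < Q)%N by rewrite fact_gt0.
pose La := (1 + Q * (2 * B))%N.
(* The threshold on H makes [K1] s at most a quarter of H^d, where s is the integer square root of
   the bound M on the norms. *)
exists (2 ^ d)%N, ((2 * La) ^ d)%N, (maxn 1 ((4 * K1) ^ 2 * (2 * La) ^ d)).
split; rewrite ?expn_gt0 //= => H X; rewrite geq_max => /andP[H0 HH] XH.
set M := (_ * H ^ n.+1)%N in XH *.
pose l := (1 + Q * (2 * B) * H)%N.
pose w (t : {ffun 'I_d -> 'I_H}) : {poly int} := l%:Z%:P + Q%:Z *: box_poly t.
have wB t u : w t - w u = Q%:Z *: (box_poly t - box_poly u).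
  by rewrite /w scalerBr; ring.
have Nw t : (H ^ d <= 2 ^ d * absz (norm n f (w t)))%N /\ (absz (norm n f (w t)) <= M)%N.
  have sz : (size (Q%:Z *: box_poly t) <= n.+1)%N.
    by apply: leq_trans (size_scale_leq _ _) (size_box_poly t).
  have [||lo hi] := HB l (Q%:Z *: box_poly t) (Q * H)%N sz.
  - move=> i; rewrite coefZ abszM leq_mul // coef_poly; case: ifP => // _.
    exact: ltnW (ltn_ord _).
  - by rewrite /l; lia.
  split.
    apply: leq_trans lo; rewrite leq_exp2r // /l; nia.
  apply: leq_trans hi _; rewrite /M -expnMn leq_exp2r // /l /La; nia.
have Nw0 t : (0 < absz (norm n f (w t)))%N.
  have [lo _] := Nw t; rewrite lt0n; apply/eqP => N0; move: lo.
  by rewrite N0 muln0 leqn0 expn_eq0 /= andbT; lia.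
have Nw1 p t : prime p -> (p <= y)%N -> ~~ (p %| norm n f (w t))%Z.
  move=> pp py; have pQ : (p %| Q)%N by rewrite dvdn_fact // prime_gt0.
  rewrite (dvdz_pcharf (pchar_Fp pp)).
  have -> : (norm n f (w t))%:~R = norm n (zpoly 'F_p f) (zpoly 'F_p (w t)).
    exact: (map_norm (intmul (1 : 'F_p))).
  have Qp0 : Q%:Z%:~R = 0 :> 'F_p by apply/eqP; rewrite -(dvdz_pcharf (pchar_Fp pp)).
  have -> : zpoly 'F_p (w t) = 1%:P.
    rewrite /w rmorphD /= map_polyZ map_polyC /= Qp0 scale0r addr0.
    by rewrite /l -mulnA PoszD PoszM rmorphD rmorphM /= Qp0 mul0r addr0.
  by rewrite normC expr1n oner_eq0.
have good p : (y < p)%N -> prime p -> ~~ (p %| norm n f f^`())%Z /\ ~~ (p %| Q%:Z)%Z.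
  move=> yp pp; split.
    apply/negP; rewrite dvdzE => /dvdn_leq; rewrite absz_gt0 norm_f' => /(_ isT) /=.
    lia.
  rewrite -[X in ~~ X]/(p %| y`!)%N; apply/negP; rewrite fact_prod.
  rewrite big_nat; elim/big_rec: _ => [|i x /andP[i0 iy] IH]; first by rewrite Euclid_dvd1.
  rewrite Euclid_dvdM // => /orP[/(dvdn_leq i0)|//]; lia.
have [s s0 /andP[sM Ms]] : exists2 s, (0 < s)%N & (s ^ 2 <= M < s.+1 ^ 2)%N.
  apply: root_floor; rewrite muln_gt0 !expn_gt0 /=; lia.
pose bad t := [exists p : 'I_s.+1, [&& (y < p)%N, prime p &
         ((p : nat)%:Z ^+ 2 %| norm n f (w t))%Z]].
have Hd0 : (0 < H ^ d)%N by rewrite expn_gt0 H0.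
have badH : (2 * #|[set t | bad t]| <= H ^ d)%N.
  have := HK1 y s H Q w y0 good wB; rewrite -/bad => le.
  have sH : (4 * K1 * s <= H ^ d)%N.
    rewrite -(@leq_exp2r _ _ 2) // expnMn.
    apply: (@leq_trans ((4 * K1) ^ 2 * M)); first by rewrite leq_mul2l sM orbT.
    rewrite /M mulnA [X in (_ <= X)%N]expnS expn1 leq_mul2r.
    apply/orP; right; apply: leq_trans HH _.
    by rewrite /d expnS leq_pmulr // expn_gt0 H0.
  rewrite -(ler_nat rat) natrM.
  have : (4 * K1 * s)%:R <= (H ^ d)%:R :> rat by rewrite ler_nat.
  have : (4 * K1)%:R <= y%:R :> rat by rewrite ler_nat.
  rewrite !natrM; set h := (H ^ d)%:R in le *; set a := #|_|%:R in le *.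
  have yr : 0 < y%:R :> rat by rewrite ltr0n.
  have h0 : 0 <= h by rewrite ler0n.
  have yK' : K1%:R * (h / y%:R) <= h / 4.
    rewrite mulrA ler_pdivrMr //.
    have : (4 * K1)%:R <= y%:R :> rat by rewrite ler_nat.
    by rewrite natrM; nra.
  by move: le; rewrite mulrDr; lra.
have goodH : (H ^ d <= 2 * #|[set t | ~~ bad t]|)%N.
  have := cardsC [set t | bad t]; rewrite card_ffun !card_ord -/d.
  rewrite (_ : ~: _ = [set t | ~~ bad t]); last by apply/setP => t; rewrite !inE.
  by lia.
have sqf t p : ~~ bad t -> prime p -> ~~ (p ^ 2 %| absz (norm n f (w t)))%N.
  move=> /existsPn bt pp; apply/negP => p2.
  have py : (y < p)%N.
    rewrite ltnNge; apply/negP => py; case/negP: (Nw1 p t pp py).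
    by rewrite dvdzE /= (dvdn_trans _ p2) // dvdn_exp.
  have ps : (p < s.+1)%N.
    rewrite -(@ltn_exp2r _ _ 2) // (leq_ltn_trans _ Ms) //.
    apply: leq_trans (dvdn_leq _ p2) _ => //; by case: (Nw t).
  by have := bt (Ordinal ps); rewrite py pp dvdzE abszX /= p2.
apply: leq_trans goodH _; rewrite -mulnA leq_mul2l /=.
pose R (t : {ffun 'I_d -> 'I_H}) (phi : {ffun 'I_X -> option 'I_X}) :=
  (cprod phi == absz (norm n f (w t))) &&
  [forall p, if phi p is Some r then (p %| (w t).[(r : nat)%:Z])%Z else true].
apply: (@leq_card_fibres _ _ _ _ R) => [t|phi].
  rewrite inE => bt.
  pose P (t : {ffun 'I_d -> 'I_H}) (p : 'I_X) : pred 'I_X := fun r =>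
    [&& prime p, (p %| absz (norm n f (w t)))%N, zroot f p r & (p %| (w t).[(r : nat)%:Z])%Z].
  pose phi : {ffun 'I_X -> option 'I_X} := [ffun p => [pick r | P t p r]].
  have phiS p : phi p = prime p && (p %| absz (norm n f (w t)))%N :> bool.
    rewrite ffunE; case: pickP => [r /and3P[-> -> _] //|np].
    apply/esym/negP => /andP[pp pN].
    have [r rp gr] := norm_simple_root pp pN (sqf t p bt pp).
    have rX : (r < X)%N by apply: leq_trans (ltnW (ltn_ord p)); case/andP: rp.
    by have := np (Ordinal rX); rewrite /P pp pN rp gr.
  have phiE p r : phi p = Some r -> P t p r.
    by rewrite ffunE; case: pickP => // r' Pr [<-].
  have cN : cprod phi = absz (norm n f (w t)).
    rewrite /cprod (eq_bigl (fun p : 'I_X => prime p && (p %| absz (norm n f (w t)))%N)) //.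
    apply: prod_primes_sqfree; last by move=> p; exact: sqf.
    by rewrite Nw0 (leq_ltn_trans _ XH) //; case: (Nw t).
  exists phi; last first.
    apply/andP; split; first by rewrite cN.
    by apply/forallP => p; case E: (phi p) => [r|//]; case/and4P: (phiE _ _ E).
  rewrite inE cN; apply/andP; split; last by apply/andP; exact: Nw.
  rewrite inE; apply/forallP => p; case E: (phi p) => [r|//].
  case/and4P: (phiE _ _ E) => pp pN -> _; rewrite pp !andbT /=.
  by rewrite ltnNge; apply/negP => py; case/negP: (Nw1 p t pp py).
(* Two polynomials of one fibre both vanish at the chosen roots, and Q is prime to |I|: the norm of
   the difference of their box parts is a multiple of |I|. *)
move=> /setIdP[C /andP[lo hi]].
set L := [set _ in _ | _].
have le : (#|L| * cprod phi <= K2 * (H ^ d + cprod phi))%N.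
  apply: HK2 => [|t u]; first exact: cprod_gt0 C.
  move=> /setIdP[_ /andP[_ /forallP tr]] /setIdP[_ /andP[_ /forallP ur]].
  rewrite dvdzE /=; apply: (cprod_dvd C) => p r E.
  have [yp pp pr] := configP C E; have [_ pQ] := good p yp pp.
  apply: (dvd_norm_zroot firr szf pp pr).
  have := tr p; have := ur p; rewrite E => ru rt.
  have : (p %| (w t - w u).[(r : nat)%:Z])%Z by rewrite hornerD hornerN rpredB.
  by rewrite wB hornerZ Gauss_dvdzr // coprimezE /= prime_coprime.
have c0 := cprod_gt0 C.
rewrite -(leq_pmul2r c0) (leq_trans le) // /K3 -mulnA leq_mul2l.
by apply/orP; right; rewrite mulSn addnC leq_add2l.
Qed.
End Lower.

(** * Logarithmic sums and the degree bound *)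

Definition nroots (f : {poly int}) (p : nat) : nat := #|[pred r : 'I_p | zroot f p r]|.

Definition weight (f : {poly int}) (y p : nat) : rat :=
  if (y < p)%N && prime p then (nroots f p)%:R else 0.

Lemma sum_inj_le (I J : finType) (h : I -> J) (A : {pred I}) (B : {pred J}) (F : J -> rat) :
  {in A &, injective h} -> (forall i, i \in A -> h i \in B) ->
  (forall j, 0 <= F j) -> \sum_(i in A) F (h i) <= \sum_(j in B) F j.
Proof.
move=> hinj hAB F0; rewrite -big_imset // big_mkcond [X in _ <= X]big_mkcond /=.
apply: ler_sum => j _; case: imsetP => [[i iA ->]|_]; first by rewrite hAB.
by case: ifP.
Qed.

Lemma prod1D_expand (T : finType) (w : T -> rat) :
  \prod_i (w i + 1) = \sum_(D : {set T}) \prod_(i in D) w i.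
Proof.
rewrite bigA_distr; apply: eq_bigr => D _.
by rewrite [RHS]big_mkcond.
Qed.

(** With D the intersection of I and J and G their symmetric difference, the product of the weights
    of I and J is w(D)^2 w(G), and I \ J is one of the 2^#G subsets of G. Forgetting that D and G
    are disjoint turns the sum into a product. *)
Lemma square_sum_le (T : finType) (w : T -> rat) (P P' : pred {set T}) :
  (forall i, 0 <= w i) ->
  (forall I J, P I -> P J -> \prod_(i in I) w i != 0 -> \prod_(i in J) w i != 0 ->
     P' ((I :\: J) :|: (J :\: I))) ->
  (\sum_(I | P I) \prod_(i in I) w i) ^+ 2 <=
  (\prod_i (w i ^+ 2 + 1)) * \sum_(G | P' G) \prod_(i in G) (2 * w i).
Proof.
move=> w0 PP'; pose W (I : {set T}) := \prod_(i in I) w i.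
have W0 I : 0 <= W I by apply: prodr_ge0.
have WU (I J : {set T}) : [disjoint I & J] -> W (I :|: J) = W I * W J.
  by move=> dIJ; rewrite /W -bigU //=; apply: eq_bigl => x; rewrite !inE.
have -> : (\sum_(I | P I) W I) ^+ 2 =
   \sum_(x in [pred x : {set T} * {set T} | [&& P x.1, P x.2, W x.1 != 0 & W x.2 != 0]])
     W x.1 * W x.2.
  rewrite expr2 big_distrlr /= pair_big /= big_mkcond [RHS]big_mkcond /=.
  apply: eq_bigr => -[I J] _ /=; rewrite inE /=; case: (P I) => //=; case: (P J) => //=.
  by have [->|] := eqVneq (W I) 0; have [->|] := eqVneq (W J) 0; rewrite ?(mulr0, mul0r).
(* The third component tells how G is divided between I and J, which makes [h] injective. *)
pose h (x : {set T} * {set T}) := (x.1 :&: x.2, (x.1 :\: x.2) :|: (x.2 :\: x.1), x.1 :\: x.2).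
pose F (z : {set T} * {set T} * {set T}) := W z.1.1 ^+ 2 * W z.1.2.
pose B := [pred z : {set T} * {set T} * {set T} | P' z.1.2 && (z.2 \subset z.1.2)].
apply: (@le_trans _ _ (\sum_(z in B) F z)).
  rewrite (eq_bigr (F \o h)) => [|[I J] _].
    apply: sum_inj_le => [[I J] [I' J'] _ _ [/= E1 E2 E3]|[I J]|[[D G] E]].
    - have E4 : J :\: I = J' :\: I'.
        have dd (U V : {set T}) : V :\: U = ((U :\: V) :|: (V :\: U)) :\: (U :\: V).
          by apply/setP => x; rewrite !inE; case: (x \in U); case: (x \in V).
        by rewrite dd E2 E3 -dd.
      congr pair; first by rewrite -(setID I J) -(setID I' J') E1 E3.
      by rewrite -(setID J I) -(setID J' I') setIC E1 E4 setIC.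
    - by rewrite !inE /= => /and4P[PI PJ WI WJ]; rewrite subsetUl andbT PP'.
    - by rewrite /F mulr_ge0 ?exprn_ge0.
  rewrite /F /=; set D := I :&: J.
  have dj : [disjoint I :\: J & J :\: I].
    by rewrite -setI_eq0; apply/eqP/setP => x; rewrite !inE; case: (x \in I); rewrite ?andbF.
  have split (U V : {set T}) : W U = W (U :&: V) * W (U :\: V).
    rewrite -WU ?setID // -setI_eq0; apply/eqP/setP => x.
    by rewrite !inE; case: (x \in U); case: (x \in V).
  by rewrite WU // (split I J) (split J I) [J :&: I]setIC -/D; ring.
rewrite prod1D_expand big_distrlr /= pair_big /=.
have -> : \sum_(z in B) F z =
    \sum_(x : {set T} * {set T} | P' x.2) \sum_(E : {set T} | E \subset x.2) F (x, E).
  by rewrite pair_big_dep /=; apply: eq_big => [[x E]|[x E] _] //; rewrite inE.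
apply: ler_sum => [[D G] /= _]; rewrite /F /= sumr_const.
rewrite (eq_card (_ : _ =i powerset G)); last by move=> E; rewrite powersetE.
rewrite card_powerset -[X in X <= _]mulr_natr natrX.
have -> : \prod_(i in G) (2 * w i) = 2 ^+ #|G| * W G by rewrite big_split /= prodr_const.
have -> : \prod_(i in D) w i ^+ 2 = W D ^+ 2 by rewrite prodrXl.
by rewrite -mulrA [W G * _]mulrC.
Qed.

(** The induction needs the stronger bound 2 - 2 a/(X - 1), whose growth absorbs each factor 1 +
    a/p^2; at X = y + 1 it is at least 1 because 2 a <= y. *)
Lemma prod_inv_sqr_le (a : rat) (y X : nat) (w : nat -> rat) : 0 < a -> (0 < y)%N ->
  2 * a <= y%:R -> (forall p, (y < p)%N -> 0 <= w p <= a / p%:R ^+ 2) ->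
  (forall p, (p <= y)%N -> w p = 0) -> \prod_(p < X) (w p + 1) <= 2.
Proof.
move=> a0 y0 ay wa wy.
suff H : forall X, (y < X)%N -> \prod_(p < X) (w p + 1) <= 2 - 2 * a / X.-1%:R.
  have [Xy|yX] := leqP X y.
    by rewrite big1 // => p _; rewrite wy ?add0r // ltnW // (leq_trans (ltn_ord p)).
  apply: le_trans (H X yX) _; rewrite gerBl mulr_ge0 ?invr_ge0 ?ler0n //.
  by rewrite mulr_ge0 // ltW.
elim=> [//|{}X IH]; rewrite ltnS leq_eqVlt => /orP[/eqP <-|yX].
  rewrite big1 => [|p _]; last by rewrite wy ?add0r // -ltnS.
  have : 2 * a / y%:R <= 1 by rewrite ler_pdivrMr ?ltr0n // mul1r.
  by move=> /=; lra.
rewrite big_ord_recr /=.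
have X1 : (0 < X.-1)%N by lia.
set x : rat := X.-1%:R; have x0 : 0 < x by rewrite ltr0n.
have Xx : X%:R = x + 1 by rewrite natr1 prednK //; lia.
have ax : 2 * a <= x by apply: le_trans ay _; rewrite ler_nat; lia.
have /andP[w0 wX] := wa X yX.
apply: (@le_trans _ _ ((2 - 2 * a / x) * (a / (x + 1) ^+ 2 + 1))).
  apply: ler_pM; rewrite ?IH //.
  - apply: prodr_ge0 => p _; apply: addr_ge0 => //.
    by have [/wy ->//|/wa/andP[]] := leqP p y.
  - by rewrite addr_ge0.
  - by rewrite lerD2r -Xx.
rewrite Xx -subr_ge0.
have -> : 2 - 2 * a / (x + 1) - (2 - 2 * a / x) * (a / (x + 1) ^+ 2 + 1) =
   2 * a * (1 + a) / (x * (x + 1) ^+ 2).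
  by field; rewrite !gt_eqF // addr_gt0.
rewrite divr_ge0 ?mulr_ge0 ?exprn_ge0 ?addr_ge0 //; exact: ltW.
Qed.

Lemma card_option_pred (T : finType) (Q : pred T) :
  #|[pred o : option T | if o is Some r then Q r else false]| = #|Q|.
Proof.
have inj : injective (@Some T) by move=> x z [].
rewrite -(card_image inj); apply: eq_card => -[r|].
  by rewrite (mem_image inj).
by apply/esym/negP => /imageP[].
Qed.

Lemma weight_ge0 f y p : 0 <= weight f y p.
Proof. by rewrite /weight; case: ifP. Qed.

Lemma card_zroots f p X : (p <= X)%N -> #|[pred r : 'I_X | zroot f p r]| = nroots f p.
Proof.
move=> pX; rewrite /nroots -!sum1_card (big_ord_widen_cond _ (zroot f p) (fun=> 1%N) pX).
by apply: eq_bigl => r; rewrite unfold_in /= /zroot; case: ltnP; rewrite ?andbF ?andbT.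
Qed.

(** Grouping the choices by their support I leaves the numbers of roots multiplied over I. Both
    polynomials then have sums over the same sets I, comparable term by term. *)
Lemma config_sum f y X (P : pred nat) :
  \sum_(phi in config f y X | P (cprod phi)) (cprod phi)%:R^-1 =
  \sum_(I : {set 'I_X} | P (\prod_(p in I) p)%N) \prod_(p in I) (weight f y p / p%:R).
Proof.
pose supp (phi : {ffun 'I_X -> option 'I_X}) : {set 'I_X} := [set p | phi p].
have cs phi : cprod phi = (\prod_(p in supp phi) p)%N.
  by apply: eq_bigl => p; rewrite inE.
rewrite (partition_big supp (fun I => P (\prod_(p in I) p)%N)) /=; last first.
  by move=> phi /andP[_]; rewrite cs.
apply: eq_bigr => I PI.
transitivity (\sum_(phi in config f y X | supp phi == I) (\prod_(p in I) p)%N%:R^-1 : rat).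
  apply: eq_big => phi; last first.
    by case/andP => _ /eqP E; rewrite cs E.
  by have [E|_] := eqVneq (supp phi) I; rewrite ?andbF // cs E PI !andbT.
rewrite sumr_const big_split /= prodfV -natr_prod -[X in X = _]mulr_natl; congr (_ * _).
pose F (p : 'I_X) : pred (option 'I_X) := if p \in I then
   [pred o : option 'I_X | if o is Some r then [&& (y < p)%N, prime p & zroot f p r] else false]
   else pred1 None.
rewrite (eq_card (_ : _ =i family F)) => [|phi]; last first.
  apply/idP/familyP => [/andP[]|H].
    rewrite inE => /forallP C /eqP sI p.
    rewrite /F -sI inE; have := C p.
    by rewrite -topredE /=; case: (phi p) => [r|] //=.
  apply/andP; split.
    rewrite inE; apply/forallP => p; have := H p; rewrite /F; case: (phi p) => [r|//].
    by case: ifP => //; rewrite inE.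
  apply/eqP/setP => p; rewrite inE; have := H p; rewrite /F.
  by case: (p \in I); rewrite inE; case: (phi p).
rewrite card_family foldrE big_image [X in _ = X]big_mkcond natr_prod /=.
apply: eq_bigr => p _; rewrite /F; case: (p \in I); last by rewrite card1.
rewrite card_option_pred /weight; case: (y < p)%N => /=; last by rewrite eq_card0.
case: (prime p) => /=; last by rewrite eq_card0.
by rewrite -(@card_zroots f p X) // ltnW.
Qed.

Lemma nroots_le n (f : {poly int}) (p : nat) : f \is monic -> size f = n.+2 ->
  prime p -> (nroots f p <= n.+1)%N.
Proof.
move=> fmon szf pp; pose s := [seq ((r : nat)%:R : 'F_p) | r : 'I_p in [pred r : 'I_p |
  zroot f p r]].
have szs : size s = nroots f p by rewrite size_image.
have mon : zpoly 'F_p f \is monic by exact: monic_map.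
have := @max_poly_roots _ _ s (monic_neq0 mon); rewrite szs.
rewrite size_map_poly_id0 ?(monicP fmon) ?oner_eq0 // szf ltnS; apply.
  apply/allP => _ /imageP[r /andP[_ fr] ->]; rewrite /root.
  by move: fr; rewrite (dvdz_pcharf (pchar_Fp pp)) -[_%:~R](horner_map (intmul 1)).
rewrite map_inj_in_uniq ?enum_uniq // => r t _ _ E; apply: val_inj.
have := congr1 (@nat_of_ord _) E; rewrite !val_Fp_nat ?prime_gt1 //=.
by rewrite !modn_small.
Qed.

(** The windows H_j^d / c1 <= |I| <= c2 H_j^d, with H_(j+1) = b H_j and b > c1 c2, are disjoint.
    Each adds at least 1/(K c2) to the sum, and k of them lie below a q^k. *)
Lemma config_lower_sum n (f : {poly int}) : zirreducible f -> size f = n.+2 ->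
  exists y0, forall y, (y0 <= y)%N -> exists M a q : nat, (0 < M)%N /\
  forall k X, (a * q ^ k < X)%N -> k%:R / M%:R <=
    \sum_(phi in config f y X | (cprod phi <= a * q ^ k)%N) (cprod phi)%:R^-1 :> rat.
Proof.
move=> firr szf; have [K [y0 [K0 HK]]] := config_lower firr szf.
set d := n.+1 in HK; exists y0 => y yy; have [c1 [c2 [H0 [c10 c20 Hc]]]] := HK y yy.
pose b := (c1 * c2).+1; pose H j := (H0.+1 * b ^ j)%N.
exists (K * c2)%N, (c2 * H0.+1 ^ d)%N, (b ^ d)%N; split; first by rewrite muln_gt0 K0.
move=> k X; rewrite -mulnA -expnM [(d * k)%N]mulnC expnM -expnMn -/(H k) => ZX.
pose Bl (j : nat) := [set phi in config f y X | (H j ^ d <= c1 * cprod phi)%N &&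
   (cprod phi <= c2 * H j ^ d)%N].
have Hmono j j' : (j <= j')%N -> (H j <= H j')%N.
  by move=> jj; rewrite leq_mul2l leq_exp2l ?jj ?orbT // /b ltnS muln_gt0 c10.
have Hgt0 j : (0 < H j)%N by rewrite muln_gt0 /= expn_gt0.
have disj (phi : {ffun 'I_X -> option 'I_X}) (j j' : nat) :
    (j < j')%N -> phi \in Bl j -> phi \in Bl j' -> False.
  move=> jj /setIdP[_ /andP[_ hi]] /setIdP[_ /andP[lo _]].
  have : (H j.+1 ^ d <= c1 * (c2 * H j ^ d))%N.
    apply: leq_trans (leq_trans lo _); last by rewrite leq_mul2l hi orbT.
    by rewrite leq_exp2r // Hmono.
  have -> : H j.+1 = (b * H j)%N by rewrite /H expnS mulnCA.
  rewrite expnMn mulnA leq_pmul2r ?expn_gt0 ?Hgt0 // leqNgt => /negP; apply.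
  by apply: (@leq_trans b) => //; rewrite /d expnS leq_pmulr // expn_gt0.
have le1 phi : (\sum_(j < k) (phi \in Bl j) <= 1)%N.
  rewrite (eq_bigr (fun j : 'I_k => if phi \in Bl j then 1%N else 0%N)) => [|j _];
    last by case: ifP.
  rewrite -big_mkcond /= sum1_card; apply/card_le1_eqP => j j' Bj Bj'; apply: val_inj.
  have [/disj D|/disj D|//] := ltngtP j j'; [by case: (D _ Bj Bj')|by case: (D _ Bj' Bj)].
apply: (@le_trans _ _ (\sum_(phi in config f y X | (cprod phi <= c2 * H k ^ d)%N)
    (cprod phi)%:R^-1 * (\sum_(j < k) (phi \in Bl j))%N%:R)); last first.
  by apply: ler_sum => phi _; rewrite ler_piMr ?invr_ge0 ?ler0n // (ler_nat _ _ 1).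
under eq_bigr do rewrite natr_sum mulr_sumr.
rewrite exchange_big /= -[k in k%:R]card_ord -sumr_const mulr_suml.
apply: ler_sum => j _; rewrite mul1r.
apply: (@le_trans _ _ (\sum_(phi in Bl j) (c2 * H j ^ d)%:R^-1)).
  rewrite sumr_const -[X in _ <= X]mulr_natr.
  have h0 : 0 < (H j ^ d)%:R :> rat by rewrite ltr0n expn_gt0 Hgt0.
  have c0 : 0 < c2%:R :> rat by rewrite ltr0n.
  have k0 : 0 < K%:R :> rat by rewrite ltr0n.
  have : (H j ^ d)%:R <= K%:R * #|Bl j|%:R :> rat.
    rewrite -natrM ler_nat; apply: Hc.
      by apply: leq_trans (leqnSn _) _; rewrite leq_pmulr // expn_gt0.
    by apply: leq_ltn_trans ZX; rewrite leq_mul2l leq_exp2r // Hmono ?orbT // ltnW.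
  rewrite !natrM; set h := (H j ^ d)%:R in h0 *; set N := #|Bl j|%:R => hN.
  rewrite [X in _ <= X]mulrC ler_pdivlMr ?mulr_gt0 // -(ler_pM2l k0).
  rewrite [X in X <= _](_ : _ = h) //; first by field; rewrite !gt_eqF.
rewrite big_mkcond [X in _ <= X]big_mkcond /=; apply: ler_sum => phi _.
case: ifP => [Bj|nB]; last by case: ifP => // _; rewrite mulr0.
have /setIdP[C /andP[lo hi]] := Bj.
have hk : (cprod phi <= c2 * H k ^ d)%N.
  by rewrite (leq_trans hi) // leq_mul2l leq_exp2r // Hmono ?orbT // ltnW.
by rewrite C hk mulr1 lef_pV2 ?posrE ?ltr0n ?ler_nat // (leq_trans (cprod_gt0 C)).
Qed.

(** In the dyadic range from 2^i to 2^(i+1) there are at most C 2^(i+1) choices, each with a term at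
    most 2^-i; there are E ranges below 2^E. *)
Lemma config_upper_sum n (f : {poly int}) : zirreducible f -> size f = n.+2 ->
  exists y0 C, forall y X E : nat, (y0 <= y)%N ->
    \sum_(phi in config f y X | (cprod phi < 2 ^ E)%N) (cprod phi)%:R^-1 <= (C * E)%:R :> rat.
Proof.
move=> firr szf; have [C [y0 [C0 HC]]] := config_upper firr szf.
exists y0, (C * 2)%N => y X E yy.
apply: (@le_trans _ _ (\sum_(phi in config f y X) \sum_(i < E)
   (if (cprod phi <= 2 ^ i.+1)%N then (2 ^ i)%:R^-1 else 0))).
  rewrite big_mkcond [X in _ <= X]big_mkcond /=; apply: ler_sum => phi _.
  have ge0 : 0 <= \sum_(i < E) (if (cprod phi <= 2 ^ i.+1)%N then (2 ^ i)%:R^-1 else 0) :> rat.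
    by apply: sumr_ge0 => i _; case: ifP; rewrite // invr_ge0 ler0n.
  have [Cp|//] := boolP (phi \in _); case: ltnP => //= lE.
  have c0 := cprod_gt0 Cp; have /andP[lo hi] := trunc_log_bounds (isT : 1 < 2)%N c0.
  have iE : (trunc_log 2 (cprod phi) < E)%N by rewrite -(ltn_exp2l _ _ (isT : 1 < 2)%N)
    (leq_ltn_trans lo).
  rewrite (bigD1 (Ordinal iE)) //= ltnW // ler_wpDr //.
    by apply: sumr_ge0 => i _; case: ifP; rewrite // invr_ge0 ler0n.
  by rewrite lef_pV2 ?posrE ?ltr0n ?ler_nat ?expn_gt0.
rewrite exchange_big /= natrM mulr_natr -[X in _ <= _ *+ X]card_ord -[X in _ <= X]sumr_const.
apply: ler_sum => i _; rewrite -big_mkcondr /= sumr_const -[X in X <= _]mulr_natr.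
have := HC y X (2 ^ i.+1)%N yy; rewrite expn_gt0 => /(_ isT).
rewrite -(ler_nat rat) => le.
rewrite mulrC ler_pdivrMr ?ltr0n ?expn_gt0 // -natrM -mulnA -expnS.
apply: le_trans le; rewrite ler_nat; apply/eq_leq/eq_card => phi.
by rewrite in_set.
Qed.

(** With S the sum for f up to Z = a q^k, the estimates give k / M <= S and S^2 <= 2 C (a^2 + 2 k
    q), so that k^2 would be O(k). *)
Theorem splitting_degree_bound n m (f g : {poly int}) (y1 : nat) :
  zirreducible f -> zirreducible g -> size f = n.+2 -> size g = m.+2 ->
  (forall p r, prime p -> (y1 < p)%N -> zroot f p r -> nroots g p = m.+1) ->
  (m.+1 < 2 * n.+1)%N.
Proof.
move=> firr girr szf szg split; rewrite ltnNge; apply/negP => mn.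
have [yf Hf] := config_lower_sum firr szf.
have [yg [C Hg]] := config_upper_sum girr szg.
(* The entry [2 * n.+1 ^ 2] makes the product of the 1 + (rho_f(p)/p)^2 over p > y at most 2, since
   f has at most n + 1 roots modulo p. *)
pose y := maxn (maxn yf yg) (maxn y1 (2 * n.+1 ^ 2)).
have [yf' yg' y1' yn] : [/\ (yf <= y)%N, (yg <= y)%N, (y1 <= y)%N & (2 * n.+1 ^ 2 <= y)%N].
  by rewrite /y !leq_max !leqnn !orbT.
have y0 : (0 < y)%N by apply: leq_trans yn; rewrite muln_gt0 expn_gt0.
have [M [a [q [M0 HM]]]] := Hf y yf'.
have main k : ((k ^ 2) <= M ^ 2 * (2 * (C * (a ^ 2 + 2 * k * q))))%N.
  pose Z := (a * q ^ k)%N; pose X := Z.+1.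
  have low := HM k X (ltnSn _).
  rewrite (config_sum f y X (fun c => c <= Z)%N) in low.
  have := @square_sum_le _ (fun p : 'I_X => weight f y p / p%:R)
    (fun I => \prod_(p in I) p <= Z)%N (fun I => \prod_(p in I) p <= Z ^ 2)%N.
  set S := (\sum_(I | _) _) in low *; move=> sq.
  have {}sq : S ^+ 2 <= 2 * (C * (a ^ 2 + 2 * k * q))%:R.
    apply: le_trans (sq _ _) _ => [p|I J|].
    - by rewrite divr_ge0 ?weight_ge0 ?ler0n.
    - move=> IZ JZ I0 J0.
      (* A nonzero weight forces the members of U to be primes, and removing primes does not
         increase a product; the index 0 is excluded in this way. *)
      have pos (U V : {set 'I_X}) : \prod_(p in U) (weight f y p / p%:R) != 0 ->
          (\prod_(p in U :\: V) p <= \prod_(p in U) p)%N.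
        move=> U0; rewrite [X in (_ <= X)%N](big_setID V) /= leq_pmull //.
        rewrite prodn_cond_gt0 // => p /setIP[pU _].
        move/prodf_neq0: U0 => /(_ p pU); rewrite mulf_eq0 negb_or => /andP[+ _].
        rewrite /weight; case: ifP; last by rewrite eqxx.
        by case/andP => _ /prime_gt0.
      have -> : (\prod_(p in I :\: J :|: J :\: I) p = \prod_(p in I :\: J) p * \prod_(p in J
        :\: I) p)%N.
        rewrite -bigU /=; first by apply: eq_bigl => p; rewrite !inE.
        rewrite -setI_eq0; apply/eqP/setP => p; rewrite !inE.
        by case: (p \in I); rewrite ?andbF.
      by rewrite -mulnn leq_mul // (leq_trans (pos _ _ _)).
    - apply: ler_pM.
      + by apply: prodr_ge0 => p _; rewrite addr_ge0 // exprn_ge0 // divr_ge0 ?weight_ge0 ?ler0n.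
      + by apply: sumr_ge0 => G _; apply: prodr_ge0 => p _;
        rewrite mulr_ge0 // divr_ge0 ?weight_ge0 ?ler0n.
      + apply: (@prod_inv_sqr_le (n.+1 ^ 2)%N%:R y X (fun p => (weight f y p / p%:R) ^+ 2)) => //.
        * by rewrite -natrM ler_nat.
        * move=> p yp; rewrite exprMn exprVn mulr_ge0 ?invr_ge0 ?exprn_ge0 ?weight_ge0 ?ler0n //=.
          rewrite ler_wpM2r ?invr_ge0 ?exprn_ge0 ?ler0n // natrX.
          rewrite lerXn2r ?nnegrE ?weight_ge0 ?ler0n // /weight yp.
          case: ifP => //= pp; rewrite ler_nat; exact: nroots_le (proj1 firr) szf pp.
        * by move=> p py; rewrite /weight ltnNge py /= mul0r expr0n.
      (* The exponent comes from Z^2 = a^2 q^(2 k), with a^2 < 2^(a^2) and q < 2^q. *)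
      + apply: le_trans (Hg y X (a ^ 2 + 2 * k * q)%N yg').
        rewrite (config_sum g y X (fun c => c < 2 ^ _)%N).
        rewrite big_mkcond [X in _ <= X]big_mkcond; apply: ler_sum => G _ /=.
        have pg : 0 <= \prod_(p in G) (weight g y p / p%:R).
          by apply: prodr_ge0 => p _; rewrite divr_ge0 ?weight_ge0 ?ler0n.
        case: ifP => GZ; last by case: ifP.
        rewrite ifT.
          apply: ler_prod => p _; rewrite mulr_ge0 ?divr_ge0 ?weight_ge0 ?ler0n //= mulrA.
          rewrite ler_wpM2r ?invr_ge0 ?ler0n // /weight.
          case: ifP => [/andP[yp pp]|_]; last by rewrite mulr0.
          rewrite -natrM ler_nat.
          (* The splitting hypothesis enters here: one root of f forces m + 1 >= 2 (n + 1) roots of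
             g. *)
          have [->|] := posnP (nroots f p); first by rewrite muln0.
          move=> /card_gt0P[r fr].
          rewrite (split p r) //; last exact: leq_ltn_trans yp.
          apply: leq_trans mn; rewrite leq_mul2l.
          exact: nroots_le (proj1 firr) szf pp.
        apply: leq_ltn_trans GZ _; rewrite /Z expnMn expnD.
        apply: (@leq_ltn_trans (a ^ 2 * 2 ^ (2 * k * q))).
          rewrite leq_mul2l; apply/orP; right.
          have -> : (2 ^ (2 * k * q) = ((2 ^ q) ^ k) ^ 2)%N by rewrite -!expnM; congr expn; lia.
          rewrite leq_exp2r //; have [->|k0] := posnP k; first by rewrite !expn0.
          by rewrite leq_exp2r // ltnW // ltn_expl.
        by rewrite ltn_pmul2r ?expn_gt0 // ltn_expl.
  have m0 : 0 < M%:R :> rat by rewrite ltr0n.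
  rewrite -(ler_nat rat) natrX natrM natrX natrM.
  have : (k%:R / M%:R) ^+ 2 <= 2 * (C * (a ^ 2 + 2 * k * q))%:R :> rat.
    apply: le_trans sq; rewrite lerXn2r ?nnegrE ?divr_ge0 ?ler0n //.
    by rewrite (le_trans _ low) ?divr_ge0 ?ler0n.
  rewrite expr_div_n ler_pdivrMr ?exprn_gt0 //.
  by rewrite [X in _ <= X -> _]mulrC.
(* For k = N + 1 the estimate becomes k^2 <= N k, which is absurd. *)
pose N := (M ^ 2 * (2 * C) * (a ^ 2 + 2 * q))%N.
have le : (a ^ 2 + 2 * N.+1 * q <= (a ^ 2 + 2 * q) * N.+1)%N.
  by move: N => N; nia.
have h := leq_mul (leqnn (M ^ 2 * (2 * C))%N) le; rewrite mulnA -/N in h.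
have := main N.+1; rewrite !mulnA in h *; move=> h'; have := leq_trans h' h.
by rewrite -[(M ^ 2 * 2 * C)%N]mulnA -/N expnS expn1 leq_pmul2r ?ltnn.
Qed.

From mathcomp Require Import boolp classical_sets functions cardinality.
From mathcomp Require Import topology.

(** * Algebraic integers *)

Notation qpoly := (map_poly (ratr : rat -> algC)).

Lemma qpoly_zpoly (g : {poly int}) : qpoly (zpoly rat g) = zpoly algC g.
Proof. by rewrite -map_poly_comp; apply: eq_map_poly => z /=; rewrite ratr_int. Qed.

(** A nonzero x divides the constant term of its integral equation; factors X are stripped first, so
    that this term is nonzero. *)
Lemma Aint_dvd_int (x : algC) : x \in Aint -> x != 0 ->
  exists (h : {poly int}) (N : int), N != 0 /\ x * (zpoly algC h).[x] = N%:~R.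
Proof.
move=> xA x0; have /floorpP[P DP] : minCpoly x \is a polyOver Num.int by [].
have := root_minCpoly x; have := minCpoly_eq0 x; rewrite DP.
elim/poly_ind: {DP}P => [|q c IH]; first by rewrite rmorph0 eqxx.
rewrite rmorphD rmorphM /= map_polyX map_polyC /= /root !hornerE.
have [->|c0] := eqVneq c 0.
  rewrite rmorph0 !addr0 mulf_eq0 polyX_eq0 orbF (mulf_eq0 _ x) (negPf x0) orbF.
  exact: IH.
move=> _; rewrite addr_eq0 => /eqP E; exists q, (- c); split; first by rewrite oppr_eq0.
by rewrite mulrC E rmorphN.
Qed.

(** The minimal polynomial of a root y of f divides that of x, and minimality of the latter makes
    the two equal; hence no root of f has smaller degree. *)
Lemma Aint_zirreducible (x : algC) : x \in Aint -> exists f : {poly int},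
  [/\ zirreducible f, root (zpoly algC f) x, (1 < size f)%N &
      forall q : {poly rat}, root (qpoly q) x = (zpoly rat f %| q)].
Proof.
move=> xA; have /floorpP[f Df] : minCpoly x \is a polyOver Num.int by [].
have fmon : f \is monic.
  have := minCpoly_monic x; rewrite Df !monicE lead_coef_map_inj //; last exact: intr_inj.
  by rewrite (eqr_int _ _ 1).
have [p [Dp pmon] pdvd] := minCpolyP x.
have Ep : p = zpoly rat f.
  by apply: (map_poly_inj (ratr : rat -> algC)); rewrite qpoly_zpoly -Df -Dp.
have szf : size (zpoly rat f) = size f.
  by rewrite size_map_poly_id0 // (monicP fmon) oner_eq0.
have f1 : (1 < size f)%N by rewrite -szf -Ep -(size_map_poly (ratr : rat -> algC)) -Dp
  size_minCpoly.
exists f; split=> //; last by move=> q; rewrite -Ep; exact: pdvd.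
  split=> // y g fy gy gf; apply/eqP; apply: contraLR gf => g0.
  have [r [_ rmon] rdvd] := minCpolyP y.
  have rp : r %| p by rewrite -rdvd Ep qpoly_zpoly.
  have rg : r %| zpoly rat g by rewrite -rdvd qpoly_zpoly.
  have ry : root (qpoly r) y by rewrite rdvd.
  have r1 : (1 < size r)%N.
    have := @root_size_gt1 _ y (qpoly r); rewrite size_map_poly; apply=> //.
    by rewrite map_poly_eq0 monic_neq0.
  have pr : p %| r.
    have /dvdpP[s Ds] := rp; rewrite -pdvd.
    have : root (qpoly p) x by rewrite pdvd.
    rewrite {1}Ds rmorphM rootM /= => /orP[ps|//]; rewrite pdvd in ps.
    have s0 : s != 0 by apply: contraTneq pmon => s0;
      rewrite Ds s0 mul0r monicE lead_coef0 eq_sym oner_eq0.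
    have := dvdp_leq s0 ps; rewrite Ds (size_mul s0 (monic_neq0 rmon)) => le.
    rewrite -size_poly_gt0 in s0; exfalso; move: le r1 s0.
    by move: (size s) (size r) => a b; clear; lia.
  have g0' : zpoly rat g != 0 by rewrite map_poly_eq0_id0 // intr_eq0 lead_coef_eq0.
  have := dvdp_leq g0' (dvdp_trans pr rg); rewrite Ep szf -leqNgt => /leq_trans; apply.
  exact: size_poly.
by rewrite -Df root_minCpoly.
Qed.

Lemma zpoly_root_dvd (t : algC) (f g : {poly int}) : zirreducible f ->
  root (zpoly algC f) t -> root (zpoly algC g) t -> exists h, g = h * f.
Proof.
move=> [fmon firr] ft gt; have E := Pdiv.RingMonic.rdivp_eq fmon g.
exists (Pdiv.CommonRing.rdivp g f); rewrite {1}E [X in _ + X](_ : _ = 0) ?addr0 //.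
apply: (firr t) => //; last by rewrite Pdiv.CommonRing.ltn_rmodpN0 // monic_neq0.
move: gt; rewrite {1}E rmorphD rmorphM /= /root hornerD hornerM (rootP ft) mulr0 add0r.
by [].
Qed.

Lemma zirreducible_uniq (f : {poly int}) (rs : seq algC) : zirreducible f ->
  (1 < size f)%N -> zpoly algC f = \prod_(x <- rs) ('X - x%:P) -> uniq rs.
Proof.
move=> [fmon firr] f1 Df; rewrite -separable_prod_XsubC -Df unlock.
apply: Pdiv.ClosedField.root_coprimep => x fx; apply/negP => f'x.
have f0 : f != 0 by rewrite monic_neq0.
have : f^`() = 0 by apply: (firr x) => //; [rewrite /root -deriv_map | exact: lt_size_deriv].
move/(congr1 (fun g : {poly int} => g`_((size f).-2))); rewrite coef_deriv coef0.
have -> : (size f).-2.+1 = (size f).-1 by move: f1; clear; lia.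
rewrite -lead_coefE (monicP fmon) => /eqP; rewrite pnatr_eq0.
by move: f1; clear; lia.
Qed.

(** If P is the minimal polynomial of q(t), then f divides P(q), so that q(x) is a root of the monic
    integral P. *)
Lemma Aint_conj (t x : algC) (f : {poly int}) (q : {poly rat}) : zirreducible f ->
  (forall p, root (qpoly p) t = (zpoly rat f %| p)) -> root (zpoly algC f) x ->
  (qpoly q).[t] \in Aint -> (qpoly q).[x] \in Aint.
Proof.
move=> firr fmin fx; set y := _.[t] => yA.
have [P DP] : exists P, minCpoly y = zpoly algC P.
  by have /floorpP[P DP] : minCpoly y \is a polyOver Num.int by []; exists P.
have : zpoly rat f %| (zpoly rat P) \Po q.
  rewrite -fmin map_comp_poly qpoly_zpoly -DP /root horner_comp -/y.
  exact: root_minCpoly.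
case/dvdpP => s Ds; apply: (@root_monic_Aint (minCpoly y)).
- rewrite /root DP -horner_comp -qpoly_zpoly -map_comp_poly Ds rmorphM /= qpoly_zpoly.
  by rewrite hornerM (rootP fx) mulr0.
- exact: minCpoly_monic.
- by [].
Qed.

Lemma Aint_horner (g : {poly int}) (x : algC) : x \in Aint -> (zpoly algC g).[x] \in Aint.
Proof.
move=> xA; apply: rpred_horner => //; apply/polyOverP => i.
by rewrite coef_map /= Aint_int.
Qed.

(** Cramer's rule: for the coefficients c of q modulo f and the Vandermonde matrix V of the
    conjugates of t, the entries of c V are the values of q at these conjugates, which are integral.
    Hence c det V is integral; multiplying by a nonzero integer N divisible by det V makes N c
    rational and integral. *)
Lemma bounded_denominator (t : algC) (f : {poly int}) : zirreducible f ->
  root (zpoly algC f) t -> (1 < size f)%N ->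
  (forall p, root (qpoly p) t = (zpoly rat f %| p)) ->
  exists2 D : nat, (0 < D)%N & forall q : {poly rat}, (qpoly q).[t] \in Aint ->
    exists g : {poly int}, D%:R * (qpoly q).[t] = (zpoly algC g).[t].
Proof.
move=> firr ft f1 fmin.
have szf : size f = (size f).-2.+2 by move: f1; clear; lia.
have [rs Df szrs] := zpoly_algC_split firr szf; set n := (size f).-2 in szf szrs.
have urs := zirreducible_uniq firr f1 Df.
have rsA x : x \in rs -> root (zpoly algC f) x by rewrite Df root_prod_XsubC.
have rsI x : x \in rs -> x \in Aint.
  move=> /rsA fx; apply: (root_monic_Aint fx); first exact: monic_map (proj1 firr).
  by apply/polyOverP => i; rewrite coef_map /= intr_int.
pose a : 'rV[algC]_n.+1 := \row_j rs`_j; pose V := Vandermonde n.+1 a.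
have VA i j : V i j \in Aint.
  by rewrite !mxE rpredX // rsI // mem_nth // szrs.
have dA : \det V \in Aint by apply: rpred_sum => s _; rewrite rpredMsign rpred_prod.
have d0 : \det V != 0.
  rewrite det_Vandermonde; apply/prodf_neq0 => i _; apply/prodf_neq0 => j ij.
  rewrite !mxE subr_eq0 nth_uniq ?szrs // neq_ltn ij ?orbT //.
have [h [N [N0 hN]]] := Aint_dvd_int dA d0.
exists (absz N) => [|q qA]; first by rewrite absz_gt0.
pose q' := q %% zpoly rat f.
have qq' x : root (zpoly algC f) x -> (qpoly q').[x] = (qpoly q).[x].
  move=> fx; rewrite [q in RHS](divp_eq q (zpoly rat f)) -/q' rmorphD rmorphM /= qpoly_zpoly.
  by rewrite hornerD hornerM (rootP fx) mulr0 add0r.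
have szq : (size (qpoly q') <= n.+1)%N.
  have szQ : size (zpoly rat f) = size f.
    by rewrite size_map_poly_id0 // (monicP (proj1 firr)) oner_eq0.
  by rewrite size_map_poly -ltnS -[n.+2]szf -szQ ltn_modp -size_poly_eq0 szQ szf.
pose c : 'rV[algC]_n.+1 := poly_rV (qpoly q').
have cV j : (c *m V) 0 j \in Aint.
  rewrite mxE (eq_bigr (fun i : 'I_n.+1 => (qpoly q')`_i * rs`_j ^+ i)) => [|i _].
    have rj : rs`_j \in rs by rewrite mem_nth // szrs.
    rewrite -(horner_coef_wide _ szq) qq'; last exact: rsA.
    exact: Aint_conj firr fmin (rsA _ rj) qA.
  by rewrite !mxE.
have cd j : c 0 j * \det V \in Aint.
  have -> : c 0 j * \det V = (c *m V *m \adj V) 0 j.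
    by rewrite -mulmxA mul_mx_adj mul_mx_scalar [RHS]mxE mulrC.
  rewrite mxE; apply: rpred_sum => i _; apply: rpredM; first exact: cV.
  rewrite mxE /cofactor rpredMsign; apply: rpred_sum => s _; rewrite rpredMsign.
  by apply: rpred_prod => k _; rewrite mxE mxE.
have cN j : exists z : int, (absz N)%:R * c 0 j = z%:~R.
  have : (absz N)%:R * c 0 j \in Num.int.
    apply: Cint_rat_Aint.
      by rewrite rpredM ?rpred_nat // mxE coef_map /= Crat_rat.
    rewrite -[_%:R]/((absz N)%:Z%:~R) abszEsign rmorphM rmorphXn /= rmorphN1 -mulrA rpredMsign.
    by rewrite -hN mulrC mulrA rpredM ?cd // Aint_horner.
  by move/intrP.
have [z Hz] := choice cN.
exists (\poly_(i < n.+1) z (inord i)).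
rewrite -(qq' _ ft) (horner_coef_wide _ szq) mulr_sumr (horner_coef_wide t (leq_trans
  (size_poly _ _) (size_poly _ _))).
apply: eq_bigr => i _; rewrite mulrA [in RHS]coef_map [in RHS]coef_poly ltn_ord inord_val /=.
by rewrite -Hz mxE.
Qed.

(** If an integral polynomial of degree n + 1 with leading coefficient l kills x, then l^n times it
    is monic as a polynomial in l x. *)
Lemma Aint_scale (x : algC) : exists2 N : nat, (0 < N)%N & N%:R * x \in Aint.
Proof.
have [p [Dp pmon] pdvd] := minCpolyP x; have [P [a a0 DP]] := rat_poly_scale p.
have Px : root (zpoly algC P) x.
  have : root (qpoly p) x by rewrite -Dp root_minCpoly.
  by rewrite DP map_polyZ qpoly_zpoly rootZ // fmorph_eq0 invr_eq0 intr_eq0.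
have P0 : P != 0.
  by apply: contraTneq pmon => P0;
    rewrite DP P0 rmorph0 scaler0 monicE lead_coef0 eq_sym oner_eq0.
have P1 : (1 < size P)%N.
  have := @root_size_gt1 _ x (zpoly algC P).
  rewrite map_poly_eq0_id0 ?intr_eq0 ?lead_coef_eq0 // => /(_ P0 Px) /leq_trans; apply.
  exact: size_poly.
have szP : size P = (size P).-2.+2 by move: P1; clear; lia.
set n := (size P).-2 in szP; set l := lead_coef P.
have l0 : l != 0 by rewrite lead_coef_eq0.
have lx : l%:~R * x \in Aint.
  pose G : {poly int} := \poly_(i < n.+2) if i == n.+1 then 1 else P`_i * l ^+ (n - i).
  have Gmon : G \is monic.
    by rewrite monicE /G lead_coef_poly ?eqxx // oner_eq0.
  apply: (@root_monic_Aint (zpoly algC G)); last 2 first.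
  - exact: monic_map.
  - by apply/polyOverP => i; rewrite coef_map /= intr_int.
  rewrite /root (horner_coef_wide _ (leq_trans (size_poly _ _) (size_poly _ _))).
  have -> : \sum_(i < n.+2) (zpoly algC G)`_i * (l%:~R * x) ^+ i = l%:~R ^+ n * (zpoly algC
    P).[x].
    rewrite (horner_coef_wide (n := n.+2)); last by rewrite -szP size_poly.
    rewrite mulr_sumr; apply: eq_bigr => i _; rewrite !coef_map coef_poly ltn_ord exprMn /=.
    have [->|ni] := eqVneq (i : nat) n.+1.
      have -> : P`_n.+1 = l by rewrite /l lead_coefE szP.
      by rewrite rmorph1 mul1r mulrA exprSr.
    have le : (i <= n)%N by have := ltn_ord i; move: ni; clear; lia.
    have -> : (l%:~R : algC) ^+ n = l%:~R ^+ (n - i) * l%:~R ^+ i by rewrite -exprD subnK.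
    by rewrite rmorphM rmorphXn /=; ring.
  by rewrite (rootP Px) mulr0.
exists (absz l); first by rewrite absz_gt0.
by rewrite -[_%:R]/((absz l)%:Z%:~R) abszEsign rmorphM rmorphXn /= rmorphN1 -mulrA rpredMsign.
Qed.

Lemma num_field_primitive (K : fieldExtType rat) (iota : {rmorphism K -> algC}) :
  exists2 t : K, iota t \in Aint & forall x : K, exists q : {poly rat}, iota x = (qpoly
    q).[iota t].
Proof.
have [z [a Dz] [ps Ds]] := algC_PET (map iota (vbasis {:K})).
pose z0 : K := \sum_(i < size (map iota (vbasis {:K}))) (vbasis {:K})`_i *+ a i.
have Ez : iota z0 = z.
  rewrite Dz rmorph_sum; apply: eq_bigr => i _; rewrite rmorphMn (nth_map 0) //.
  by apply: (leq_trans (ltn_ord i)); rewrite size_map.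
have [N N0 NA] := Aint_scale z.
exists (N%:R * z0); first by rewrite rmorphM rmorph_nat Ez.
have zN : z = (N%:R^-1 * (N%:R * z)) by rewrite mulKf // pnatr_eq0 -lt0n.
move=> x; pose b := vbasis {:K}.
have [q Hq] : exists q : {poly rat}, iota x = (qpoly q).[z].
  exists (\sum_(i < \dim {:K}) coord b i x *: ps`_i).
  rewrite {1}(coord_vbasis (memvf x)) !rmorph_sum /= horner_sum; apply: eq_bigr => i _.
  rewrite rmorphZ_num -mul_polyC rmorphM /= map_polyC /= hornerM hornerC; congr (_ * _).
  have szs : size ps = \dim {:K}.
    by have := congr1 size Ds; rewrite !size_map size_tuple.
  have ib : (i < size b)%N by rewrite size_tuple.
  by have := congr1 (fun s => s`_i) Ds; rewrite (nth_map 0) // (nth_map 0) ?szs.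
exists (q \Po (N%:R^-1 *: 'X)); rewrite Hq map_comp_poly horner_comp; congr (_.[_]).
rewrite map_polyZ map_polyX /= hornerZ hornerX.
by rewrite fmorphV /= rmorphM !rmorph_nat Ez.
Qed.

(** The powers of X modulo an equation of c over F_p lie in a finite space, so two powers of c
    coincide. This torsion stands in for the finiteness of residue fields when points are shown to
    be closed. *)
Lemma torsion_closure_Fp (p : nat) : exists (K : closedFieldType) (h : {rmorphism 'F_p -> K}),
  forall c : K, c != 0 -> exists2 e, (0 < e)%N & c ^+ e = 1.
Proof.
have [K [h hint]] := countable_algebraic_closure 'F_p; exists K, h => c c0.
have [q qmon qc] := hint c; set m := (size q).-1.
pose v (i : 'I_#|'rV['F_p]_m|.+1) : 'rV['F_p]_m := poly_rV ('X^i %% q).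
have /injectivePn[i [j ij vij]] : ~~ injectiveb v.
  apply/negP => /injectiveP /(leq_card v); rewrite card_ord ltnn //.
wlog lij : i j ij vij / (i < j)%N.
  move=> H; have [lt|lt|E] := ltngtP i j; first exact: (H i j).
    by apply: (H j i) => //; rewrite eq_sym.
  by move: ij; rewrite (val_inj E) eqxx.
have mq : m.+1 = size q by rewrite prednK // size_poly_gt0 monic_neq0.
have sz k : (size ('X^k %% q)%R <= m)%N.
  by rewrite -ltnS mq ltn_modp monic_neq0.
have E : ('X^i %% q) = ('X^j %% q) by rewrite -(poly_rV_K (sz i)) -(poly_rV_K (sz j))
  -[LHS]/(rVpoly (v i)) vij.
have ev k : (map_poly h ('X^k %% q)).[c] = c ^+ k.
  have := congr1 (fun u => (map_poly h u).[c]) (divp_eq 'X^k q).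
  rewrite rmorphD rmorphM /= hornerD hornerM (rootP qc) mulr0 add0r => <-.
  by rewrite map_polyXn hornerXn.
exists (j - i)%N; first by rewrite subn_gt0.
apply: (mulIf (expf_neq0 i c0)); rewrite -exprD subnK ?(ltnW lij) // mul1r.
by rewrite -!ev E.
Qed.

Lemma nroots_of_frob (p n : nat) (K : closedFieldType) (h : {rmorphism 'F_p -> K})
  (f : {poly int}) : prime p -> f \is monic -> size f = n.+2 ->
  ~~ (p %| norm n f f^`())%Z ->
  (forall r : K, root (zpoly K f) r -> r ^+ p = r) -> nroots f p = n.+1.
Proof.
move=> pp fmon szf pf fr; have [l Dl] := closed_field_poly_normal (zpoly K f).
have mon : zpoly K f \is monic by exact: monic_map.
rewrite (monicP mon) scale1r in Dl.
have ul := dvd_norm_deriv_uniq h pp fmon szf Dl pf.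
have szl := size_rs fmon szf Dl.
apply/eqP; rewrite eqn_leq nroots_le //= -szl.
have lE : {subset l <= [seq ((r : nat)%:R : K) | r : 'I_p in [pred r : 'I_p | zroot f p r]]}.
  move=> x xl; have fx : root (zpoly K f) x by rewrite Dl root_prod_XsubC.
  have [c Dc] := intr_frob_fixed h pp (fr x fx).
  have p0 : p%:Z != 0 by rewrite -lt0n prime_gt0.
  pose s := absz (c %% p)%Z.
  have sE : s%:Z = (c %% p)%Z by rewrite gez0_abs // modz_ge0.
  have sp : (s < p)%N by rewrite -ltz_nat sE ltz_pmod ?ltz_nat ?prime_gt0.
  have sx : s%:R = x.
    rewrite pmulrn; apply/eqP; rewrite -Dc -subr_eq0 -rmorphB /= -(dvdz_closure h pp) sE.
    by rewrite -eqz_mod_dvd modz_mod.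
  apply/mapP; exists (Ordinal sp); last by rewrite /= sx.
  rewrite mem_enum inE /zroot sp /= (dvdz_closure h pp) -[_%:~R](horner_map (intmul 1)) /=.
  by rewrite -[_%:~R]/(s%:R) sx; exact: fx.
by have := uniq_leq_size ul lE; rewrite size_image.
Qed.

(** The n + 1 distinct roots of f modulo p are roots of X^p - X, so the remainder of X^p - X by f,
    of degree at most n, is divisible by p; it remains to evaluate at t. *)
Lemma Aint_frob (p n : nat) (f : {poly int}) (t : algC) : prime p ->
  f \is monic -> size f = n.+2 -> t \in Aint -> root (zpoly algC f) t ->
  nroots f p = n.+1 -> exists2 z, z \in Aint & t ^+ p - t = p%:R * z.
Proof.
move=> pp fmon szf tA ft nr; pose R := Pdiv.CommonRing.rmodp ('X^p - 'X) f.
have DR := Pdiv.RingMonic.rdivp_eq fmon ('X^p - 'X).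
have szR : (size R <= n.+1)%N.
  by rewrite -ltnS -szf Pdiv.CommonRing.ltn_rmodpN0 // monic_neq0.
have R0 : zpoly 'F_p R = 0.
  apply/eqP; apply: contraT => R0.
  pose s := [seq ((r : nat)%:R : 'F_p) | r : 'I_p in [pred r : 'I_p | zroot f p r]].
  have al : all (root (zpoly 'F_p R)) s.
    apply/allP => _ /mapP[r + ->]; rewrite mem_enum inE => /andP[_ fr]; rewrite /root.
    have := congr1 (fun q => (zpoly 'F_p q).[(r : nat)%:R]) DR.
    have -> : (zpoly 'F_p ('X^p - 'X)).[(r : nat)%:R] = 0.
      have := expf_card ((r : nat)%:R : 'F_p); rewrite card_Fp // => fr'.
      by rewrite rmorphB /= map_polyXn map_polyX !hornerE fr' subrr.
    rewrite rmorphD rmorphM /= hornerD hornerM.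
    have -> : (zpoly 'F_p f).[(r : nat)%:R] = 0.
      apply/eqP; move: fr; rewrite (dvdz_pcharf (pchar_Fp pp)).
      by rewrite -[_%:~R](horner_map (intmul 1)).
    by rewrite mulr0 add0r => <-.
  have us : uniq s.
    rewrite map_inj_in_uniq ?enum_uniq // => r u _ _ E; apply: val_inj.
    have := congr1 (@nat_of_ord _) E; rewrite !val_Fp_nat ?prime_gt1 //=.
    by rewrite !modn_small.
  have := max_poly_roots R0 al us; rewrite size_image -/(nroots f p) nr => lt.
  by have := leq_trans lt (leq_trans (size_poly _ _) szR); rewrite ltnn.
have Rp i : exists z : int, R`_i = p%:Z * z.
  have : (p %| R`_i)%Z.
    rewrite (dvdz_pcharf (pchar_Fp pp)); apply/eqP.
    by have := congr1 (fun q : {poly 'F_p} => q`_i) R0; rewrite coef_map coef0.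
  by case/dvdzP => z ->; exists z; rewrite mulrC.
have [z Hz] := choice Rp; pose g : {poly int} := \poly_(i < n.+1) z i.
have RE : R = p%:Z%:P * g.
  apply/polyP => i; rewrite coefCM coef_poly; case: ltnP => [_|ni]; first exact: Hz.
  by rewrite mulr0 nth_default // (leq_trans szR).
exists (zpoly algC g).[t]; first exact: Aint_horner.
have E : zpoly algC ('X^p - 'X) =
    zpoly algC (Pdiv.CommonRing.rdivp ('X^p - 'X) f) * zpoly algC f + p%:R%:P * zpoly algC g.
  by rewrite {1}DR -/R RE rmorphD !rmorphM /= map_polyC.
have := congr1 (fun q : {poly algC} => q.[t]) E.
by rewrite rmorphB /= map_polyXn map_polyX !hornerE (rootP ft) mulr0 add0r.
Qed.

(** Complete splitting of p as seen by one algebraic integer. The condition is stable under sums,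
    which carries splitting from t_1 and t_2 to a generator of the compositum. *)
Definition frob_fixed (p : nat) (x : algC) : Prop :=
  x \in Aint /\ exists2 z, z \in Aint & x ^+ p - x = p%:R * z.

Lemma exprD_prime (R : comNzRingType) (l : nat) (x y : R) : prime l ->
  (x + y) ^+ l = x ^+ l + y ^+ l +
    l%:R * \sum_(i < l.-1) x ^+ (l - i.+1) * y ^+ i.+1 *+ ('C(l, i.+1) %/ l).
Proof.
case: l => [//|l] pl; rewrite exprDn big_ord_recl big_ord_recr /=.
rewrite bin0 subn0 expr0 mulr1 mulr1n /bump leq0n add1n subnn binn expr0 mul1r mulr1n.
rewrite addrA addrAC; congr (_ + _); rewrite mulr_sumr; apply: eq_bigr => i _.
rewrite /bump leq0n add1n; have lC : (l.+1 %| 'C(l.+1, i.+1))%N.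
  by apply: prime_dvd_bin => //=; rewrite ltnS.
by rewrite -{1}(divnK lC) mulrnA mulr_natl.
Qed.

Lemma frob_fixedD p x y : prime p -> frob_fixed p x -> frob_fixed p y ->
  frob_fixed p (x + y).
Proof.
case: p => [//|p] pp [xA [u uA xu]] [yA [v vA yv]]; split; first exact: rpredD.
have [w wA Dw] : exists2 w, w \in Aint & (x + y) ^+ p.+1 = x ^+ p.+1 + y ^+ p.+1 + p.+1%:R * w.
  eexists; last exact: exprD_prime.
  by apply: rpred_sum => i _; rewrite rpredMn // rpredM ?rpredX.
exists (u + v + w); first by rewrite !rpredD.
by rewrite Dw !mulrDr -xu -yv; ring.
Qed.

Lemma frob_fixedMn p x a : prime p -> frob_fixed p x -> frob_fixed p (x *+ a).
Proof.
move=> pp xf; elim: a => [|a IH]; last by rewrite mulrS; apply: frob_fixedD.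
split; first exact: Aint0; exists 0; first exact: Aint0.
by rewrite mulr0n expr0n eqn0Ngt prime_gt0 // subr0 mulr0.
Qed.

(** Write z^p - z = p w and D w = g(z). Then f divides D (X^p - X) - p g, and modulo p this shows
    that Frobenius fixes every root of f. *)
Lemma nroots_of_frob_fixed (p n D : nat) (f : {poly int}) (z : algC) : prime p ->
  zirreducible f -> size f = n.+2 -> root (zpoly algC f) z ->
  (forall q : {poly rat}, (qpoly q).[z] \in Aint ->
    exists g : {poly int}, D%:R * (qpoly q).[z] = (zpoly algC g).[z]) ->
  ~~ (p %| norm n f f^`())%Z -> ~~ (p %| D)%N -> frob_fixed p z -> nroots f p = n.+1.
Proof.
move=> pp firr szf fz Dz pf pD [zA [w wA zw]].
have [K [h _]] := torsion_closure_Fp p.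
apply: (nroots_of_frob h pp (proj1 firr) szf pf) => r fr.
have p0 : p%:R != 0 :> algC by rewrite pnatr_eq0 -lt0n prime_gt0.
have Ew : w = (qpoly (p%:R^-1 *: ('X^p - 'X))).[z].
  rewrite map_polyZ rmorphB /= map_polyXn map_polyX hornerZ !hornerE zw.
  by rewrite fmorphV rmorph_nat mulKf.
have [g Hg] : exists g : {poly int}, D%:R * w = (zpoly algC g).[z].
  by rewrite Ew; apply: Dz; rewrite -Ew.
have : root (zpoly algC (D%:Z%:P * ('X^p - 'X) - p%:Z%:P * g)) z.
  rewrite rmorphB !rmorphM rmorphB /= !map_polyC map_polyXn map_polyX /root !hornerE.
  by rewrite zw -Hg mulrCA subr_eq0; apply/eqP.
move=> /(zpoly_root_dvd firr fz)[q E].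
have : D%:R * (r ^+ p - r) - p%:R * (zpoly K g).[r] = 0.
  have := congr1 (fun g => (zpoly K g).[r]) E.
  rewrite [in X in _ = X -> _]rmorphM /= hornerM (rootP fr) mulr0 => <-.
  by rewrite rmorphB !rmorphM rmorphB /= !map_polyC map_polyXn map_polyX !hornerE.
have -> : p%:R = 0 :> K by apply/eqP; rewrite pmulrn -(dvdz_closure h pp).
rewrite mul0r subr0 => /eqP; rewrite mulf_eq0 pmulrn -(dvdz_closure h pp).
by rewrite -[(_ %| _)%Z]/(p %| D)%N (negPf pD) subr_eq0 => /eqP.
Qed.

(** The 2 d elements s^i and z s^i with i < d lie in Q(z), of dimension at most m < 2 d, so u(s) + z
    v(s) = 0 for some u and v of degree below d, not both zero. By minimality of f, v(s) is nonzero,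
    and z lies in Q(s). *)
Lemma small_degree_generator (s z : algC) (f g : {poly int}) (q : {poly rat}) :
  zirreducible f -> root (zpoly algC f) s -> root (zpoly algC g) z -> g \is monic ->
  (1 < size g)%N -> s = (qpoly q).[z] -> ((size g).-1 < 2 * (size f).-1)%N ->
  exists u v : {poly rat}, z = (qpoly u).[s] / (qpoly v).[s].
Proof.
move=> [fmon firr] fs gz gmon g1 sz lt.
set m := (size g).-1 in lt; set d := (size f).-1 in lt.
pose red (h : {poly rat}) : {poly rat} := h %% zpoly rat g.
have redE h : (qpoly (red h)).[z] = (qpoly h).[z].
  rewrite [h in RHS](divp_eq h (zpoly rat g)) -/(red h) rmorphD rmorphM /= qpoly_zpoly.
  by rewrite hornerD hornerM (rootP gz) mulr0 add0r.
have szgQ : size (zpoly rat g) = size g.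
  by rewrite size_map_poly_id0 // (monicP gmon) oner_eq0.
have sred h : (size (red h) <= m)%N.
  rewrite -ltnS prednK ?(ltnW g1) // -szgQ ltn_modp -size_poly_eq0 szgQ.
  by rewrite -lt0n (ltnW g1).
pose B : 'M[rat]_(d + d, m) := col_mx (\matrix_(i < d) poly_rV (red (q ^+ i)))
   (\matrix_(i < d) poly_rV (red ('X * q ^+ i))).
have [w w0 wB] : exists2 w : 'rV_(d + d), w != 0 & w *m B = 0.
  have : kermx B != 0.
    rewrite kermx_eq0 -row_leq_rank -ltnNge (leq_ltn_trans (rank_leq_col _)) //.
    by rewrite addnn -mul2n.
  by case/rowV0Pn => w /sub_kermxP wB w0; exists w.
pose u := rVpoly (lsubmx w); pose v := rVpoly (rsubmx w).
have szu : (size u <= d)%N by exact: size_poly.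
have szv : (size v <= d)%N by exact: size_poly.
pose Phi (x : 'rV[rat]_m) := (qpoly (rVpoly x)).[z].
have Phi_red h : Phi (poly_rV (red h)) = (qpoly h).[z].
  by rewrite /Phi poly_rV_K ?sred // redE.
have Phi_mul (c : 'rV_d) (A : 'M_(d, m)) :
    Phi (c *m A) = \sum_i ratr (c 0 i) * Phi (row i A).
  rewrite mulmx_sum_row /Phi linear_sum rmorph_sum horner_sum; apply: eq_bigr => i _.
  by rewrite linearZ /= map_polyZ hornerZ.
have evs (c : 'rV_d) : (qpoly (rVpoly c)).[s] = \sum_i ratr (c 0 i) * s ^+ i.
  rewrite (horner_coef_wide (n := d)); last by rewrite size_map_poly size_poly.
  by apply: eq_bigr => i _; rewrite coef_map coef_rVpoly_ord.
have rel : (qpoly u).[s] + z * (qpoly v).[s] = 0.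
  have : Phi (lsubmx w *m \matrix_(i < d) poly_rV (red (q ^+ i)) +
     rsubmx w *m \matrix_(i < d) poly_rV (red ('X * q ^+ i))) = 0.
    by rewrite -mul_row_col hsubmxK wB /Phi linear0 rmorph0 horner0.
  rewrite {1}/Phi linearD rmorphD hornerD -![_.[z]]/(Phi _) !Phi_mul !evs mulr_sumr => E.
  rewrite -[RHS]E; congr (_ + _); apply: eq_bigr => i _; rewrite rowK Phi_red.
    by rewrite rmorphXn horner_exp -sz.
  by rewrite rmorphM rmorphXn /= map_polyX hornerM horner_exp hornerX -sz mulrCA.
have nz (h : {poly rat}) : (size h <= d)%N -> (qpoly h).[s] = 0 -> h = 0.
  have [P [a a0 ->]] := rat_poly_scale h.
  have ia0 : a%:~R^-1 != 0 :> rat by rewrite invr_eq0 intr_eq0.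
  rewrite size_scale // map_polyZ hornerZ qpoly_zpoly => szP /eqP.
  rewrite mulf_eq0 fmorph_eq0 (negPf ia0) /= => Ps.
  rewrite (firr s P fs Ps) ?rmorph0 ?scaler0 //.
  have [->|P0] := eqVneq P 0; first by rewrite size_poly0 size_poly_gt0 monic_neq0.
  rewrite size_map_poly_id0 ?intr_eq0 ?lead_coef_eq0 // in szP.
  by apply: leq_ltn_trans szP _; rewrite prednK // size_poly_gt0 monic_neq0.
have v0 : v != 0.
  apply: contraNneq w0 => v0; have u0 : u = 0.
    by apply: nz => //; move: rel; rewrite v0 rmorph0 horner0 mulr0 addr0.
  rewrite -(hsubmxK w) -(rVpolyK (lsubmx w)) -(rVpolyK (rsubmx w)) -/u -/v u0 v0.
  by rewrite !linear0 row_mx0.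
exists (- u), v; rewrite rmorphN hornerN.
have vs0 : (qpoly v).[s] != 0 by apply: contra v0 => /eqP /nz ->.
by move/eqP: rel; rewrite addr_eq0 => /eqP ->; rewrite opprK mulfK.
Qed.

Local Open Scope classical_set_scope.
Local Open Scope ring_scope.

(** * Residue fields and closed points *)

Section Integers.
Variable L : set algC.
Hypothesis HL : is_subfield L.

Lemma subfield0 : L 0.
Proof. by case: HL => L1 LB _; rewrite -(subrr 1); exact: LB. Qed.

Lemma subfieldN x : L x -> L (- x).
Proof. by case: HL => _ LB _ Lx; rewrite -sub0r; apply: LB => //; exact: subfield0. Qed.

Lemma subfieldD x y : L x -> L y -> L (x + y).
Proof. by case: HL => _ LB _ Lx Ly; rewrite -[y]opprK; apply: LB => //; exact: subfieldN. Qed.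

Lemma subfieldM x y : L x -> L y -> L (x * y).
Proof.
case: HL => L1 _ LV Lx Ly; rewrite -[y]invrK; apply: (LV) => //.
by rewrite -div1r; exact: LV.
Qed.

Lemma subfield_horner (g : {poly int}) x : L x -> L (zpoly algC g).[x].
Proof.
move=> Lx; have Ln (k : nat) : L k%:R.
  by elim: k => [|k IH]; [exact: subfield0 | rewrite -natr1; apply: subfieldD => //; case: HL].
elim/poly_ind: g => [|g c IH]; first by rewrite rmorph0 horner0; exact: subfield0.
rewrite rmorphD rmorphM /= map_polyX map_polyC /= !hornerE; apply: subfieldD.
  exact: subfieldM.
by case: c => k; [exact: Ln | rewrite NegzE rmorphN; apply/subfieldN/Ln].
Qed.

Lemma integersD x y : integers L x -> integers L y -> integers L (x + y).
Proof. by move=> [Lx xA] [Ly yA]; split; [exact: subfieldD | exact: rpredD]. Qed.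

Lemma integersM x y : integers L x -> integers L y -> integers L (x * y).
Proof. by move=> [Lx xA] [Ly yA]; split; [exact: subfieldM | exact: rpredM]. Qed.

Lemma integersN x : integers L x -> integers L (- x).
Proof. by move=> [Lx xA]; split; [exact: subfieldN | rewrite rpredN]. Qed.

Lemma integers_horner (g : {poly int}) x : integers L x -> integers L (zpoly algC g).[x].
Proof. by move=> [Lx xA]; split; [exact: subfield_horner | exact: Aint_horner]. Qed.

Lemma integers_int (z : int) : integers L z%:~R.
Proof.
have := @integers_horner z%:P 0; rewrite map_polyC hornerC; apply.
by split; [exact: subfield0 | exact: Aint0].
Qed.

Lemma integers1 : integers L 1. Proof. exact: (integers_int 1). Qed.

Lemma integersX x k : integers L x -> integers L (x ^+ k).
Proof.
by move=> Ox; elim: k => [|k IH]; [exact: integers1 | rewrite exprS; exact: integersM].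
Qed.
End Integers.

(** Z[t] maps to F by t -> r, and x goes to g(r)/D when D x = g(t). As D is invertible in F, a root
    of f in F alone defines a character of O_L. *)
Lemma residue_map (L : set algC) (t : algC) (f : {poly int}) (D : nat)
    (F : fieldType) (r : F) :
  is_subfield L -> zirreducible f -> root (zpoly algC f) t ->
  (forall x, integers L x -> exists g : {poly int}, D%:R * x = (zpoly algC g).[t]) ->
  root (zpoly F f) r -> D%:R != 0 :> F -> (0 < D)%N ->
  exists phi : algC -> F, [/\
    forall x y, integers L x -> integers L y -> phi (x + y) = phi x + phi y,
    forall x y, integers L x -> integers L y -> phi (x * y) = phi x * phi y &
    forall g : {poly int}, phi (zpoly algC g).[t] = (zpoly F g).[r]].
Proof.
move=> HL firr ft HD fr DF D0.
pose phi x := if pselect (exists g : {poly int}, D%:R * x = (zpoly algC g).[t]) is left e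
  then (zpoly F (sval (cid e))).[r] / D%:R else 0.
have wd (g h : {poly int}) : (zpoly algC g).[t] = (zpoly algC h).[t] ->
    (zpoly F g).[r] = (zpoly F h).[r].
  move=> /eqP; rewrite -subr_eq0 -hornerN -hornerD -rmorphB /= => /(zpoly_root_dvd firr ft)[k].
  move=> /(congr1 (fun u => (zpoly F u).[r])).
  rewrite rmorphB rmorphM /= hornerD hornerN hornerM (rootP fr) mulr0.
  by move=> /eqP; rewrite subr_eq0 => /eqP.
have phiE x (g : {poly int}) : D%:R * x = (zpoly algC g).[t] -> phi x = (zpoly F g).[r] / D%:R.
  move=> Dx; rewrite /phi; case: pselect => [e|[]]; last by exists g.
  by congr (_ / _); apply: wd; rewrite -Dx; case: cid.
exists phi; split=> [x y Ox Oy|x y Ox Oy|g].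
- have [g Dg] := HD x Ox; have [h Dh] := HD y Oy.
  rewrite (phiE x g) // (phiE y h) // (phiE (x + y) (g + h)); last first.
    by rewrite mulrDr Dg Dh rmorphD hornerD.
  by rewrite rmorphD /= hornerD mulrDl.
- have [g Dg] := HD x Ox; have [h Dh] := HD y Oy.
  have [k Dk] := HD _ (integersM HL Ox Oy).
  rewrite (phiE x g) // (phiE y h) // (phiE (x * y) k) //.
  have : (zpoly F (D%:Z%:P * k)).[r] = (zpoly F (g * h)).[r].
    apply: wd; rewrite !rmorphM /= map_polyC !hornerM hornerC -Dk -Dg -Dh /=.
    rewrite -[_ 1 D]/(D%:R : algC); ring.
  rewrite !rmorphM /= map_polyC !hornerM hornerC -[_ 1 D]/(D%:R : F) => E.
  by apply: (mulfI DF); rewrite mulrA E; field.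
- rewrite (phiE _ (D%:Z%:P * g)); last by rewrite rmorphM /= map_polyC hornerM hornerC.
  by rewrite rmorphM /= map_polyC hornerM hornerC mulrAC -[_ 1 D]/(D%:R : F) divff ?mul1r.
Qed.

Section SIntegers.
Variables (K : fieldExtType rat) (iota : {rmorphism K -> algC}) (S : set (place K)).
Local Notation L := (range iota).
Local Notation O := (integers L).
Local Notation A := (S_integers iota S L).

Lemma range_subfield : is_subfield L.
Proof.
split=> [|_ _ [x _ <-] [y _ <-]|_ _ [x _ <-] [y _ <-]].
- by exists 1 => //; rewrite rmorph1.
- by exists (x - y) => //; rewrite rmorphB.
- by exists (x / y) => //; rewrite fmorph_div.
Qed.
Let HL := range_subfield.

Lemma finite_prime_below P : finite_primes L P -> prime_below L P = P.
Proof.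
move=> [[[PO _ _ _] _ _] _]; apply/seteqP; split=> [x []//|x Px]; split=> //; exact: PO.
Qed.

Lemma integers_S_integers x : O x -> A x.
Proof.
move=> Ox; split; first by case: Ox.
move=> P [[_ P1 _] _] _; exists x, 1; split=> //; first exact: integers1.
by rewrite divr1.
Qed.

Lemma S_integersD x y : A x -> A y -> A (x + y).
Proof.
move=> [Lx xP] [Ly yP]; split; first exact: subfieldD.
move=> P FP SP; have [a [b [Oa Ob Pb ->]]] := xP P FP SP.
have [a' [b' [Oa' Ob' Pb' ->]]] := yP P FP SP.
case: FP => -[[PO P0 _ _] P1 Pp] _.
have b0 : b != 0 by apply: contra_notN Pb => /eqP ->.
have b'0 : b' != 0 by apply: contra_notN Pb' => /eqP ->.
exists (a * b' + a' * b), (b * b'); split.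
- by apply: integersD => //; exact: integersM.
- exact: integersM.
- by move=> /Pp[].
- by field; rewrite b0 b'0.
Qed.

Lemma S_integersM x y : A x -> A y -> A (x * y).
Proof.
move=> [Lx xP] [Ly yP]; split; first exact: subfieldM.
move=> P FP SP; have [a [b [Oa Ob Pb ->]]] := xP P FP SP.
have [a' [b' [Oa' Ob' Pb' ->]]] := yP P FP SP.
case: FP => -[[PO P0 _ _] P1 Pp] _.
exists (a * a'), (b * b'); split; [exact: integersM|exact: integersM|by move=> /Pp[]|].
by rewrite invfM mulrACA.
Qed.

Lemma maximal_prime Q x y : maximal_ideal A Q -> A x -> A y -> Q (x * y) -> Q x \/ Q y.
Proof.
move=> [[QA Q0 QD QM] Q1 Qmax] Ax Ay Qxy.
have [Qx|nQx] := pselect (Q x); [by left|right].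
pose J : set algC := [set z | exists q s, [/\ Q q, A s & z = q + s * x]].
have A1 : A 1 by apply: integers_S_integers; exact: integers1.
have JI : is_ideal A J.
  split.
  - by move=> _ [q [s [Qq As ->]]]; apply: S_integersD; [exact: QA | exact: S_integersM].
  - by exists 0, 0; split; [exact: Q0|apply: QA; exact: Q0|rewrite mul0r addr0].
  - move=> _ _ [q [s [Qq As ->]]] [q' [s' [Qq' As' ->]]].
    by exists (q + q'), (s + s'); split; [exact: QD|exact: S_integersD|ring].
  - move=> a _ Aa [q [s [Qq As ->]]]; exists (a * q), (a * s).
    by split; [exact: QM|exact: S_integersM|ring].
have QJ : Q `<=` J.
  move=> q Qq; exists q, 0; split=> //; last by rewrite mul0r addr0.
  by apply: QA; exact: Q0.
have [JQ|JA] := Qmax J JI QJ.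
  case: nQx; rewrite -JQ; exists 0, 1; split=> //; by rewrite add0r mul1r.
have : J 1 by rewrite JA.
case=> q [s [Qq As E]]; rewrite -[y]mul1r E mulrDl -mulrA [q * y]mulrC.
by apply: QD; apply: QM.
Qed.

Lemma maximal_contraction Q (p : nat) : maximal_ideal A Q -> Q p%:R -> (0 < p)%N ->
  finite_primes L (Q `&` O).
Proof.
move=> Qmax Qp p0; have [[QA Q0 QD QM] Q1 _] := Qmax; split; last first.
  exists p%:R; last by rewrite pnatr_eq0 -lt0n.
  by split=> //; exact: (integers_int HL p).
split; first split.
- by move=> x [].
- by split=> //; exact: (integers_int HL 0).
- by move=> x y [Qx Ox] [Qy Oy]; split; [exact: QD|exact: integersD].
- move=> a x Oa [Qx Ox]; split; last exact: integersM.
  by apply: QM => //; exact: integers_S_integers.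
- by case.
move=> x y Ox Oy [Qxy _].
have [] := maximal_prime Qmax (integers_S_integers Ox) (integers_S_integers Oy) Qxy.
  by left.
by right.
Qed.

Section Residue.
Variables (F : fieldType) (phi : algC -> F) (p : nat).
Hypotheses (phiD : forall x y, O x -> O y -> phi (x + y) = phi x + phi y)
  (phiM : forall x y, O x -> O y -> phi (x * y) = phi x * phi y)
  (phi1 : phi 1 = 1) (phip : phi p%:R = 0) (p0 : (0 < p)%N)
  (Ftors : forall c : F, c != 0 -> exists2 e, (0 < e)%N & c ^+ e = 1)
  (Sp : forall P, S (FinPlace P) -> ~ P p%:R).

(** The kernel of [phi] extended to fractions with denominator outside it: the trace on the
    S-integers of the maximal ideal of the local ring at this kernel. *)
Definition residue_point : set algC :=
  [set x | A x /\ exists a b, [/\ O a, O b, phi a = 0, phi b != 0 & x = a / b]].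

Lemma residue0 : phi 0 = 0.
Proof.
have := phiD (integers_int HL 0) (integers_int HL 0); rewrite addr0 => /esym/eqP.
by rewrite -subr_eq0 addrK => /eqP.
Qed.

Lemma residueX x e : O x -> phi (x ^+ e) = phi x ^+ e.
Proof.
move=> Ox; elim: e => [|e IH]; first by rewrite !expr0.
by rewrite !exprS phiM ?IH //; exact: integersX.
Qed.

Lemma residue_kernel_prime : finite_primes L [set x | O x /\ phi x = 0].
Proof.
split; last first.
  by exists p%:R; [split=> //; exact: (integers_int HL p)|rewrite pnatr_eq0 -lt0n].
split; first split.
- by move=> x [].
- by split; [exact: (integers_int HL 0)|exact: residue0].
- by move=> x y [Ox x0] [Oy y0]; split; [exact: integersD|rewrite phiD // x0 y0 addr0].
- by move=> a x Oa [Ox x0]; split; [exact: integersM|rewrite phiM // x0 mulr0].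
- by move=> [_] /eqP; rewrite phi1 oner_eq0.
move=> x y Ox Oy [_]; rewrite phiM // => /eqP; rewrite mulf_eq0 => /orP[] /eqP z; [left|right];
  by split.
Qed.

(** The kernel of [phi] is a finite prime that contains p, hence not in S, and the definition of
    S-integers applies to it. *)
Lemma S_integers_residue x : A x -> exists a b, [/\ O a, O b, phi b != 0 & x = a / b].
Proof.
move=> [_ /(_ _ residue_kernel_prime)]; rewrite finite_prime_below;
  last exact: residue_kernel_prime.
case=> [/Sp|a [b [Oa Ob Pb ->]]]; first by apply; split=> //; exact: (integers_int HL p).
by exists a, b; split=> //; apply: contra_notN Pb => /eqP; split.
Qed.

Lemma residue_point_integer x : O x -> residue_point x <-> phi x = 0.
Proof.
move=> Ox; split=> [[_ [a [b [Oa Ob a0 b0 E]]]]|x0].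
  have b0' : b != 0 by apply: contraNneq b0 => ->; rewrite residue0.
  have : phi (x * b) = 0 by rewrite E mulfVK.
  by rewrite phiM // => /eqP; rewrite mulf_eq0 (negPf b0) orbF => /eqP.
split; first exact: integers_S_integers.
by exists x, 1; split; rewrite ?divr1 ?phi1 ?oner_eq0 //; exact: integers1.
Qed.

(** If a larger ideal J contains a / b with phi(a) nonzero, it contains a. As phi(a) has finite
    order e, 1 - a^e lies in the kernel, and 1 lies in J. *)
Lemma residue_point_closed : maximal_ideal A residue_point.
Proof.
have nz b : phi b != 0 -> b != 0 by apply: contraNneq => ->; rewrite residue0.
have I : is_ideal A residue_point.
  split.
  - by move=> x [].
  - by apply/residue_point_integer; [exact: (integers_int HL 0)|exact: residue0].
  - move=> x y [Ax [a [b [Oa Ob a0 b0 Ex]]]] [Ay [c [d [Oc Od c0 d0 Ey]]]].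
    split; first exact: S_integersD.
    exists (a * d + c * b), (b * d); split.
    + by apply: integersD => //; exact: integersM.
    + exact: integersM.
    + by rewrite phiD ?phiM ?a0 ?c0 ?mul0r ?addr0 //; exact: integersM.
    + by rewrite phiM // mulf_neq0.
    + by rewrite Ex Ey; field; rewrite !nz.
  - move=> c x Ac [Ax [a [b [Oa Ob a0 b0 Ex]]]]; split; first exact: S_integersM.
    have [u [v [Ou Ov v0 Ec]]] := S_integers_residue Ac.
    exists (u * a), (v * b); split; [exact: integersM|exact: integersM| | |].
    + by rewrite phiM // a0 mulr0.
    + by rewrite phiM // mulf_neq0.
    + by rewrite Ex Ec; field; rewrite !nz.
have n1 : ~ residue_point 1.
  by move=> /(residue_point_integer (integers1 HL)) /eqP; rewrite phi1 oner_eq0.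
split=> // J [JA J0 JD JM] QJ.
have [JQ|nJQ] := pselect (J `<=` residue_point); first by left; apply/seteqP; split.
right; apply/seteqP; split=> [x /JA //|x Ax].
have [y Jy nQy] : exists2 y, J y & ~ residue_point y.
  by apply: contrapT => H; apply: nJQ => y Jy; apply: contrapT => nQ; apply: H; exists y.
have [a [b [Oa Ob b0 Ey]]] := S_integers_residue (JA _ Jy).
have a0 : phi a != 0.
  apply: contra_notN nQy => /eqP a0; split; first exact: JA.
  by exists a, b.
have [e e0 ae] := Ftors a0.
have Ja : J a.
  have -> : a = b * y by rewrite Ey mulrC mulfVK ?nz.
  by apply: JM => //; exact: integers_S_integers.
have Jae : J (a ^+ e).
  rewrite -(prednK e0) exprSr; apply: JM => //.
  by apply: integers_S_integers; exact: integersX.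
have OaN : O (- a ^+ e) by apply: integersN => //; exact: integersX.
have J1 : J 1.
  rewrite -[1](subrK (a ^+ e)); apply: JD => //; apply: QJ; apply/residue_point_integer.
    by apply: integersD => //; exact: integers1.
  have : phi (1 - a ^+ e + a ^+ e) = 1 by rewrite subrK.
  rewrite phiD ?residueX ?ae //; last 2 first.
  - by apply: integersD => //; exact: integers1.
  - exact: integersX.
  by move=> /(canRL (addrK 1)); rewrite subrr.
by rewrite -[x]mulr1; exact: JM.
Qed.
End Residue.
End SIntegers.

(** In a Galois number field containing s and x, some automorphism over Q(s) moves x, and it extends
    to algC. *)
Lemma algC_aut_moves (s x : algC) : (forall q : {poly rat}, x <> (qpoly q).[s]) ->
  exists nu : {rmorphism algC -> algC}, nu s = s /\ nu x != x.
Proof.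
move=> nx; have [z _ [ps Ds]] := algC_PET [:: s; x].
have [p [Dp pmon] pdvd] := minCpolyP z.
have [r Dr] := closed_field_poly_normal (qpoly p).
have mon : qpoly p \is monic by rewrite -Dp minCpoly_monic.
rewrite (monicP mon) scale1r in Dr.
have [Qs [QsC [rr Drr genQs]]] := num_field_exists r.
have zr : z \in r by rewrite -root_prod_XsubC -Dr pdvd.
have [zz Dz] : exists zz, QsC zz = z.
  by move: zr; rewrite -Drr => /mapP[zz _ ->]; exists zz.
have QsC_poly q : map_poly QsC (map_poly (in_alg Qs) q) = qpoly q.
  rewrite -map_poly_comp; apply: eq_map_poly => a /=.
  by rewrite rmorphZ_num rmorph1 mulr1.
pose pr := map_poly (in_alg Qs) p.
have prover : pr \is a polyOver 1%VS by apply/polyOver1P; exists p.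
have Dpr : pr = \prod_(y <- rr) ('X - y%:P).
  apply: (map_poly_inj QsC); rewrite QsC_poly Dr -Drr big_map rmorph_prod /=.
  by apply: eq_bigr => y _; rewrite map_polyXsubC.
have spl : splittingFieldFor 1 pr {:Qs} by exists rr => //; rewrite Dpr eqpxx.
have Qn_ax : FieldExt_isSplittingField _ Qs by constructor; exists pr.
pose Qn : splittingFieldType rat := HB.pack_for (splittingFieldType rat) Qs Qn_ax.
have evz (q : {poly rat}) : QsC (map_poly (in_alg Qs) q).[zz] = (qpoly q).[z].
  by rewrite -horner_map Dz QsC_poly.
have [a Da] : exists a : Qn, QsC a = s.
  exists (map_poly (in_alg Qs) ps`_0).[zz]; rewrite evz.
  by case: (ps) Ds => [|q [|q' [|]]] //= [-> _].
have [b Db] : exists b : Qn, QsC b = x.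
  exists (map_poly (in_alg Qs) ps`_1).[zz]; rewrite evz.
  by case: (ps) Ds => [|q [|q' [|]]] //= [_ ->].
have gal1 : galois 1 {:Qn}.
  apply/and3P; split; first exact: sub1v.
    apply/separableP => y _; apply: pcharf0_separable => q.
    by rewrite -(fmorph_pchar QsC) pchar_num.
  by apply/splitting_normalField; [exact: sub1v | exists pr].
have galK : galois <<1; a>> {:Qn} by apply: galoisS gal1; rewrite sub1v subvf.
have bK : b \notin <<1; a>>%VS.
  apply/negP => /Fadjoin_polyP[q /polyOver1P[q' ->] E].
  by apply: (nx q'); rewrite -Db E -horner_map Da QsC_poly.
have [g gG gb] : exists2 g, g \in 'Gal({:Qn} / <<1; a>>)%g & g b != b.
  apply: contrapT => H; case/negP: bK; move/galois_fixedField: galK => <-.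
  apply/fixedFieldP; first exact: memvf.
  by move=> g gG; apply/eqP; apply: contraT => gb; case: H; exists g.
have [nu Dnu] := extend_algC_subfield_aut (QsC : {rmorphism Qn -> algC}) g.
exists nu; split; last by rewrite -Db -Dnu (inj_eq (fmorph_inj QsC)).
have ga : g a = a := fixed_gal (subvf _) gG (memv_adjoin _ _).
by rewrite -Da -Dnu; exact: (congr1 QsC ga).
Qed.

(** * Prime ideals of rings of integers *)

(** Finiteness of O_L in a usable form: D O_L lies in the Z-span of 1, t, ..., t^(d-1). The
    pigeonhole arguments below run in this lattice. *)
Definition lattice_bound (L : set algC) (t : algC) (d D : nat) : Prop :=
  [/\ is_subfield L, integers L t, (0 < D)%N & forall x, integers L x ->
    exists2 g : {poly int}, (size g <= d)%N & D%:R * x = (zpoly algC g).[t]].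

Section NumberRing.
Variables (L : set algC) (t : algC) (d D : nat).
Hypothesis LB : lattice_bound L t d D.
Local Notation O := (integers L).

Lemma bound_subfield : is_subfield L. Proof. by case: LB. Qed.
Local Notation HL := bound_subfield.

Lemma int_combination_dvd (N : nat) (g : {poly int}) : (0 < N)%N ->
  (forall i, (N %| g`_i)%Z) -> exists2 k : {poly int}, (size k <= size g)%N & g = N%:Z%:P * k.
Proof.
move=> N0 Ng; exists (\poly_(i < size g) (g`_i %/ N)%Z); first exact: size_poly.
apply/polyP => i; rewrite coefCM coef_poly; case: ltnP => [_|gi].
  by rewrite mulrC divzK.
by rewrite mulr0 nth_default.
Qed.

(** The coefficients of D x modulo N D classify x: if those of x and y agree, D (x - y) is N D times
    an element of Z[t]. *)
Lemma finite_classes (N : nat) : (0 < N)%N -> exists (I : finType) (cls : algC -> I),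
  forall x y, O x -> O y -> cls x = cls y ->
  exists2 k : {poly int}, (size k <= d)%N & x - y = N%:R * (zpoly algC k).[t].
Proof.
move=> N0; have [_ Ot D0 HD] := LB.
have /choice[G HG] : forall x, exists g : {poly int}, O x -> (size g <= d)%N /\ D%:R * x =
  (zpoly algC g).[t].
  move=> x; have [Ox|nO] := pselect (O x); last by exists 0.
  by have [g szg Eg] := HD x Ox; exists g.
pose M := (N * D)%N; have M0 : (0 < M)%N by rewrite muln_gt0 N0.
exists {ffun 'I_d -> 'I_M.+1}, (fun x => [ffun i : 'I_d => inord (absz ((G x)`_i %% M)%Z)]).
move=> x y Ox Oy /ffunP E; have [szx Ex] := HG x Ox; have [szy Ey] := HG y Oy.
have MZ : M%:Z != 0 by rewrite -lt0n.
have lt z : (absz (z %% M)%Z < M.+1)%N.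
  by rewrite ltnS ltnW // -ltz_nat gez0_abs ?modz_ge0 ?ltz_pmod.
have dv i : (M %| (G x - G y)`_i)%Z.
  rewrite coefB; have [ni|ni] := ltnP i d; last first.
    by rewrite !nth_default ?subrr ?dvdz0 // (leq_trans _ ni).
  rewrite -eqz_mod_dvd; apply/eqP.
  have := E (Ordinal ni); rewrite !ffunE => /(congr1 (@nat_of_ord _));
    rewrite !(inordK (lt _)) /= => Em.
  by rewrite -[LHS]gez0_abs ?modz_ge0 // -[RHS]gez0_abs ?modz_ge0 // Em.
have [k szk Ek] := int_combination_dvd M0 dv.
exists k.
  by rewrite (leq_trans szk) // (leq_trans (size_polyD _ _)) // geq_max size_polyN szx.
have DC : D%:R != 0 :> algC by rewrite pnatr_eq0 -lt0n.
apply: (mulfI DC); rewrite mulrBr Ex Ey -hornerN -hornerD -rmorphB /= Ek.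
have -> : (zpoly algC (M%:Z%:P * k)).[t] = M%:R * (zpoly algC k).[t].
  by rewrite rmorphM /= map_polyC hornerM hornerC.
by rewrite natrM; ring.
Qed.

Section Prime.
Variable P : set algC.
Hypothesis FP : finite_primes L P.

Lemma prime_sub x : P x -> O x.
Proof. by case: FP => -[[PO _ _ _] _ _] _; exact: PO. Qed.
Lemma prime0 : P 0. Proof. by case: FP => -[[]]. Qed.
Lemma primeD x y : P x -> P y -> P (x + y).
Proof. by case: FP => -[[_ _ PD _] _ _] _; exact: PD. Qed.
Lemma primeM a x : O a -> P x -> P (a * x).
Proof. by case: FP => -[[_ _ _ PM] _ _] _; exact: PM. Qed.
Lemma primeMr x a : P x -> O a -> P (x * a).
Proof. by rewrite mulrC => Px Oa; exact: primeM. Qed.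
Lemma prime_n1 : ~ P 1. Proof. by case: FP => -[]. Qed.
Lemma primeMP x y : O x -> O y -> P (x * y) -> P x \/ P y.
Proof. by case: FP => -[_ _ PP] _; exact: PP. Qed.
Lemma primeN x : P x -> P (- x).
Proof.
by move=> Px; rewrite -mulN1r; apply: primeM => //; exact: (integersN HL (integers1 HL)).
Qed.
Lemma primeB x y : P x -> P y -> P (x - y).
Proof. by move=> Px Py; apply: primeD => //; exact: primeN. Qed.
Lemma prime_expP x k : O x -> P (x ^+ k) -> P x.
Proof.
move=> Ox; elim: k => [|k IH]; first by rewrite expr0 => /prime_n1.
by rewrite exprS => /primeMP[] //; exact: (integersX HL).
Qed.

Lemma prime_integer : exists2 N : nat, (0 < N)%N & P N%:R.
Proof.
have [_ [x Px x0]] := FP; have [Lx xA] := prime_sub Px.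
have [h [N [N0 hN]]] := Aint_dvd_int xA x0; exists (absz N); first by rewrite absz_gt0.
have PN : P N%:~R.
  by rewrite -hN; apply: primeMr => //; exact: (integers_horner HL).
case: (intP N) PN => [//|k|k] /=; first by [].
by rewrite rmorphN => /primeN; rewrite opprK.
Qed.

Lemma power_pigeonhole (N : nat) (c m : algC) : (0 < N)%N -> O c -> O m ->
  exists i j, (i < j)%N /\ exists2 k, O k & c * m ^+ i - c * m ^+ j = N%:R * k.
Proof.
move=> N0 Oc Om; have [I [cls Hcls]] := finite_classes N0.
have Ocm k : O (c * m ^+ k) by apply: (integersM HL) => //; exact: (integersX HL).
pose v (i : 'I_#|I|.+1) := cls (c * m ^+ i).
have /injectivePn[i [j ij vij]] : ~~ injectiveb v.
  by apply/negP => /injectiveP /(leq_card v); rewrite card_ord ltnn.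
wlog lij : i j ij vij / (i < j)%N.
  move=> H; have [lt|lt|E] := ltngtP i j; first exact: (H i j).
    by apply: (H j i) => //; rewrite eq_sym.
  by move: ij; rewrite (val_inj E) eqxx.
have [k _ Ek] := Hcls _ _ (Ocm i) (Ocm j) vij.
exists i, j; split=> //; exists (zpoly algC k).[t] => //.
by apply: (integers_horner HL); case: LB.
Qed.

(** The residue ring is a finite domain: two powers of s agree modulo P, and the smaller one can be
    cancelled. *)
Lemma prime_unit s : O s -> ~ P s -> exists2 s', O s' & P (1 - s * s').
Proof.
move=> Os nPs; have [N N0 PN] := prime_integer.
have [i [j [ij [k Ok E]]]] := power_pigeonhole N0 (integers1 HL) Os.
exists (s ^+ (j - i).-1); first exact: (integersX HL).
have ji : (0 < j - i)%N by rewrite subn_gt0.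
rewrite -exprS prednK //.
have : P (s ^+ i * (1 - s ^+ (j - i))).
  by rewrite mulrBr mulr1 -exprD subnKC ?(ltnW ij) // -[X in X - _]mul1r -[X in _ - X]mul1r E;
    exact: primeMr.
have O2 : O (1 - s ^+ (j - i)).
  by apply: (integersD HL); [exact: (integers1 HL) | apply: (integersN HL);
    exact: (integersX HL)].
by case/primeMP => [|//|/prime_expP|//]; [exact: (integersX HL) | move=> /(_ Os)].
Qed.

(* P is an associated prime of O / C because this ring is finite. Starting from c = 1,
   c is multiplied by the highest power of each m in P that keeps (C : c) inside P. *)
Lemma associated_element (C : set algC) (N : nat) : is_ideal O C -> (0 < N)%N -> C N%:R ->
  C `<=` P -> exists c, [/\ O c, forall u, O u -> C (c * u) -> P u & forall m, P m -> C (c * m)].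
Proof.
move=> [CO C0 CD CM] N0 CN CP.
pose T c := O c /\ forall u, O u -> C (c * u) -> P u.
have T1 : T 1 by split; [exact: (integers1 HL) | move=> u _; rewrite mul1r; exact: CP].
have step c m : T c -> P m -> exists c', [/\ T c', C (c' * m) & exists2 e, O e & c' = e * c].
  move=> [Oc Tc] Pm; have Om := prime_sub Pm.
  have ex : exists i, ~~ `[< T (c * m ^+ i) >].
    apply: contrapT => H; have {}H i : T (c * m ^+ i).
      by apply: contrapT => nT; apply: H; exists i; apply/asboolPn.
    have [i [j [ij [k Ok E]]]] := power_pigeonhole N0 Oc Om.
    have ji : (0 < j - i)%N by rewrite subn_gt0.
    have O2 : O (1 - m ^+ (j - i)).
      by apply: (integersD HL); [exact: (integers1 HL) | apply: (integersN HL);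
        exact: (integersX HL)].
    have : P (1 - m ^+ (j - i)).
      apply: (proj2 (H i)) => //; rewrite mulrBr mulr1 -mulrA -exprD subnKC ?(ltnW ij) //.
      by rewrite E mulrC; exact: CM.
    have Pmj : P (m ^+ (j - i)).
      by rewrite -(prednK ji) exprS; apply: primeMr => //; exact: (integersX HL).
    by move=> /primeD /(_ Pmj); rewrite subrK; exact: prime_n1.
  case: (ex_minnP ex) => -[|i] /asboolPn nT imin; first by case: nT; rewrite expr0 mulr1.
  have [Oi Ti] : T (c * m ^+ i).
    by apply: contrapT => nTi; have := imin i; rewrite ltnn => H; suff: false by []; apply: H;
      apply/asboolPn.
  have [s [Os Cs nPs]] : exists s, [/\ O s, C (c * m ^+ i.+1 * s) & ~ P s].
    apply: contrapT => H; apply: nT; split.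
      by apply: (integersM HL) => //; exact: (integersX HL).
    by move=> u Ou Cu; apply: contrapT => nPu; apply: H; exists u.
  exists (c * m ^+ i * s); split.
  - split; first exact: (integersM HL).
    move=> u Ou; rewrite -mulrA => /Ti H.
    by case: (primeMP Os Ou (H (integersM HL Os Ou))) => [/nPs|].
  - by move: Cs; rewrite exprSr; congr C; ring.
  - exists (m ^+ i * s); last by ring.
    by apply: (integersM HL) => //; exact: (integersX HL).
have [I [cls Hcls]] := finite_classes N0.
have /choice[rep Hrep] : forall i : I, exists x, P x /\ forall y, P y -> cls y = i -> cls x = i.
  move=> i; have [[x Px xi]|nx] := pselect (exists2 x, P x & cls x = i).
    by exists x.
  by exists 0; split; [exact: prime0 | move=> y Py yi; case: nx; exists y].
have [c [Tc Cc]] : exists c, T c /\ forall i, i \in enum I -> C (c * rep i).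
  elim: (enum I) => [|i s [c [Tc Cc]]]; first by exists 1; split.
  have [c' [Tc' Ci [e Oe Ec]]] := step c (rep i) Tc (proj1 (Hrep i)).
  exists c'; split=> // j; rewrite inE => /orP[/eqP -> //|js].
  by rewrite Ec -mulrA; apply: CM => //; exact: Cc.
have [Oc Tu] := Tc; exists c; split=> // m Pm.
have [Prm Erm] := Hrep (cls m).
have [k szk E] := Hcls _ _ (prime_sub Pm) (prime_sub Prm) (esym (Erm m Pm erefl)).
rewrite -[m](subrK (rep (cls m))) mulrDr; apply: CD; last by apply: Cc; rewrite mem_enum.
rewrite E mulrCA mulrC; apply: CM => //; apply: (integersM HL) => //.
by apply: (integers_horner HL); case: LB.
Qed.

(** The determinant trick for the group P, which is generated by representatives of its classes
    modulo N together with the N t^k. *)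
Lemma prime_multiplier_Aint z : (forall x, P x -> P (z * x)) -> z \in Aint.
Proof.
move=> zP; have [N N0 PN] := prime_integer; have [I [cls Hcls]] := finite_classes N0.
have [_ Ot D0 HD] := LB.
have /choice[rep Hrep] : forall i : I, exists x, P x /\ forall y, P y -> cls y = i -> cls x = i.
  move=> i; have [[x Px xi]|nx] := pselect (exists2 x, P x & cls x = i).
    by exists x.
  by exists 0; split; [exact: prime0 | move=> y Py yi; case: nx; exists y].
pose J : finType := (I + 'I_d)%type.
pose Y (j : J) : algC := match j with inl i => rep i | inr k => N%:R * t ^+ k end.
have PY j : P (Y j).
  case: j => [i|k] /=; first by case: (Hrep i).
  by apply: primeMr => //; exact: (integersX HL).
have span x : P x -> exists a : J -> int, x = \sum_j (a j)%:~R * Y j.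
  move=> Px; have [Prx Erx] := Hrep (cls x).
  have [k szk E] := Hcls _ _ (prime_sub Px) (prime_sub Prx) (esym (Erx x Px erefl)).
  exists (fun j : J => match j with inl i => (i == cls x)%:R | inr i => k`_i end).
  rewrite big_sumType /= (bigD1 (cls x)) //= eqxx mul1r big1 ?addr0; last first.
    by move=> i /negPf ->; rewrite mul0r.
  have -> : \sum_(i < d) (k`_i)%:~R * (N%:R * t ^+ i) = x - rep (cls x);
    last by rewrite addrC subrK.
  rewrite E (horner_coef_wide _ (leq_trans (size_poly _ _) szk)) mulr_sumr.
  by apply: eq_bigr => i _; rewrite coef_map /= mulrCA.
have /choice[a Ha] : forall j, exists a : J -> int, z * Y j = \sum_i (a i)%:~R * Y i.
  by move=> j; apply: span; apply: zP.
pose n := #|J|; pose A : 'M[int]_n := \matrix_(i, j) a (enum_val i) (enum_val j).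
pose v : 'cV[algC]_n := \col_i Y (enum_val i).
have Av : map_mx intr A *m v = z *: v.
  apply/colP => i; rewrite !mxE Ha (reindex (@enum_val J predT)) /=; last first.
    by apply: onW_bij; exact: enum_val_bij.
  by apply: eq_bigr => j _; rewrite !mxE.
have v0 : v != 0.
  have d0 : (0 < d)%N.
    have [g szg] := HD 1 (integers1 HL); rewrite lt0n; case: eqP => // d0.
    move: szg; rewrite d0 leqn0 size_poly_eq0 => /eqP ->.
    by rewrite rmorph0 horner0 mulr1 => /eqP; rewrite pnatr_eq0 -(negbK (_ == _)) -lt0n D0.
  apply/eqP => /colP /(_ (enum_rank (inr (Ordinal d0) : J))).
  rewrite !mxE enum_rankK /= expr0 mulr1 => /eqP; rewrite pnatr_eq0 => /eqP N00.
  by rewrite N00 in N0.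
have det0 : \det (z%:M - map_mx intr A) = 0.
  apply/eqP; apply: contraT => dn0; case/negP: v0.
  have U : z%:M - map_mx intr A \in unitmx by rewrite unitmxE unitfE.
  rewrite -(mulKmx U v) mulmxBl Av mul_scalar_mx subrr mulmx0 //.
apply: (@root_monic_Aint (zpoly algC (char_poly A))).
- rewrite /root -det0; apply/eqP; rewrite -[LHS]horner_evalE /char_poly -!det_map_mx.
  congr (\det _); apply/matrixP => i j;
    rewrite !mxE /= horner_evalE rmorphB rmorphMn /= map_polyX map_polyC /=.
  by rewrite hornerD hornerN hornerC hornerMn hornerX.
- exact: monic_map (char_poly_monic A).
- by apply/polyOverP => i; rewrite coef_map /= intr_int.
Qed.

(* z = c / N spans the inverse of P with O; were z P contained in P, z would be integral. *)
Lemma prime_invertible : exists z pi,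
  [/\ (forall x, P x -> O (z * x)), P pi & ~ P (z * pi)].
Proof.
have [N N0 PN] := prime_integer.
pose C : set algC := [set x | O x /\ exists2 y, O y & x = N%:R * y].
have CI : is_ideal O C.
  split.
  - by move=> x [].
  - by split; [exact: (integers_int HL 0) | exists 0; [exact: (integers_int HL 0)|rewrite mulr0]].
  - move=> u v [Ou [x Ox Eu]] [Ov [y Oy Ev]]; split; first exact: (integersD HL).
    by exists (x + y); [exact: (integersD HL) | rewrite Eu Ev mulrDr].
  - move=> a u Oa [Ou [x Ox Eu]]; split; first exact: (integersM HL).
    by exists (a * x); [exact: (integersM HL) | rewrite Eu mulrCA].
have ON : O N%:R by exact: (integers_int HL N).
have CN : C N%:R by split=> //; exists 1; [exact: (integers1 HL) | rewrite mulr1].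
have CP : C `<=` P by move=> u [_ [y Oy ->]]; exact: primeMr.
have [c [Oc Tc cP]] := associated_element CI N0 CN CP.
have NC : N%:R != 0 :> algC by rewrite pnatr_eq0 -lt0n.
pose z := c / N%:R.
have zPO x : P x -> O (z * x).
  by move=> /cP[_ [y Oy E]]; rewrite /z mulrAC E mulrAC divff // mul1r.
have [|H] := pselect (exists2 pi, P pi & ~ P (z * pi)); first by case=> pi Ppi nP; exists z, pi.
have zA : z \in Aint.
  by apply: prime_multiplier_Aint => x Px; apply: contrapT => nP; apply: H; exists x.
have Oz : O z.
  by split=> //; case: HL => _ _ LV; apply: LV; [case: Oc | case: ON].
case: prime_n1; apply: Tc; first exact: (integers1 HL).
by split; [exact: (integersM HL Oc (integers1 HL)) | exists z => //;
  rewrite mulr1 /z mulrC mulfVK].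
Qed.
End Prime.

(** Counting replaces Zorn's lemma: among the proper ideals containing C, take J meeting the most
    classes modulo N. Since N O lies in J, an ideal strictly larger than J meets a new class, hence
    is not proper. *)
Lemma prime_above (C : set algC) (N : nat) : is_ideal O C -> (0 < N)%N -> C N%:R -> ~ C 1 ->
  exists2 P, finite_primes L P & C `<=` P.
Proof.
move=> [CO C0 CD CM] N0 CN C1; have [I [cls Hcls]] := finite_classes N0.
pose good (S : {set I}) := `[< exists J : set algC, [/\ is_ideal O J, C `<=` J, ~ J 1 &
   forall i, (i \in S) = `[< exists2 x, J x & cls x = i >] ] >].
have [S0 gS0] : exists S0, good S0.
  exists [set i | `[< exists2 x, C x & cls x = i >] ]%SET; apply/asboolP; exists C.
  by split=> // i; rewrite inE.
case: (@arg_maxnP _ S0 good (fun S : {set I} => #|S|) gS0) => S /asboolP[J [JI CJ J1 SJ]] Smax.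
have [JO J0 JD JM] := JI.
have JN : J N%:R := CJ _ CN.
have max x : O x -> ~ J x -> exists j s, [/\ J j, O s & 1 = j + s * x].
  move=> Ox nJx; pose J' : set algC := [set y | exists j s, [/\ J j, O s & y = j + s * x]].
  have J'I : is_ideal O J'.
    split.
    - move=> _ [j [s [Jj Os ->]]]; apply: (integersD HL); first exact: JO.
      exact: (integersM HL).
    - by exists 0, 0; split=> //; [exact: (integers_int HL 0)|rewrite mul0r addr0].
    - move=> _ _ [j [s [Jj Os ->]]] [j' [s' [Jj' Os' ->]]].
      by exists (j + j'), (s + s'); split; [exact: JD|exact: (integersD HL)|ring].
    - move=> a _ Oa [j [s [Jj Os ->]]]; exists (a * j), (a * s).
      by split; [exact: JM|exact: (integersM HL)|ring].
  have JJ' : J `<=` J'.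
    by move=> j Jj; exists j, 0; split=> //; [exact: (integers_int HL 0)|rewrite mul0r addr0].
  apply: contrapT => n1.
  have gS' : good [set i | `[< exists2 x, J' x & cls x = i >] ]%SET.
    apply/asboolP; exists J'; split; [exact: J'I|exact: subset_trans JJ'| |by move=> i;
      rewrite inE].
    by case=> j [s H]; apply: n1; exists j, s.
  have SS' : S \proper [set i | `[< exists2 x, J' x & cls x = i >] ]%SET.
    apply/properP; split.
      apply/fintype.subsetP => i; rewrite SJ inE => /asboolP[y Jy yi].
      by apply/asboolP; exists y => //; exact: JJ'.
    have J'x : J' x by exists 0, 1; split=> //; [exact: (integers1 HL)|rewrite add0r mul1r].
    exists (cls x); first by rewrite inE; apply/asboolP; exists x.
    rewrite SJ; apply/asboolPn => -[y Jy yx]; apply: nJx.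
    have [k _ E] := Hcls _ _ Ox (JO _ Jy) (esym yx).
    rewrite -[x](subrK y); apply: JD => //; rewrite E mulrC; apply: JM => //.
    by apply: (integers_horner HL); case: LB.
  by have := Smax _ gS'; rewrite /= leqNgt proper_card.
exists J => //; split; last by exists N%:R => //; rewrite pnatr_eq0 -lt0n.
split=> // x y Ox Oy Jxy; have [Jx|nJx] := pselect (J x); [by left|right].
have [j [s [Jj Os E]]] := max x Ox nJx.
rewrite -[y]mul1r E mulrDl -mulrA [j * y]mulrC; apply: JD; first exact: JM.
exact: JM.
Qed.
End NumberRing.

Lemma ideal_mul_ind (I J T : set algC) : T 0 -> (forall x y, T x -> T y -> T (x + y)) ->
  (forall a b, I a -> J b -> T (a * b)) -> ideal_mul I J `<=` T.
Proof.
move=> T0 TD TM _ [n [a [b [ab ->]]]]; elim: n a b ab => [|n IH] a b ab.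
  by rewrite big_ord0.
rewrite big_ord_recl; apply: TD; first by case: (ab ord0) => Ia Jb; exact: TM.
by apply: IH => i; exact: ab.
Qed.

Lemma mem_ideal_mul (I J : set algC) a b : I a -> J b -> ideal_mul I J (a * b).
Proof.
by move=> Ia Jb; exists 1, (fun=> a), (fun=> b); split=> //; rewrite big_ord1.
Qed.

Lemma ideal_mul0 (I J : set algC) : ideal_mul I J 0.
Proof. by exists 0, (fun=> 0), (fun=> 0); split=> [[]//|]; rewrite big_ord0. Qed.

Lemma ideal_mulD (I J : set algC) x y :
  ideal_mul I J x -> ideal_mul I J y -> ideal_mul I J (x + y).
Proof.
move=> [n [a [b [ab ->]]]] [m [c [d [cd ->]]]].
exists (n + m)%N, (fun i => match fintype.split i with inl j => a j | inr j => c j end),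
  (fun i => match fintype.split i with inl j => b j | inr j => d j end); split.
  by move=> i; case: fintype.split.
rewrite big_split_ord /=; congr (_ + _); apply: eq_bigr => i _.
  by rewrite (unsplitK (inl i)).
by rewrite (unsplitK (inr i)).
Qed.

Lemma ideal_mul_subset (I I' J J' : set algC) : I `<=` I' -> J `<=` J' ->
  ideal_mul I J `<=` ideal_mul I' J'.
Proof.
move=> sI sJ; apply: ideal_mul_ind; [exact: ideal_mul0|exact: ideal_mulD|].
by move=> a b Ia Jb; apply: mem_ideal_mul; [exact: sI|exact: sJ].
Qed.

Lemma ideal_mulMr (I J : set algC) s : (forall b, J b -> J (s * b)) ->
  forall x, ideal_mul I J x -> ideal_mul I J (s * x).
Proof.
move=> Js; apply: ideal_mul_ind; first by rewrite mulr0; exact: ideal_mul0.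
  by move=> x y xP yP; rewrite mulrDr; exact: ideal_mulD.
by move=> a b Ia Jb; rewrite mulrCA; apply: mem_ideal_mul => //; exact: Js.
Qed.

Lemma ideal_mulMl (I J : set algC) s : (forall a, I a -> I (s * a)) ->
  forall x, ideal_mul I J x -> ideal_mul I J (s * x).
Proof.
move=> Is; apply: ideal_mul_ind; first by rewrite mulr0; exact: ideal_mul0.
  by move=> x y xP yP; rewrite mulrDr; exact: ideal_mulD.
by move=> a b Ia Jb; rewrite mulrA; apply: mem_ideal_mul => //; exact: Is.
Qed.

Lemma ideal_mul_ring (I J : set algC) : (forall x y, I x -> I y -> I (x * y)) ->
  (forall x y, J x -> J y -> J (x * y)) ->
  forall x y, ideal_mul I J x -> ideal_mul I J y -> ideal_mul I J (x * y).
Proof.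
move=> IM JM x y xP yP; move: x xP; apply: ideal_mul_ind.
- by rewrite mul0r; exact: ideal_mul0.
- by move=> x x' xP x'P; rewrite mulrDl; exact: ideal_mulD.
- move=> a b Ia Jb; rewrite -mulrA; apply: ideal_mulMl => [c Ic|]; first exact: IM.
  by apply: ideal_mulMr => // c Jc; exact: JM.
Qed.

Lemma qhorner_closed (T : set algC) z (q : {poly rat}) :
  (forall x y, T x -> T y -> T (x + y)) -> (forall x y, T x -> T y -> T (x * y)) ->
  (forall c : rat, T (ratr c)) -> T z -> T (qpoly q).[z].
Proof.
move=> TD TM Tc Tz; elim/poly_ind: q => [|q c IH].
  by rewrite rmorph0 horner0; have := Tc 0; rewrite rmorph0.
rewrite rmorphD rmorphM /= map_polyX map_polyC /= !hornerE.
by apply: TD => //; exact: TM.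
Qed.

Lemma subfield_rat L (c : rat) : is_subfield L -> L (ratr c).
Proof.
move=> HL; have Lz (z : int) : L z%:~R by case: (integers_int HL z).
by case: (HL) => _ _ LV; apply: LV.
Qed.

Lemma subfield_qhorner L z (q : {poly rat}) : is_subfield L -> L z -> L (qpoly q).[z].
Proof.
move=> HL Lz; apply: qhorner_closed => //; first exact: subfieldD.
  exact: subfieldM.
by move=> c; exact: subfield_rat.
Qed.

Definition adjoin (z : algC) : set algC := [set x | exists q : {poly rat}, x = (qpoly q).[z]].

Lemma mem_adjoin z : adjoin z z.
Proof. by exists 'X; rewrite map_polyX hornerX. Qed.

Lemma adjoin_qhorner z x (q : {poly rat}) : adjoin z x -> adjoin z (qpoly q).[x].
Proof. by move=> [p ->]; exists (q \Po p); rewrite map_comp_poly horner_comp. Qed.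

Lemma qinv (x : algC) : exists q : {poly rat}, x^-1 = (qpoly q).[x].
Proof.
have [->|x0] := eqVneq x 0; first by exists 0; rewrite invr0 rmorph0 horner0.
have [N N0 NA] := Aint_scale x; have NC : N%:R != 0 :> algC by rewrite pnatr_eq0 -lt0n.
have [h [M [M0 hM]]] := Aint_dvd_int NA (mulf_neq0 NC x0).
have MC : M%:~R != 0 :> algC by rewrite intr_eq0.
exists ((N%:R / M%:~R) *: (zpoly rat h \Po (N%:R *: 'X))).
rewrite map_polyZ hornerZ map_comp_poly horner_comp qpoly_zpoly map_polyZ map_polyX hornerZ
  hornerX.
rewrite fmorph_div /= !rmorph_nat ratr_int; apply: (mulfI (mulf_neq0 MC x0)).
have -> : M%:~R * x * (N%:R / M%:~R * (zpoly algC h).[N%:R * x]) =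
  N%:R * x * (zpoly algC h).[N%:R * x] by field.
by rewrite hM mulfK.
Qed.

Lemma adjoin_subfield z : is_subfield (adjoin z).
Proof.
have aM x y : adjoin z x -> adjoin z y -> adjoin z (x * y).
  by move=> [p ->] [q ->]; exists (p * q); rewrite rmorphM hornerM.
split=> //.
- by exists 1; rewrite rmorph1 hornerC.
- by move=> x y [p ->] [q ->]; exists (p - q); rewrite rmorphB hornerD hornerN.
- move=> x y Lx Ly; apply: aM => //; have [q ->] := qinv y; exact: adjoin_qhorner.
Qed.

Lemma adjoin_subset L z : is_subfield L -> L z -> adjoin z `<=` L.
Proof. by move=> HL Lz _ [q ->]; exact: subfield_qhorner. Qed.

Lemma adjoin_integral z : exists2 t, t \in Aint & adjoin t = adjoin z.
Proof.
have [N N0 NA] := Aint_scale z; exists (N%:R * z) => //.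
have NC : N%:R != 0 :> algC by rewrite pnatr_eq0 -lt0n.
have aN t : adjoin t N%:R by rewrite -ratr_nat; apply: subfield_rat; exact: adjoin_subfield.
apply/seteqP; split; apply: adjoin_subset; try exact: adjoin_subfield.
  by apply: (subfieldM (adjoin_subfield z)) => //; exact: mem_adjoin.
have {2}-> : z = N%:R * z / N%:R by rewrite mulrAC mulfV // mul1r.
by case: (adjoin_subfield (N%:R * z)) => _ _; apply=> //; exact: mem_adjoin.
Qed.

Lemma adjoin_lattice z : z \in Aint -> exists d D, lattice_bound (adjoin z) z d D.
Proof.
move=> zA; have [f [firr fz f1 fmin]] := Aint_zirreducible zA.
have [D D0 HD] := bounded_denominator firr fz f1 fmin.
exists (size f).-1, D; split=> //; first exact: adjoin_subfield.
  by split=> //; exact: mem_adjoin.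
move=> _ [[q ->] xA]; have [g ->] := HD q xA; have [fmon _] := firr.
exists (Pdiv.CommonRing.rmodp g f).
  by rewrite -ltnS prednK ?(ltnW f1) // Pdiv.CommonRing.ltn_rmodpN0 ?monic_neq0.
by rewrite {1}(Pdiv.RingMonic.rdivp_eq fmon g) rmorphD rmorphM /= hornerD hornerM (rootP fz)
  mulr0 add0r.
Qed.

(** Sums of products form a ring that contains the generator z, hence all of Q(z); the last
    inclusion allows properties of the compositum to be checked on products. *)
Lemma adjoin_compositum z1 z2 : exists z, [/\ adjoin z1 `<=` adjoin z, adjoin z2 `<=` adjoin z
  & adjoin z `<=` ideal_mul (adjoin z1) (adjoin z2)].
Proof.
have [z [a Dz] [ps Ds]] := algC_PET [:: z1; z2]; exists z.
have psz : size ps = 2%N by have := congr1 size Ds; rewrite size_map.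
case: ps psz Ds => [|p [|p' []]] //= _ [D1 D2].
have S := adjoin_subfield; have sM z' := subfieldM (S z').
have L1 z' : adjoin z' 1 by case: (S z').
split; [by apply: adjoin_subset => //; exists p|by apply: adjoin_subset => //; exists p'|].
have IR := ideal_mul_ring (@sM z1) (@sM z2).
move=> _ [q ->]; apply: (qhorner_closed (T := ideal_mul (adjoin z1) (adjoin z2)));
  [by move=> x y; exact: ideal_mulD|exact: IR| |].
  by move=> c; rewrite -[ratr c]mulr1; apply: mem_ideal_mul => //; exact: subfield_rat.
have In y m : ideal_mul (adjoin z1) (adjoin z2) y -> ideal_mul (adjoin z1) (adjoin z2) (y *+ m).
  move=> yI; elim: m => [|m IH]; first exact: ideal_mul0.
  by rewrite mulrS; exact: ideal_mulD.
rewrite Dz; elim/big_ind: _ => [||[[|[|//]] i] _] /=; first exact: ideal_mul0.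
- exact: ideal_mulD.
- by apply: In; rewrite -[X in ideal_mul _ _ X]mulr1; apply: mem_ideal_mul => //;
  exact: mem_adjoin.
- by apply: In; rewrite -[X in ideal_mul _ _ X]mul1r; apply: mem_ideal_mul => //;
  exact: mem_adjoin.
Qed.

Section Subextensions.
Variables (K : fieldExtType rat) (iota : {rmorphism K -> algC}).
Local Notation k := (range iota).

Lemma range_adjoin : exists2 t, t \in Aint & k = adjoin t.
Proof.
have [t tA Ht] := num_field_primitive iota; exists (iota t) => //.
apply/seteqP; split=> [_ [x _ <-]|]; first exact: Ht.
by apply: adjoin_subset; [exact: range_subfield|exists t].
Qed.

Lemma finite_subext_adjoin L : finite_subext k setT L -> exists2 z, z \in Aint & L = adjoin z.
Proof.
move=> [HL kL _ [n [e [eL eS]]]]; have [t tA Dk] := range_adjoin.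
have [z [a Dz] [ps Ds]] := algC_PET (t :: [seq e i | i <- enum 'I_n]).
have Lt : L t by apply: kL; rewrite Dk; exact: mem_adjoin.
have inL x : x \in (t :: [seq e i | i <- enum 'I_n]) -> L x.
  by rewrite inE => /orP[/eqP->//|/mapP[i _ ->]].
have Lz : L z.
  rewrite Dz; elim/big_ind: _ => [||i _]; [exact: (subfield0 HL)|exact: (subfieldD HL)|].
  elim: (a i) => [|m IH]; first exact: (subfield0 HL).
  by rewrite mulrS; apply: (subfieldD HL) => //; apply: inL; exact: mem_nth.
have aE x : x \in (t :: [seq e i | i <- enum 'I_n]) -> adjoin z x.
  by rewrite Ds => /mapP[p _ ->]; exists p.
have [t' t'A Et] := adjoin_integral z; exists t' => //; rewrite Et.
apply/seteqP; split; last exact: adjoin_subset.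
move=> x /eS[c [kc ->]]; have S := adjoin_subfield z.
elim/big_ind: _ => [||i _]; [exact: (subfield0 S)|exact: (subfieldD S)|].
apply: (subfieldM S); last by apply: aE; rewrite inE map_f ?mem_enum ?orbT.
have [q ->] : adjoin t (c i) by rewrite -Dk.
by apply: adjoin_qhorner; apply: aE; rewrite inE eqxx.
Qed.

Lemma adjoin_finite_subext z : k `<=` adjoin z -> finite_subext k setT (adjoin z).
Proof.
move=> kz; have [t tA Et] := adjoin_integral z; rewrite -Et in kz *.
have [f [[fmon _] ft f1 _]] := Aint_zirreducible tA.
split=> //; first exact: adjoin_subfield.
have qmon : zpoly rat f \is monic by exact: monic_map.
have szq : size (zpoly rat f) = size f by rewrite size_map_poly_id0 // (monicP fmon) oner_eq0.
exists (size f).-1, (fun i => t ^+ i); split.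
  by move=> i; exists 'X^i; rewrite map_polyXn hornerXn.
move=> _ [q ->]; pose r := Pdiv.CommonRing.rmodp q (zpoly rat f).
exists (fun i => ratr r`_i); split.
  by move=> i; apply: subfield_rat; exact: range_subfield.
have rs : (size r <= (size f).-1)%N.
  by rewrite -ltnS prednK ?(ltnW f1) // -szq Pdiv.CommonRing.ltn_rmodpN0 ?monic_neq0.
rewrite (Pdiv.RingMonic.rdivp_eq qmon q) rmorphD rmorphM /= hornerD hornerM.
rewrite qpoly_zpoly (rootP ft) mulr0 add0r -/r.
rewrite (horner_coef_wide _ (leq_trans (size_poly _ _) rs)).
by apply: eq_bigr => i _; rewrite coef_map.
Qed.
End Subextensions.

(** * Unramified extensions *)

Definition is_subring (T : set algC) : Prop :=
  [/\ T 1, (forall x y, T x -> T y -> T (x - y)) & (forall x y, T x -> T y -> T (x * y))].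

Lemma integers_subring L : is_subfield L -> is_subring (integers L).
Proof.
move=> HL; split; [exact: integers1| |by move=> x y; exact: integersM].
by move=> x y Ox Oy; apply: (integersD HL) => //; exact: integersN.
Qed.

Section IdealCongruence.
Variables T J : set algC.
Hypotheses (TR : is_subring T) (JI : is_ideal T J).

Lemma subring0 : T 0.
Proof. by case: TR => T1 TB _; rewrite -(subrr 1); exact: TB. Qed.

Lemma subringN x : T x -> T (- x).
Proof. by case: TR => _ TB _ Tx; rewrite -sub0r; apply: TB => //; exact: subring0. Qed.

Lemma subringD x y : T x -> T y -> T (x + y).
Proof. by case: TR => _ TB _ Tx Ty; rewrite -[y]opprK; apply: TB => //; exact: subringN. Qed.

Lemma subringM x y : T x -> T y -> T (x * y). Proof. by case: TR => _ _; apply. Qed.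

Lemma subringMn x n : T x -> T (x *+ n).
Proof.
move=> Tx; elim: n => [|n IH]; first exact: subring0.
by rewrite mulrS; exact: subringD.
Qed.

Lemma subringX x n : T x -> T (x ^+ n).
Proof.
by case: (TR) => T1 _ TM Tx; elim: n => [|n IH] //; rewrite exprS; exact: TM.
Qed.

Lemma ideal0 : J 0. Proof. by case: JI. Qed.
Lemma idealD x y : J x -> J y -> J (x + y). Proof. by case: JI => _ _ H _; exact: H. Qed.
Lemma idealM a x : T a -> J x -> J (a * x). Proof. by case: JI => _ _ _; apply. Qed.
Lemma idealMr x a : J x -> T a -> J (x * a). Proof. by rewrite mulrC => *; exact: idealM. Qed.
Lemma idealN x : J x -> J (- x).
Proof.
by move=> Jx; rewrite -mulN1r; apply: idealM => //; apply: subringN; case: TR.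
Qed.
Lemma ideal_trans y x z : J (x - y) -> J (y - z) -> J (x - z).
Proof. by move=> xy yz; rewrite -(subrK y x) -addrA; exact: idealD. Qed.
Lemma ideal_sym x y : J (x - y) -> J (y - x).
Proof. by move=> /idealN; rewrite opprB. Qed.

Lemma ideal_congrX x y n : T x -> T y -> J (x - y) -> J (x ^+ n - y ^+ n).
Proof.
move=> Tx Ty xy; rewrite subrXX; apply: idealMr => //.
elim/big_ind: _ => [||i _]; [exact: subring0|exact: subringD|].
by apply: subringM; exact: subringX.
Qed.

Lemma ideal_congr_iter x q m : T x -> J (x ^+ q - x) -> J (x ^+ (q ^ m) - x).
Proof.
move=> Tx xq; elim: m => [|m IH]; first by rewrite expn0 subrr; exact: ideal0.
rewrite expnS mulnC exprM; apply: ideal_trans xq.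
by apply: ideal_congrX => //; exact: subringX.
Qed.

Lemma frobenius_ideal (l e : nat) (x y : algC) : prime l -> J l%:R -> T x -> T y ->
  J ((x + y) ^+ (l ^ e) - (x ^+ (l ^ e) + y ^+ (l ^ e))).
Proof.
move=> pl Jl; elim: e x y => [|e IH] x y Tx Ty; first by rewrite expn0 subrr; exact: ideal0.
rewrite expnS !exprM; have := exprD_prime x y pl; set w := \sum_(i < _) _ => E.
have Tw : T w.
  rewrite /w; elim/big_ind: _ => [||i _]; [exact: subring0|exact: subringD|].
  by apply: subringMn; apply: subringM; exact: subringX.
have [TX TY] : T (x ^+ l) /\ T (y ^+ l) by split; exact: subringX.
apply: ideal_trans (IH _ _ TX TY).
apply: ideal_congrX; [by apply: subringX; exact: subringD|exact: subringD|].
by rewrite E addrC addKr; exact: idealMr.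
Qed.
End IdealCongruence.

Section Ramification.
Variables (L : set algC) (t : algC) (d D : nat).
Hypothesis LB : lattice_bound L t d D.
Local Notation O := (integers L).
Let HL : is_subfield L := bound_subfield LB.
Let OR : is_subring O := integers_subring HL.

Lemma prime_is_ideal P : finite_primes L P -> is_ideal O P. Proof. by case=> -[]. Qed.

Lemma prime_residue_char P : finite_primes L P -> exists2 l, prime l & P l%:R.
Proof.
move=> FP; have exN : exists N : nat, `[< (0 < N)%N /\ P N%:R >].
  by have [N N0 PN] := prime_integer LB FP; exists N; apply/asboolP.
case: (ex_minnP exN) => l /asboolP[l0 Pl] lmin; exists l => //.
have On (n : nat) : O n%:R by exact: (integers_int HL n).
have l1 : (1 < l)%N.
  by case: l l0 Pl {lmin} => [//|[_ P1|//]]; case: (prime_n1 FP).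
apply/primeP; split=> // a /dvdnP[b Db]; move: Pl; rewrite Db natrM.
have /andP[b0 a0] : (0 < b)%N && (0 < a)%N by rewrite -muln_gt0 -Db.
have mn c : (0 < c)%N -> P c%:R -> (b * a <= c)%N.
  by move=> c0 Pc; rewrite -Db; apply: lmin; apply/asboolP.
move=> /(primeMP FP)[||/(mn b b0)|/(mn a a0)]; [exact: On|exact: On| |].
  by rewrite -[X in (_ <= X)%N]muln1 leq_pmul2l // => a1; rewrite eqn_leq a1 a0.
by rewrite -[X in (_ <= X)%N]mul1n leq_pmul2r // => b1;
  rewrite (_ : b = 1)%N ?mul1n ?eqxx ?orbT //; apply/eqP; rewrite eqn_leq b1.
Qed.

(** The powers x^(l^i) repeat modulo P for some i < j <= #I, and Frobenius is injective modulo a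
    prime, so j - i is a period of x. The factorial is a common period for all x and all P above
    l. *)
Lemma frobenius_exponent (l : nat) : prime l -> exists2 e, (0 < e)%N &
  forall P, finite_primes L P -> P l%:R -> forall x, O x -> P (x ^+ (l ^ e) - x).
Proof.
move=> pl; have [I [cls Hcls]] := finite_classes LB (prime_gt0 pl).
exists (#|I|)`!; first exact: fact_gt0.
move=> P FP Pl x Ox; have PI := prime_is_ideal FP.
have OX n := subringX OR n Ox.
pose v (i : 'I_#|I|.+1) := cls (x ^+ (l ^ i)).
have /injectivePn[i [j ij vij]] : ~~ injectiveb v.
  by apply/negP => /injectiveP /(leq_card v); rewrite card_ord ltnn.
wlog lij : i j ij vij / (i < j)%N.
  move=> H; have [lt|lt|E] := ltngtP i j; first exact: (H i j).
    by apply: (H j i) => //; rewrite eq_sym.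
  by move: ij; rewrite (val_inj E) eqxx.
have [g _ Eg] := Hcls _ _ (OX _) (OX _) vij.
have Pg : P (x ^+ (l ^ i) - x ^+ (l ^ j)).
  rewrite Eg; apply: (primeMr FP) => //; apply: (integers_horner HL).
  by case: LB.
set y := x ^+ (l ^ (j - i)); have Oy : O y by exact: OX.
have yi : x ^+ (l ^ j) = y ^+ (l ^ i) by rewrite -exprM -expnD subnK // ltnW.
have Pxy : P (y - x).
  apply: (ideal_sym OR PI); apply: (prime_expP LB FP (k := (l ^ i)%N)).
    exact: (integersD HL Ox (integersN HL Oy)).
  have := frobenius_ideal OR PI i pl Pl (integersD HL Ox (integersN HL Oy)) Oy.
  rewrite subrK -yi => H; have := primeB LB FP Pg H.
  by congr P; ring.
have /dvdnP[m ->] : (j - i %| (#|I|)`!)%N.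
  apply: dvdn_fact; rewrite subn_gt0 lij /= (leq_trans (leq_subr _ _)) //.
  by rewrite -ltnS.
by rewrite mulnC expnM; exact: (ideal_congr_iter OR PI).
Qed.

Section Prime.
Variable P : set algC.
Hypothesis FP : finite_primes L P.

Lemma mem_ideal_exp2 a b : P a -> P b -> ideal_exp O P 2 (a * b).
Proof.
move=> Pa Pb; apply: mem_ideal_mul => //; rewrite -[b]mulr1; apply: mem_ideal_mul => //.
exact: (integers1 HL).
Qed.

Lemma ideal_exp1_subset : ideal_exp O P 1 `<=` P.
Proof.
apply: ideal_mul_ind; [exact: (prime0 FP)|by move=> x y; exact: (primeD FP)|].
by move=> a b; exact: (primeMr FP).
Qed.

Lemma ideal_exp2_ind (T : set algC) : T 0 -> (forall x y, T x -> T y -> T (x + y)) ->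
  (forall a b, P a -> P b -> T (a * b)) -> ideal_exp O P 2 `<=` T.
Proof.
move=> T0 TD TM; apply: ideal_mul_ind => // a b Pa /ideal_exp1_subset; exact: TM.
Qed.

Lemma ideal_exp2M s x : O s -> ideal_exp O P 2 x -> ideal_exp O P 2 (s * x).
Proof. by move=> Os; apply: ideal_mulMl => a; exact: (primeM FP). Qed.

(** As z maps P to O, it maps P^2 to P; an element pi with z pi outside P is therefore not in
    P^2. *)
Lemma prime_uniformizer : exists z pi, [/\ forall x, P x -> O (z * x), P pi,
  ~ P (z * pi) & ~ ideal_exp O P 2 pi].
Proof.
have [z [pi [zP Ppi zpi]]] := prime_invertible LB FP.
exists z, pi; split=> //; apply: contra_not zpi; move: pi {Ppi}.
apply: ideal_exp2_ind; first by rewrite mulr0; exact: (prime0 FP).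
  by move=> x y Px Py; rewrite mulrDr; exact: (primeD FP).
by move=> a b Pa Pb; rewrite mulrA; apply: (primeM FP) => //; exact: zP.
Qed.
End Prime.
End Ramification.

Section Extension.
Variables (k : set algC) (tk : algC) (dk Dk : nat) (L : set algC) (t : algC) (d D : nat).
Hypotheses (LBk : lattice_bound k tk dk Dk) (LB : lattice_bound L t d D) (kL : k `<=` L).
Variable p : set algC.
Hypothesis FPp : finite_primes k p.
Local Notation O := (integers L).
Local Notation pO := (ideal_mul p O).
Let HL : is_subfield L := bound_subfield LB.
Let Hk : is_subfield k := bound_subfield LBk.
Let OR : is_subring O := integers_subring HL.

Lemma integers_subset x : integers k x -> O x.
Proof. by case=> kx xA; split=> //; exact: kL. Qed.

Lemma extension_is_ideal : is_ideal O pO.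
Proof.
split.
- apply: ideal_mul_ind; [exact: (subring0 OR)|exact: (subringD OR)|].
  by move=> a b pa Ob; apply: (subringM OR) => //; apply: integers_subset; exact: (prime_sub FPp).
- exact: ideal_mul0.
- by move=> x y; exact: ideal_mulD.
- by move=> a x Oa; apply: ideal_mulMr => b; exact: (subringM OR).
Qed.

Lemma prime_extension : p `<=` pO.
Proof.
by move=> x px; rewrite -[x]mulr1; apply: mem_ideal_mul => //; exact: (integers1 HL).
Qed.

Section Above.
Variable P : set algC.
Hypotheses (FP : finite_primes L P) (pP : p `<=` P).

Lemma extension_subset : pO `<=` P.
Proof.
apply: ideal_mul_ind; [exact: (prime0 FP)|by move=> x y; exact: (primeD FP)|].
by move=> a b pa; apply: (primeMr FP); exact: pP.
Qed.

Lemma prime_below_above : prime_below k P = p.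
Proof.
apply/seteqP; split=> [s [Ps Os]|x px]; last by split; [exact: pP|exact: (prime_sub FPp)].
apply: contrapT => nps; have [s' Os' ss'] := prime_unit LBk FPp Os nps.
apply: (prime_n1 FP); rewrite -[1](subrK (s * s')); apply: (primeD FP); first exact: pP.
by apply: (primeMr FP) => //; exact: integers_subset.
Qed.

Lemma ramification_index1 :
  ramification_index L p P 1 <-> ~ (pO `<=` ideal_exp O P 2).
Proof.
split=> [[] //|nP]; split=> // x /extension_subset Px.
by rewrite -[x]mulr1; apply: mem_ideal_mul => //; exact: (integers1 HL).
Qed.
End Above.

(** If y is not in p O, the ideal C of all u with u y in p O is proper, hence inside some P. For a
    in p O outside P^2, z a lies in C because z y is integral, so z a is in P; as z pi is a unit
    modulo P, a would lie in P^2. *)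
Lemma unramified_radical y :
  (forall P, finite_primes L P -> p `<=` P -> ~ (pO `<=` ideal_exp O P 2)) ->
  O y -> (forall P, finite_primes L P -> p `<=` P -> P y) -> pO y.
Proof.
move=> unr Oy yP; have [N N0 pN] := prime_integer LBk FPp; have PI := extension_is_ideal.
pose C : set algC := [set u | O u /\ pO (u * y)].
have CI : is_ideal O C.
  split; first by move=> u [].
  - by split; [exact: (subring0 OR)|rewrite mul0r; exact: (ideal0 PI)].
  - move=> u v [Ou uC] [Ov vC]; split; first exact: (subringD OR).
    by rewrite mulrDl; exact: (idealD PI).
  - move=> a u Oa [Ou uC]; split; first exact: (subringM OR).
    by rewrite -mulrA; exact: (idealM PI).
have pC : p `<=` C.
  move=> a pa; split; first by apply: integers_subset; exact: (prime_sub FPp).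
  by apply: mem_ideal_mul.
have [[_]|nC1] := pselect (C 1); first by rewrite mul1r.
have [P FP CP] := prime_above LB CI N0 (pC _ pN) nC1.
have pP := subset_trans pC CP.
have [a [pOa na]] : exists a, pO a /\ ~ ideal_exp O P 2 a.
  apply: contrapT => H; apply: (unr P FP pP) => a pOa.
  by apply: contrapT => na; apply: H; exists a.
have [z [pi [zP Ppi zpi _]]] := prime_uniformizer LB FP.
have Pa := extension_subset FP pP pOa.
have Cza : C (z * a).
  split; first exact: zP.
  have -> : z * a * y = z * y * a by ring.
  by apply: (idealM PI) => //; apply: zP; exact: yP.
have [s Os Ps] := prime_unit LB FP (zP _ Ppi) zpi.
case: na; have -> : a = (1 - z * pi * s) * a + s * ((z * a) * pi) by ring.
apply: ideal_mulD; first exact: (mem_ideal_exp2 LB).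
by apply: (ideal_exp2M FP) => //; apply: (mem_ideal_exp2 LB) => //; exact: CP.
Qed.

(* p is unramified in L iff O_L / p O_L is reduced iff some power of the Frobenius
   endomorphism is the identity on this finite ring; the latter is inherited by
   composita. *)
Lemma unramified_frobenius (l : nat) : prime l -> p l%:R ->
  (forall P, finite_primes L P -> prime_below k P = p -> ramification_index L p P 1) <->
  exists2 e, (0 < e)%N & forall x, O x -> pO (x ^+ (l ^ e) - x).
Proof.
move=> pl pL; have PI := extension_is_ideal; split=> [unr|[e e0 Fe] P FP bP].
  have [e e0 He] := frobenius_exponent LB pl; exists e => // x Ox.
  apply: unramified_radical.
  - move=> P FP pP; apply/(ramification_index1 FP pP); apply: unr => //.
    exact: prime_below_above.
  - by apply: (integersD HL); [exact: (integersX HL)|exact: (integersN HL)].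
  - by move=> P FP pP; apply: He => //; exact: pP.
have pP : p `<=` P by move=> x; rewrite -bP => -[].
apply/(ramification_index1 FP pP) => sP.
have [z [pi [_ Ppi _ npi]]] := prime_uniformizer LB FP; apply: npi.
have Opi := prime_sub FP Ppi.
(* Both terms lie in P^2: the power because l^e >= 2, the difference by the containment of p O in
   P^2. *)
have -> : pi = pi ^+ (l ^ e) + (-1) * (pi ^+ (l ^ e) - pi) by ring.
have le : (l ^ e = (l ^ e - 2).+2)%N.
  by rewrite -addn2 subnK // (leq_trans (prime_gt1 pl)) // -[X in (X <= _)%N]expn1 leq_exp2l //
    prime_gt1.
apply: ideal_mulD.
  rewrite le exprS exprS mulrCA mulrA mulrC; apply: (ideal_exp2M FP).
    exact: (integersX HL).
  exact: (mem_ideal_exp2 LB).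
apply: (ideal_exp2M FP); last by apply: sP; exact: Fe.
exact: (integersN HL (integers1 HL)).
Qed.
End Extension.

Section Compositum.
Variables (k : set algC) (tk : algC) (dk Dk : nat) (L1 L2 L : set algC).
Hypotheses (LBk : lattice_bound k tk dk Dk) (H1 : is_subfield L1) (H2 : is_subfield L2).
Hypotheses (HL : is_subfield L) (kL1 : k `<=` L1) (kL2 : k `<=` L2).
Hypotheses (L1L : L1 `<=` L) (L2L : L2 `<=` L) (L12 : L `<=` ideal_mul L1 L2).
Variables (p : set algC) (l : nat).
Hypotheses (FPp : finite_primes k p) (pl : prime l) (pL : p l%:R).
Local Notation O1 := (integers L1).
Local Notation O2 := (integers L2).
Local Notation O := (integers L).
Local Notation R := (ideal_mul O1 O2).
Local Notation pR := (ideal_mul p R).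
Let Hk : is_subfield k := bound_subfield LBk.

Lemma integers_compositum : R `<=` O.
Proof.
apply: ideal_mul_ind; [exact: (subring0 (integers_subring HL))|exact: (integersD HL)|].
by move=> a b [La Aa] [Lb Ab]; apply: (integersM HL); split=> //; [exact: L1L|exact: L2L].
Qed.

Lemma compositum_l : O1 `<=` R.
Proof. by move=> a Oa; rewrite -[a]mulr1; apply: mem_ideal_mul => //; exact: (integers1 H2). Qed.

Lemma compositum_r : O2 `<=` R.
Proof. by move=> a Oa; rewrite -[a]mul1r; apply: mem_ideal_mul => //; exact: (integers1 H1). Qed.

Lemma compositum_subring : is_subring R.
Proof.
split; first by apply: compositum_l; exact: (integers1 H1).
  move=> x y Rx Ry; apply: ideal_mulD => //; rewrite -mulN1r; apply: ideal_mulMl => // a.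
  exact: (integersM H1 (integersN H1 (integers1 H1))).
by apply: ideal_mul_ring; [exact: (integersM H1)|exact: (integersM H2)].
Qed.
Let RR := compositum_subring.

Lemma prime_compositum : p `<=` R.
Proof.
move=> a /(prime_sub FPp) [ka Aa]; apply: compositum_l; split=> //; exact: kL1.
Qed.

Lemma compositum_extension_ideal : is_ideal R pR.
Proof.
split.
- apply: ideal_mul_ind; [exact: (subring0 RR)|exact: (subringD RR)|].
  by move=> a b /prime_compositum; exact: (subringM RR).
- exact: ideal_mul0.
- by move=> x y; exact: ideal_mulD.
- by move=> a x Oa; apply: ideal_mulMr => b; exact: (subringM RR).
Qed.
Let RI := compositum_extension_ideal.

Lemma compositum_clear x : L x -> exists2 N : nat, (0 < N)%N & R (N%:R * x).
Proof.
move=> /L12; move: x; apply: ideal_mul_ind.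
- by exists 1 => //; rewrite mulr0; exact: ideal_mul0.
- move=> x y [N N0 Nx] [M M0 My]; exists (N * M)%N; first by rewrite muln_gt0 N0.
  have -> : (N * M)%:R * (x + y) = (N%:R * x) *+ M + (M%:R * y) *+ N.
    by rewrite -[(N%:R * x) *+ M]mulr_natr -[(M%:R * y) *+ N]mulr_natr natrM; ring.
  by apply: (subringD RR); exact: (subringMn RR).
- move=> a b La Lb; have [N N0 NA] := Aint_scale a; have [M M0 MA] := Aint_scale b.
  exists (N * M)%N; first by rewrite muln_gt0 N0.
  have -> : (N * M)%:R * (a * b) = (N%:R * a) * (M%:R * b) by rewrite natrM; ring.
  have LN L' (HL' : is_subfield L') (n : nat) : L' n%:R by case: (integers_int HL' n).
  by apply: mem_ideal_mul; split=> //; [apply: (subfieldM H1)|apply: (subfieldM H2)] => //;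
    exact: LN.
Qed.

(** Modulo p R, the Frobenius power with exponent e1 e2 is additive and fixes O_1 and O_2, hence the
    ring R of sums of products; the passage from R to O is the difficulty. *)
Lemma compositum_frobenius (e1 e2 : nat) : (0 < e1)%N -> (0 < e2)%N ->
  (forall x, O1 x -> ideal_mul p O1 (x ^+ (l ^ e1) - x)) ->
  (forall x, O2 x -> ideal_mul p O2 (x ^+ (l ^ e2) - x)) ->
  forall x, O x -> ideal_mul p O (x ^+ (l ^ (e1 * e2)) - x).
Proof.
move=> e10 e20 F1 F2 x Ox; pose q := (l ^ (e1 * e2))%N.
have q1 : (1 < q)%N by rewrite -(expn0 l) ltn_exp2l ?muln_gt0 ?e10 // prime_gt1.
have l0 := prime_gt0 pl; have q0 : (0 < q)%N by rewrite expn_gt0 l0.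
have sub1 : ideal_mul p O1 `<=` pR by apply: ideal_mul_subset => //; exact: compositum_l.
have sub2 : ideal_mul p O2 `<=` pR by apply: ideal_mul_subset => //; exact: compositum_r.
have Rl : pR l%:R.
  by rewrite -[l%:R]mulr1; apply: mem_ideal_mul => //; case: RR.
have FR : R `<=` [set y | R y /\ pR (y ^+ q - y)].
  apply: ideal_mul_ind.
  - by split; [exact: (subring0 RR)|rewrite expr0n gtn_eqF // subr0; exact: ideal_mul0].
  - move=> u v [Ru uF] [Rv vF]; split; first exact: (subringD RR).
    apply: (ideal_trans RI (frobenius_ideal RR RI (e1 * e2) pl Rl Ru Rv)).
    have -> : u ^+ q + v ^+ q - (u + v) = (u ^+ q - u) + (v ^+ q - v) by ring.
    exact: ideal_mulD.
  - move=> a b Oa Ob; have Ra := compositum_l Oa; have Rb := compositum_r Ob.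
    split; first exact: (subringM RR).
    have aF : pR (a ^+ q - a).
      by rewrite /q expnM; apply: (ideal_congr_iter RR RI) => //; apply: sub1; exact: F1.
    have bF : pR (b ^+ q - b).
      by rewrite /q mulnC expnM; apply: (ideal_congr_iter RR RI) => //; apply: sub2; exact: F2.
    have -> : (a * b) ^+ q - a * b = (a ^+ q - a) * b ^+ q + a * (b ^+ q - b).
      by rewrite exprMn; ring.
    apply: ideal_mulD; first by apply: (idealMr RI) => //; exact: (subringX RR).
    exact: (idealM RI).
have kL : k `<=` L := subset_trans kL1 L1L.
have pOI : is_ideal O (ideal_mul p O).
  split.
  - apply: ideal_mul_ind; [exact: (subring0 (integers_subring HL))|exact: (integersD HL)|].
    by move=> a b /(prime_sub FPp)[ka Aa] Ob; apply: (integersM HL) => //; split=> //; exact: kL.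
  - exact: ideal_mul0.
  - by move=> u v; exact: ideal_mulD.
  - by move=> a u Oa; apply: ideal_mulMr => b; exact: (integersM HL).
have kR a : integers k a -> R a.
  by case=> ka Aa; apply: compositum_l; split=> //; exact: kL1.
have kO a : integers k a -> O a by case=> ka Aa; split=> //; exact: kL.
(* It remains to find s in O_k, outside p, such that s x lies in R, that is, to see
   that O_L and R agree locally at p, although R need not be integrally closed. *)
suff [s [Os ps Rsx]] : exists s, [/\ integers k s, ~ p s & R (s * x)].
  have OX u n : O u -> O (u ^+ n) by move=> Ou; exact: (integersX HL).
  have sub : pR `<=` ideal_mul p O by apply: ideal_mul_subset => //; exact: integers_compositum.
  have [_ sxF] := FR _ Rsx; have [_ sF] := FR _ (kR _ Os).
  have H : ideal_mul p O (s * (x ^+ q - x)).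
    have -> : s * (x ^+ q - x) = ((s * x) ^+ q - s * x) + (- x ^+ q) * (s ^+ q - s).
      by rewrite exprMn; ring.
    apply: ideal_mulD; first exact: sub.
    by apply: (idealM pOI); [apply: (integersN HL); exact: OX|exact: sub].
  have [s' Os' ss'] := prime_unit LBk FPp Os ps.
  rewrite -/q; have -> : x ^+ q - x = (1 - s * s') * (x ^+ q - x) + s' * (s * (x ^+ q - x)) by
    ring.
  apply: ideal_mulD; last by apply: (idealM pOI) => //; exact: kO.
  apply: mem_ideal_mul => //; apply: (integersD HL); first exact: OX.
  exact: (integersN HL).
pose C : set algC := [set a | integers k a /\ R (a * x)].
have CI : is_ideal (integers k) C.
  split; first by move=> u [].
  - by split; [exact: (integers_int Hk 0)|rewrite mul0r; exact: ideal_mul0].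
  - move=> u v [Ou uC] [Ov vC]; split; first exact: (integersD Hk).
    by rewrite mulrDl; exact: ideal_mulD.
  - move=> a u Oa [Ou uC]; split; first exact: (integersM Hk).
    by rewrite -mulrA; apply: (subringM RR) => //; exact: kR.
have [N N0 NC] := compositum_clear (proj1 Ox).
have CN : C N%:R by split=> //; exact: (integers_int Hk N).
apply: contrapT => nC; have Cp : C `<=` p.
  by move=> s [Os sx]; apply: contrapT => ps; apply: nC; exists s.
have [c [Oc Tc cp]] := associated_element LBk FPp CI N0 CN Cp.
have Ocx : O (c * x) by apply: (integersM HL) => //; exact: kO.
(* Integrality of c x makes m c x nilpotent modulo p R; being fixed there by a power of Frobenius,
   it is zero. *)
have pcx m : p m -> pR (m * (c * x)).
  move=> pm; have [Ocm Ry] := cp m pm; have Om := prime_sub FPp pm.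
  have {}Ry : R (m * (c * x)) by rewrite mulrCA mulrA.
  have [f [[fmon _] fx f1 _]] := Aint_zirreducible (proj2 Ocx).
  pose e := (size f).-1; have ef : size f = e.+1 by rewrite /e prednK // ltnW.
  have ye : pR ((m * (c * x)) ^+ e).
    have E : (c * x) ^+ e = - \sum_(i < e) (f`_i)%:~R * (c * x) ^+ i.
      apply/eqP; rewrite -addr_eq0; have := rootP fx.
      have sz : (size (zpoly algC f) <= e.+1)%N by rewrite -ef; exact: size_poly.
      rewrite (horner_coef_wide _ sz) big_ord_recr /= coef_map /=.
      have -> : f`_e = 1 by have := monicP fmon; rewrite /lead_coef -/e.
      rewrite mul1r addrC => H; apply/eqP; rewrite -[RHS]H; congr (_ + _).
      by apply: eq_bigr => i _; rewrite coef_map.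
    rewrite exprMn E mulrN -mulN1r; apply: (idealM RI).
      by apply: (subringN RR); case: RR.
    rewrite mulr_sumr; elim/big_ind: _ => [||i _]; [exact: ideal_mul0|exact: ideal_mulD|].
    have -> : m ^+ e * ((f`_i)%:~R * (c * x) ^+ i) =
        m * (m ^+ (e - i).-1 * (f`_i)%:~R * (m * (c * x)) ^+ i).
      have -> : m ^+ e = m * m ^+ (e - i).-1 * m ^+ i.
        by rewrite -exprS prednK ?subn_gt0 // -exprD subnK // ltnW.
      by rewrite [(m * (c * x)) ^+ i]exprMn; ring.
    apply: mem_ideal_mul => //; apply: (subringM RR); last exact: (subringX RR).
    apply: (subringM RR); first by apply: (subringX RR); exact: prime_compositum.
    by apply: kR; exact: (integers_int Hk).
  have [j je] : exists j, (e <= q ^ j)%N by exists e; rewrite ltnW // ltn_expl.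
  have yj : pR ((m * (c * x)) ^+ (q ^ j)).
    rewrite -(subnK je) exprD; apply: (idealM RI) => //; exact: (subringX RR).
  have [_ yF] := FR _ Ry.
  have := ideal_congr_iter RR RI j Ry yF => /(ideal_sym RR RI) H.
  by have := ideal_mulD H yj; rewrite subrK.
(* Since z p lies in O_k, z (pi c x) lies in R; so c (z pi) is in C, and the choice of c puts z pi
   in p. *)
have [z [pi [zP ppi zpi _]]] := prime_uniformizer LBk FPp.
apply: zpi; apply: Tc; first exact: zP.
split; first by apply: (integersM Hk) => //; exact: zP.
have -> : c * (z * pi) * x = z * (pi * (c * x)) by ring.
have : ideal_mul p R `<=` [set y | R (z * y)].
  apply: ideal_mul_ind => /=; first by rewrite mulr0; exact: ideal_mul0.
    by move=> u v Ru Rv; rewrite mulrDr; exact: ideal_mulD.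
  by move=> a b pa Rb; rewrite mulrA; apply: (subringM RR) => //; apply: kR; exact: zP.
by apply; exact: pcx.
Qed.
End Compositum.

(** * The fixed field of the Galois group *)

Lemma qpoly_aut (nu : {rmorphism algC -> algC}) (q : {poly rat}) z :
  nu (qpoly q).[z] = (qpoly q).[nu z].
Proof.
rewrite -horner_map -map_poly_comp; congr (_.[_]).
by apply: eq_map_poly => c /=; rewrite fmorph_rat.
Qed.

Section MaximalUnramified.
Variables (K : fieldExtType rat) (iota : {rmorphism K -> algC}) (S : set (place K)).
Local Notation k := (range iota).
Local Notation M := (max_unramified_ext iota S).

Lemma range_lattice : exists t d D, k = adjoin t /\ lattice_bound k t d D.
Proof.
have [t tA Dk] := range_adjoin iota; have [d [D LB]] := adjoin_lattice tA.
by exists t, d, D; rewrite Dk.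
Qed.

Lemma unramified_at_frobenius z p l : z \in Aint -> k `<=` adjoin z -> finite_primes k p ->
  prime l -> p l%:R ->
  unramified_at iota (adjoin z) (FinPlace p) <-> exists2 e, (0 < e)%N &
    forall x, integers (adjoin z) x -> ideal_mul p (integers (adjoin z)) (x ^+ (l ^ e) - x).
Proof.
move=> zA kz FPp pl pL; have [t [d [D [_ LBk]]]] := range_lattice.
have [d' [D' LB]] := adjoin_lattice zA.
exact: (unramified_frobenius LBk LB).
Qed.

Lemma finite_place_char p : finite_primes k p -> exists2 l, prime l & p l%:R.
Proof.
move=> FPp; have [t [d [D [_ LBk]]]] := range_lattice.
exact: (prime_residue_char LBk).
Qed.

Lemma base_unramified : KS_subext iota S k.
Proof.
have [t [d [D [Dk LBk]]]] := range_lattice.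
have fin : finite_subext k setT k.
  by rewrite {2}Dk; apply: adjoin_finite_subext; rewrite -Dk.
have [Hk kk _ fk] := fin; split=> // x kx; exists k; split=> //.
move=> [p|T] /= FPp nS.
  move=> P FP bP; rewrite (finite_prime_below FP) in bP; rewrite -{}bP {p FPp nS}.
  apply/(ramification_index1 LBk FP) => // sP.
  have [z [pi [_ Ppi _ npi]]] := prime_uniformizer LBk FP.
  by apply: npi; apply: sP; exact: (prime_extension LBk).
by move=> tau _ rtau f _ ftau _ [y _ <-]; rewrite ftau.
Qed.

Lemma compositum_unramified L1 L2 : finite_subext k setT L1 -> finite_subext k setT L2 ->
  unramified_outside iota S L1 -> unramified_outside iota S L2 ->
  exists L, [/\ finite_subext k setT L, unramified_outside iota S L, L1 `<=` L & L2 `<=` L].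
Proof.
move=> F1 F2 U1 U2; have [_ kL1 _ _] := F1; have [_ kL2 _ _] := F2.
have [z1 z1A D1] := finite_subext_adjoin F1; have [z2 z2A D2] := finite_subext_adjoin F2.
rewrite {L1 F1}D1 {L2 F2}D2 in kL1 kL2 U1 U2 *.
have [w []] := adjoin_compositum z1 z2; have [z zA <-] := adjoin_integral w.
move=> s1 s2 s12; have kz := subset_trans kL1 s1; exists (adjoin z); split=> //.
  exact: adjoin_finite_subext.
have [t [d [D [_ LBk]]]] := range_lattice; have As := adjoin_subfield.
move=> [p|T] pv nS.
  have [l pl pL] := finite_place_char pv.
  apply/(unramified_at_frobenius zA kz pv pl pL).
  have [e1 e10 E1] := proj1 (unramified_at_frobenius z1A kL1 pv pl pL) (U1 _ pv nS).
  have [e2 e20 E2] := proj1 (unramified_at_frobenius z2A kL2 pv pl pL) (U2 _ pv nS).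
  exists (e1 * e2)%N; first by rewrite muln_gt0 e10.
  exact: (compositum_frobenius LBk (As z1) (As z2) (As z) kL1 s1 s2 s12 pv pl pL e10 e20 E1 E2).
move=> tau Ttau rtau f [f1 fD fM] ftau y /s12 yz.
have h1 : hom_on (adjoin z1) f.
  by split=> // u v Lu Lv; [apply: fD|apply: fM]; exact: s1.
have h2 : hom_on (adjoin z2) f.
  by split=> // u v Lu Lv; [apply: fD|apply: fM]; exact: s2.
suff : ideal_mul (adjoin z1) (adjoin z2) `<=` [set u | adjoin z u /\ f u \is Num.real].
  by move=> /(_ _ yz)[].
have f0 : f 0 = 0.
  have Lz0 := subfield0 (As z); have := fD 0 0 Lz0 Lz0; rewrite addr0.
  by move=> E; rewrite -[LHS](addrK (f 0)) -E subrr.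
apply: ideal_mul_ind.
- by split; [exact: subfield0|rewrite f0 rpred0].
- move=> u v [Lu ru] [Lv rv]; split; first exact: (subfieldD (As z)).
  by rewrite fD // rpredD.
- move=> a b La Lb; split; first by apply: (subfieldM (As z)); [exact: s1|exact: s2].
  rewrite fM ?rpredM //; [|exact: (U2 _ pv nS tau)|exact: s1|exact: s2].
  exact: (U1 _ pv nS tau).
Qed.

Lemma max_unramified_subfield : is_subfield M.
Proof.
have [_ _ kM _] := base_unramified.
have clos (op : algC -> algC -> algC) : (forall L, is_subfield L -> forall x y, L x -> L y -> L
  (op x y)) ->
    forall x y, M x -> M y -> M (op x y).
  move=> opL x y [L1 [F1 U1 L1x]] [L2 [F2 U2 L2y]].
  have [L [F U s1 s2]] := compositum_unramified F1 F2 U1 U2.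
  exists L; split=> //; case: (F) => HL _ _ _; apply: opL => //; [exact: s1|exact: s2].
split; first by apply: kM; case: (range_subfield iota).
  by apply: (clos (fun x y => x - y)) => L [_ LB _]; exact: LB.
by apply: (clos (fun x y => x / y)) => L [_ _ LV]; exact: LV.
Qed.

(** An automorphism over K fixes p, so it carries the Frobenius criterion from Q(z) to Q(nu z); at a
    real place, embeddings are composed with it. *)
Lemma aut_unramified (nu : {rmorphism algC -> algC}) : (forall x, k x -> nu x = x) ->
  forall x, M x -> M (nu x).
Proof.
move=> nuk x [L [F U Lx]]; have [_ kL _ _] := F.
have [z zA Dz] := finite_subext_adjoin F; rewrite {L F}Dz in kL U Lx *.
have nuz u : adjoin (nu z) u -> exists2 v, adjoin z v & u = nu v.
  by move=> [q ->]; exists (qpoly q).[z]; [exists q|rewrite qpoly_aut].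
have znu u : adjoin z u -> adjoin (nu z) (nu u).
  by move=> [q ->]; exists q; rewrite qpoly_aut.
have nuA : nu z \in Aint by rewrite Aint_aut.
have kz : k `<=` adjoin (nu z) by move=> u ku; rewrite -(nuk u ku); apply: znu; exact: kL.
exists (adjoin (nu z)); split; [exact: adjoin_finite_subext| |exact: znu].
move=> [p|T] pv nS.
  have [l pl pL] := finite_place_char pv.
  apply/(unramified_at_frobenius nuA kz pv pl pL).
  have [e e0 E] := proj1 (unramified_at_frobenius zA kL pv pl pL) (U _ pv nS).
  exists e => // u [/nuz[v Lv ->]]; rewrite Aint_aut => vA.
  have := E v (conj Lv vA); rewrite -rmorphXn -rmorphB /=; move: (_ - _).
  apply: ideal_mul_ind.
  - by rewrite rmorph0; exact: ideal_mul0.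
  - by move=> a b aP bP; rewrite rmorphD; exact: ideal_mulD.
  - move=> a b pa [Lb bA]; have [ka _] := prime_sub pv pa; rewrite rmorphM (nuk a ka).
    by apply: mem_ideal_mul => //; split; [exact: znu|rewrite Aint_aut].
move=> tau Ttau rtau f [f1 fD fM] ftau u /nuz[v Lv ->].
apply: (U _ pv nS tau Ttau rtau (fun x => f (nu x))) => //.
  split; first by rewrite rmorph1.
    by move=> a b La Lb; rewrite rmorphD fD //; exact: znu.
  by move=> a b La Lb; rewrite rmorphM fM //; exact: znu.
by move=> a; rewrite nuk //; exists a.
Qed.

(** An element outside k is moved by an automorphism of algC over k. This automorphism and its
    inverse preserve K_S, so its restriction, extended by the identity, belongs to the Galois
    group. *)
Lemma galois_fixed_field x : M x ->
  (forall g : galois_aut M k, gal_fun g x = x) -> k x.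
Proof.
move=> Mx gx; apply: contrapT => nkx.
have [t tA Dk] := range_adjoin iota.
have [|nu [nut nux]] := @algC_aut_moves t x.
  by move=> q xq; apply: nkx; rewrite Dk; exists q.
have nuk y : k y -> nu y = y by rewrite Dk => -[q ->]; rewrite qpoly_aut nut.
have nuM := aut_unramified nuk.
have nuK := algC_invautK nu; pose nu' : {rmorphism algC -> algC} := algC_invaut nu.
have nu'M : forall y, M y -> M (nu' y).
  by apply: aut_unramified => y ky; rewrite -{1}(nuk y ky); apply: (fmorph_inj nu); rewrite nuK.
pose g y := if `[< M y >] then nu y else y.
have gM y : M y -> g y = nu y by rewrite /g; case: asboolP.
have [M1 MB MV] := max_unramified_subfield; have HM := max_unramified_subfield.
have gP : is_gal M k g.
  split.
  - split=> [y My|y y' /set_mem My /set_mem My'|y My]; first by rewrite gM //; exact: nuM.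
      by rewrite !gM //; exact: fmorph_inj.
    by exists (nu' y); [exact: nu'M|rewrite gM ?nuK //; exact: nu'M].
  - split; first by rewrite gM ?rmorph1.
      by move=> y y' My My'; rewrite !gM ?rmorphD //; exact: subfieldD.
    by move=> y y' My My'; rewrite !gM ?rmorphM //; exact: subfieldM.
  - move=> y ky; rewrite gM ?nuk //; case: base_unramified => _ _ kM _; exact: kM.
  - by move=> y nMy; rewrite /g; case: asboolP.
by have := gx (Defs.Gal gP); rewrite /= gM //; apply/eqP.
Qed.
End MaximalUnramified.

(** Every element of the target group is the image of some [tau g], which fixes K_1; the
    corresponding field is thus fixed by the whole group. *)
Lemma corresponding_base (K1 K2 : fieldExtType rat)
  (iota1 : {rmorphism K1 -> algC}) (iota2 : {rmorphism K2 -> algC})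
  (S1 : set (place K1)) (S2 : set (place K2))
  (sigma : GKS iota1 S1 -> GKS iota2 S2) (tau : GKS iota2 S2 -> GKS iota1 S1) :
  cancel tau sigma -> corresponding_ext sigma (range iota1) = range iota2.
Proof.
move=> tauK; apply/seteqP; split=> [x [Mx xfix]|x kx].
  apply: (galois_fixed_field Mx) => g; have := xfix (tau g); rewrite tauK; apply=> y ky.
  by case: (galP (tau g)) => _ _ + _; apply.
split; first by case: (base_unramified iota2 S2) => _ _ kM _; exact: kM.
by move=> g _; case: (galP (sigma g)) => _ _ + _; apply.
Qed.

(** * Points of degree one *)

Lemma prime_bezout (p : nat) (z : int) : prime p -> ~ (p %| z)%Z ->
  exists u v : int, u * p%:Z + v * z = 1.
Proof.
move=> pp pz; have cop : coprimez p z.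
  by rewrite /coprimez /gcdz eqz_nat -/(coprime _ _) prime_coprime //; apply/negP.
by have [u [v E]] := Bezoutz p z; exists u, v; rewrite E (eqP cop).
Qed.

Section SubringCongruence.
Variables T J : set algC.
Hypotheses (TR : is_subring T) (JI : is_ideal T J).

Lemma subring_int (z : int) : T z%:~R.
Proof.
have T1 : T 1 by case: TR.
case: (intP z) => [|n|n]; first by exact: (subring0 TR).
  exact: (subringMn TR).
by rewrite rmorphN; apply: (subringN TR); exact: (subringMn TR).
Qed.

Lemma subring_horner (g : {poly int}) x : T x -> T (zpoly algC g).[x].
Proof.
move=> Tx; elim/poly_ind: g => [|g c IH]; first by rewrite rmorph0 horner0; exact: (subring0 TR).
rewrite rmorphD rmorphM /= map_polyX map_polyC /= !hornerE.
by apply: (subringD TR); [exact: (subringM TR)|exact: subring_int].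
Qed.

Lemma ideal_congr_horner (g : {poly int}) u v : T u -> T v -> J (u - v) ->
  J ((zpoly algC g).[u] - (zpoly algC g).[v]).
Proof.
move=> Tu Tv uv; elim/poly_ind: g => [|g c IH].
  by rewrite rmorph0 !horner0 subrr; exact: (ideal0 JI).
rewrite !rmorphD !rmorphM /= map_polyX map_polyC /= !hornerE.
set a := (zpoly algC g).[u]; set b := (zpoly algC g).[v].
have -> : a * u + c%:~R - (b * v + c%:~R) = (a - b) * u + b * (u - v) by ring.
apply: (idealD JI); first exact: (idealMr JI).
by apply: (idealM JI) => //; exact: subring_horner.
Qed.

Lemma ideal_int (p : nat) (z : int) : prime p -> J p%:R -> ~ J 1 -> J z%:~R <-> (p %| z)%Z.
Proof.
move=> pp Jp J1; split=> [Jz|/dvdzP[q ->]]; last first.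
  by rewrite rmorphM /=; apply: (idealM JI) => //; exact: subring_int.
apply: contrapT => pz; apply: J1.
have [u [v E]] := prime_bezout pp pz.
have := congr1 (intmul (1 : algC)) E; rewrite rmorphD !rmorphM rmorph1 /= => <-.
by apply: (idealD JI); apply: (idealM JI) => //; exact: subring_int.
Qed.
End SubringCongruence.

Definition primitive_data (t : algC) (f : {poly int}) (n D : nat) : Prop :=
  [/\ zirreducible f, root (zpoly algC f) t, size f = n.+2,
      (0 < D)%N /\ forall q : {poly rat}, (qpoly q).[t] \in Aint ->
        exists g : {poly int}, D%:R * (qpoly q).[t] = (zpoly algC g).[t]
    & forall q : {poly rat}, root (qpoly q) t = (zpoly rat f %| q)].

Lemma primitive_data_exists t : t \in Aint -> exists f n D, primitive_data t f n D.
Proof.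
move=> tA; have [f [firr ft f1 fmin]] := Aint_zirreducible tA.
have [D D0 HD] := bounded_denominator firr ft f1 fmin.
by exists f, (size f - 2)%N, D; split=> //; rewrite -addn2 subnK.
Qed.

(** For n + 1 < p a polynomial of degree at most n + 1 is determined by its values on F_p; p prime
    to D provides residue characters, and p prime to the norm of f', the discriminant up to sign,
    separates the roots of f modulo p. *)
Definition good_prime (f : {poly int}) (n D p : nat) : Prop :=
  [/\ prime p, (n.+1 < p)%N, ~~ (p %| D)%N & ~~ (p %| norm n f f^`())%Z].

Lemma good_prime_bound t f n D : primitive_data t f n D ->
  exists y, forall p, prime p -> (y < p)%N -> good_prime f n D p.
Proof.
move=> [firr ft szf [D0 _] _]; have [fmon _] := firr.
have f'0 : f^`() != 0.
  apply: contraTneq (_ : f^`()`_n != 0) => [->|]; first by rewrite coef0 eqxx.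
  have := monicP fmon; rewrite /lead_coef szf coef_deriv /= => ->.
  by rewrite pnatr_eq0.
have szf' : (size f^`() <= n.+1)%N.
  by rewrite -ltnS -szf lt_size_deriv // -size_poly_eq0 szf.
have N0 := norm_neq0 firr szf f'0 szf'.
exists (n.+1 + D + absz (norm n f f^`()))%N => p pp py; split=> //.
- by apply: leq_ltn_trans py; rewrite -addnA leq_addr.
- apply/negP => /(dvdn_leq D0); rewrite leqNgt => /negP; apply; apply: leq_ltn_trans py.
  by rewrite addnAC leq_addl.
- have aN : (0 < absz (norm n f f^`()))%N by rewrite absz_gt0.
  apply/negP; rewrite dvdzE => /(dvdn_leq aN); rewrite leqNgt => /negP; apply.
  by apply: leq_ltn_trans py; rewrite leq_addl.
Qed.

Definition avoids (K : fieldExtType rat) (S : set (place K)) (p : nat) : Prop :=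
  forall P, S (FinPlace P) -> ~ P p%:R.

Lemma avoids_bound (K : fieldExtType rat) (iota : {rmorphism K -> algC}) (S : set (place K)) :
  prime_set iota S -> exists y, forall p, prime p -> (y < p)%N -> avoids S p.
Proof.
move=> [finS SP _].
have /choice[c Hc] : forall v : place K, exists c : nat, S v ->
    forall P, v = FinPlace P -> forall l, prime l -> P l%:R -> (l <= c)%N.
  move=> v; have [Sv|nSv] := pselect (S v); last by exists 0%N.
  case: v Sv => [P|T] Sv; last by exists 0%N.
  have FP : finite_primes (range iota) P := SP _ Sv.
  have [l pl Pl] := finite_place_char FP.
  exists l => _ _ [<-] l' pl' Pl'.
  have OR := integers_subring (range_subfield iota).
  have := proj1 (ideal_int OR (prime_is_ideal FP) l' pl Pl (prime_n1 FP)) Pl'.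
  rewrite dvdzE /= dvdn_prime2 // => /eqP ->; exact: leqnn.
have /finite_seqP[s Ds] := finite_image c finS.
exists (\max_(i <- s) i) => p pp py P SP' Pp.
have := Hc _ SP' P erefl p pp Pp; apply/negP; rewrite -ltnNge; apply: leq_ltn_trans py.
have cs : c (FinPlace P) \in s.
  have : (c @` S) (c (FinPlace P)) by exists (FinPlace P).
  by rewrite Ds.
by rewrite (big_rem _ cs) /= leq_maxl.
Qed.

Section Points.
Variables (K : fieldExtType rat) (iota : {rmorphism K -> algC}) (S : set (place K)).
Variables (t : algC) (f : {poly int}) (n D p : nat).
Local Notation k := (range iota).
Local Notation O := (integers k).
Local Notation A := (S_integers iota S k).
Hypotheses (Dk : k = adjoin t) (tA : t \in Aint) (PD : primitive_data t f n D).
Hypotheses (gp : good_prime f n D p) (Sp : avoids S p).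

Lemma S_integers_subring : is_subring A.
Proof.
have Hk := range_subfield iota; split; first by apply: integers_S_integers; exact: integers1.
  move=> x y Ax Ay; rewrite -mulN1r; apply: S_integersD => //; apply: S_integersM => //.
  by apply: integers_S_integers; apply: (integersN Hk); exact: (integers1 Hk).
by move=> x y; exact: S_integersM.
Qed.
Let AR := S_integers_subring.

Let Hk : is_subfield k := range_subfield iota.
Let pp : prime p. Proof. by case: gp. Qed.
Let kt : k t. Proof. by rewrite Dk; exact: mem_adjoin. Qed.
Let Ot : O t. Proof. by []. Qed.

Lemma integers_denominator x : O x -> exists g : {poly int}, D%:R * x = (zpoly algC g).[t].
Proof.
move=> [kx xA]; move: kx xA; rewrite Dk => -[q ->] qA.
by case: PD => _ _ _ [_ HD] _; exact: HD.
Qed.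

Lemma residue_character (F : fieldType) (r : F) : p%:R = 0 :> F -> root (zpoly F f) r ->
  exists phi : algC -> F, [/\
    forall x y, O x -> O y -> phi (x + y) = phi x + phi y,
    forall x y, O x -> O y -> phi (x * y) = phi x * phi y,
    phi 1 = 1, phi p%:R = 0 &
    forall g : {poly int}, phi (zpoly algC g).[t] = (zpoly F g).[r]].
Proof.
move=> pF fr; have [firr ft szf [D0 _] _] := PD; have [_ _ pD _] := gp.
have DF : D%:R != 0 :> F.
  apply/eqP => DF; have [|u [v E]] := @prime_bezout p D pp; first exact/negP.
  have := congr1 (intmul (1 : F)) E; rewrite rmorphD !rmorphM /= -!pmulrn pF DF !mulr0 addr0.
  by move/esym/eqP; rewrite oner_eq0.
have [phi [phiD phiM phiE]] := residue_map Hk firr ft integers_denominator fr DF D0.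
exists phi; split=> //.
  by have := phiE 1; rewrite !rmorph1 !hornerC.
by have := phiE p%:Z%:P; rewrite !map_polyC !hornerC /= -!pmulrn pF.
Qed.

Lemma closure_point (F : closedFieldType) (h : {rmorphism 'F_p -> F}) (r : F) :
  (forall c : F, c != 0 -> exists2 e, (0 < e)%N & c ^+ e = 1) -> root (zpoly F f) r ->
  exists Q, [/\ closed_points A Q, Q p%:R &
    forall g : {poly int}, Q (zpoly algC g).[t] <-> (zpoly F g).[r] = 0].
Proof.
move=> Ftors fr.
have pF : p%:R = 0 :> F by have := dvdz_closure h pp p; rewrite dvdzz => /esym/eqP.
have [phi [phiD phiM phi1 phip phiE]] := residue_character pF fr.
exists (residue_point iota S phi); split.
- exact: (residue_point_closed phiD phiM phi1 phip (prime_gt0 pp) Ftors Sp).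
- by apply/(residue_point_integer S phiD phiM phi1) => //; exact: (integers_int Hk p).
- move=> g; rewrite -phiE; apply: (residue_point_integer S phiD phiM phi1).
  exact: (integers_horner Hk).
Qed.

Section Point.
Variable Q : set algC.
Hypotheses (Qmax : closed_points A Q) (Qp : Q p%:R).

Lemma point_ideal : is_ideal A Q. Proof. by case: Qmax. Qed.
Let QI := point_ideal.

Lemma point_int (z : int) : Q z%:~R <-> (p %| z)%Z.
Proof. by apply: (ideal_int AR) => //; case: Qmax. Qed.

Lemma point_inv (z : int) : ~ (p %| z)%Z -> exists u : int, Q (1 - u%:~R * z%:~R).
Proof.
move=> pz; have [u [v E]] := prime_bezout pp pz; exists v.
have -> : 1 - v%:~R * z%:~R = u%:~R * p%:R :> algC.
  by have := congr1 (intmul (1 : algC)) E; rewrite rmorphD !rmorphM rmorph1 /= => E1;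
    rewrite -[X in X - _]E1 addrK.
by apply: (idealM QI) => //; exact: (subring_int AR).
Qed.

Lemma point_reduce (c : int) : exists2 r : nat, (r < p)%N & Q (c%:~R - r%:R).
Proof.
have p0 : p%:Z != 0 by rewrite eqz_nat -lt0n prime_gt0.
have mE : (absz (c %% p)%Z : int) = (c %% p)%Z by rewrite gez0_abs // modz_ge0.
exists (absz (c %% p)%Z); first by rewrite -ltz_nat mE ltz_pmod // ltz_nat prime_gt0.
have -> : c%:~R - (absz (c %% p)%Z)%:R = (c - (c %% p)%Z)%:~R :> algC.
  by rewrite rmorphB /= -[in RHS]mE.
by apply/point_int; rewrite -eqz_mod_dvd modz_mod.
Qed.

Lemma point_root (c : int) : Q (t - c%:~R) -> exists r, zroot f p r.
Proof.
move=> Qtc; have [firr ft _ _ _] := PD; have At : A t := integers_S_integers S Ot.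
have [r rp Qcr] := point_reduce c; exists r; rewrite /zroot rp /=.
have := ideal_congr_horner AR QI f At (subring_int AR r) (ideal_trans QI Qtc Qcr).
rewrite (rootP ft) sub0r => /(idealN AR QI); rewrite opprK.
have -> : (zpoly algC f).[r%:Z%:~R] = (f.[r%:Z])%:~R by rewrite horner_map.
by move=> /point_int.
Qed.

(** A congruence of t with an integer extends to Z[t], then to O because D is invertible modulo p,
    then to fractions with denominator outside Q. *)
Lemma point_integer x (c : int) : Q (t - c%:~R) -> A x -> exists m : int, Q (x - m%:~R).
Proof.
move=> Qtc [kx xA]; have At : A t := integers_S_integers S Ot.
have FP := maximal_contraction Qmax Qp (prime_gt0 pp).
have [|a [b [Oa Ob nb Dx]]] := xA _ FP.
  rewrite (finite_prime_below FP) => /Sp; apply; split=> //; exact: (integers_int Hk p).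
have int_mod y : O y -> exists m : int, Q (y - m%:~R).
  move=> Oy; have Ay := integers_S_integers S Oy.
  have [_ _ pD _] := gp; have [|u Qu] := @point_inv D; first exact/negP.
  have [g Eg] := integers_denominator Oy.
  have Qg := ideal_congr_horner AR QI g At (subring_int AR c) Qtc.
  exists (u * g.[c]).
  have -> : y - (u * g.[c])%:~R = y * (1 - u%:~R * D%:~R) +
      u%:~R * ((zpoly algC g).[t] - (zpoly algC g).[c%:~R]).
    by rewrite -Eg horner_map rmorphM /= -[D%:~R]/(D%:R); ring.
  by apply: (idealD QI); [apply: (idealM QI)|apply: (idealM QI) => //; exact: (subring_int AR)].
have [ma Qa] := int_mod _ Oa; have [mb Qb] := int_mod _ Ob.
have [Aa Ab] := (integers_S_integers S Oa, integers_S_integers S Ob).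
have [|v Qv] := @point_inv mb.
  move=> /point_int H; apply: nb; split=> //.
  by have := idealD QI Qb H; rewrite subrK.
have b0 : b != 0.
  by apply: contra_notN nb => /eqP ->; split; [exact: (ideal0 QI)|exact: (integers_int Hk 0)].
have Ax : A x by split.
have Axb : x * b = a by rewrite Dx mulfVK.
exists (ma * v); have -> : x - (ma * v)%:~R =
    x * (1 - v%:~R * mb%:~R) + (- (x * v%:~R)) * (b - mb%:~R) + v%:~R * (a - ma%:~R).
  by rewrite -Axb rmorphM /=; ring.
have Av : A v%:~R := subring_int AR v.
apply: (idealD QI); last exact: (idealM QI).
apply: (idealD QI); first exact: (idealM QI).
by apply: (idealM QI) => //; apply: (subringN AR); exact: (subringM AR).
Qed.

Lemma degree1_point : abs_inertia_degree A Q 1 <-> exists c : int, Q (t - c%:~R).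
Proof.
have Q1 : ~ Q 1 by case: Qmax.
split=> [[p' [[pp' Qp'] [e [Ae eP]]]]|[c Qtc]].
  have At : A t := integers_S_integers S Ot.
  (* The basis element e need not be 1: from t = c e and 1 = c1 e modulo Q one gets t = c / c1, and
     c1 is invertible because 1 is not in Q. *)
  have [c [Qc _]] := eP t At; have A1 : A 1 by case: AR.
  have [c1 [Qc1 _]] := eP 1 A1; rewrite !big_ord1 in Qc Qc1.
  have [|u Qu] := @point_inv (c1 ord0).
    move=> /point_int H; apply: Q1.
    by have := idealD QI Qc1 (idealMr QI H (Ae ord0)); rewrite subrK.
  exists ((c ord0 : nat)%:Z * u).
  have -> : t - ((c ord0 : nat)%:Z * u)%:~R = (t - (c ord0 : nat)%:R * e ord0) +
      (c ord0 : nat)%:R * (e ord0 * (1 - u%:~R * (c1 ord0 : nat)%:~R)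
        + (- u%:~R) * (1 - (c1 ord0 : nat)%:R * e ord0)).
    by rewrite rmorphM /= -!pmulrn; ring.
  have An (z : nat) : A z%:R := subring_int AR z.
  apply: (idealD QI) => //; apply: (idealM QI) => //; apply: (idealD QI).
    exact: (idealM QI).
  by apply: (idealM QI) => //; apply: (subringN AR); exact: (subring_int AR).
exists p; split=> //; exists (fun=> 1); split=> [_|x Ax]; first by case: AR.
have [m Qm] := point_integer Qtc Ax; have [r rp Qr] := point_reduce m.
have Qxr := ideal_trans QI Qm Qr.
exists [ffun=> Ordinal rp]; split=> [|c' Qc']; first by rewrite big_ord1 ffunE mulr1.
rewrite big_ord1 mulr1 in Qc'.
have Qrc : Q (r%:R - (c' ord0 : nat)%:R).
  exact: (ideal_trans QI (ideal_sym AR QI Qxr) Qc').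
apply/ffunP => i; rewrite ffunE ord1; apply: val_inj => /=.
have : (p %| r%:Z - (c' ord0 : nat)%:Z)%Z by apply/point_int; rewrite rmorphB.
rewrite -eqz_mod_dvd !modz_nat => /eqP[]; rewrite !modn_small //.
Qed.

End Point.
End Points.

Lemma irreducible_zpoly t f n D : primitive_data t f n D -> irreducible_poly (zpoly rat f).
Proof.
move=> [[fmon _] ft szf _ fmin]; have qmon : zpoly rat f \is monic by exact: monic_map.
split=> [|q q1 /dvdpP[q' Dq]].
  by rewrite size_map_poly_id0 ?szf // (monicP fmon) oner_eq0.
have fN0 := monic_neq0 qmon; have qN0 : q != 0 by apply: contraNneq fN0 => q0;
  rewrite Dq q0 mulr0.
have q'N0 : q' != 0 by apply: contraNneq fN0 => q0; rewrite Dq q0 mul0r.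
have : root (qpoly (q' * q)) t by rewrite -Dq qpoly_zpoly.
rewrite rmorphM rootM !fmin => /orP[] H; last first.
  by rewrite -dvdp_size_eqp ?Dq ?dvdp_mull // -Dq eqn_leq !dvdp_leq // Dq dvdp_mull.
have := dvdp_leq q'N0 H; rewrite Dq size_mul //.
have := size_poly_gt0 q'; have := size_poly_gt0 q; rewrite qN0 q'N0; move: q1.
by move: (size q) (size q') => a b; clear; lia.
Qed.

Lemma closure_int_frob (p : nat) (F : closedFieldType) (h : {rmorphism 'F_p -> F}) (c : int) :
  prime p -> c%:~R ^+ p = c%:~R :> F.
Proof.
move=> pp; have pF : p \in [pchar F] by rewrite (fmorph_pchar h); exact: pchar_Fp.
by rewrite -(pFrobenius_autE pF) rmorph_int.
Qed.

Section NormalPoints.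
Variables (K : fieldExtType rat) (iota : {rmorphism K -> algC}) (S : set (place K)).
Variables (t : algC) (f : {poly int}) (n D p : nat).
Local Notation k := (range iota).
Local Notation O := (integers k).
Local Notation A := (S_integers iota S k).
Hypotheses (Dk : k = adjoin t) (tA : t \in Aint) (PD : primitive_data t f n D).
Hypotheses (gp : good_prime f n D p) (Sp : avoids S p).
Let pp : prime p. Proof. by case: gp. Qed.

(** Each root r of f in the closure of F_p has a point above p, where t is congruent to an integer
    c; then r = c is fixed by Frobenius. *)
Lemma degree1_nroots :
  (forall Q, closed_points A Q -> Q p%:R -> abs_inertia_degree A Q 1) ->
  nroots f p = n.+1.
Proof.
move=> deg1; have [F [h Ftors]] := torsion_closure_Fp p.
have [[fmon _] _ szf _ _] := PD; have [_ _ _ fdisc] := gp.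
apply: (nroots_of_frob h pp fmon szf fdisc) => r fr.
have [Q [Qmax Qp Qg]] := closure_point Dk tA PD gp Sp h Ftors fr.
have [c Qc] := proj1 (degree1_point Dk tA PD gp Sp Qmax Qp) (deg1 Q Qmax Qp).
have : (zpoly F ('X - c%:P)).[r] = 0.
  by apply/Qg; rewrite rmorphB /= map_polyX map_polyC /= hornerXsubC.
rewrite rmorphB /= map_polyX map_polyC /= hornerXsubC => /eqP; rewrite subr_eq0 => /eqP ->.
exact: (closure_int_frob h _ pp).
Qed.

Lemma root_degree1_point r : zroot f p r ->
  exists2 Q, closed_points A Q /\ Q p%:R & abs_inertia_degree A Q 1.
Proof.
move=> /andP[rp fr]; have [F [h Ftors]] := torsion_closure_Fp p.
have fr' : root (zpoly F f) r%:Z%:~R.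
  by rewrite /root horner_map /= -(dvdz_closure h pp).
have [Q [Qmax Qp Qg]] := closure_point Dk tA PD gp Sp h Ftors fr'.
exists Q => //; apply/(degree1_point Dk tA PD gp Sp Qmax Qp); exists r%:Z.
have := proj2 (Qg ('X - r%:Z%:P)); rewrite !rmorphB /= !map_polyX !map_polyC /= !hornerXsubC.
by apply; rewrite subrr.
Qed.

Hypothesis normK : normal_over_rat K.

Lemma normal_splits : exists rs : seq K, zpoly algC f = \prod_(x <- rs) ('X - (iota x)%:P).
Proof.
have [[fmon _] ft szf _ _] := PD; have [t0 _ Dt] : k t by rewrite Dk; exact: mem_adjoin.
have iE (q : {poly rat}) : map_poly iota (map_poly (in_alg K) q) = qpoly q.
  by rewrite -map_poly_comp; apply: eq_map_poly => c; exact: (fmorph_eq_rat (iota \o in_alg K)).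
have [|rs] := normK (irreducible_zpoly PD).
  exists t0; rewrite -(fmorph_root iota) iE qpoly_zpoly.
  by rewrite Dt.
move=> H; exists rs; rewrite -qpoly_zpoly -iE.
have -> : map_poly (in_alg K) (zpoly rat f) = \prod_(r <- rs) ('X - r%:P).
  apply/eqP; rewrite -eqp_monic //; first exact/monic_map/monic_map.
  exact: monic_prod_XsubC.
by rewrite rmorph_prod /=; apply: eq_bigr => x _; rewrite rmorphB /= map_polyX map_polyC.
Qed.

(** All roots of f lie in K, so the residue character O -> F_p given by the single root r carries
    the whole factorization of f to F_p. *)
Lemma normal_split_mod r : zroot f p r ->
  exists (cs : seq int) (g : {poly int}), f = \prod_(c <- cs) ('X - c%:P) + p%:Z%:P * g.
Proof.
move=> /andP[rp fr]; have [rs Drs] := normal_splits.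
have dvdE (z : int) : (p %| z)%Z = (z%:~R == 0 :> 'F_p).
  exact: dvdz_pcharf (pchar_Fp pp) z.
have pF : p%:R = 0 :> 'F_p by have := dvdE p; rewrite dvdzz => /esym/eqP.
have fr' : root (zpoly 'F_p f) r%:Z%:~R by rewrite /root horner_map /= -dvdE.
have [phi [phiD phiM phi1 _ phiE]] := residue_character Dk PD gp pF fr'.
have Hk := range_subfield iota; have OR := integers_subring Hk.
have phiz (z : int) : phi z%:~R = z%:~R.
  by have := phiE z%:P; rewrite !map_polyC !hornerC.
have Ox x : x \in rs -> O (iota x).
  move=> xrs; split=> //; apply: (@root_monic_Aint (zpoly algC f)).
  - by rewrite Drs -(big_map iota xpredT (fun y => 'X - y%:P)) root_prod_XsubC map_f.
  - by case: PD => -[fmon _] _ _ _ _; exact: monic_map.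
  - by apply/polyOverP => i; rewrite coef_map /= intr_int.
have phiB z x : O x -> phi (z%:~R - x) = z%:~R - phi x.
  move=> Ox'; have Oz : O z%:~R := integers_int Hk z.
  have := phiD _ _ (integersD Hk Oz (integersN Hk Ox')) Ox'; rewrite subrK phiz => ->.
  by rewrite addrK.
have phi_prod z (s : seq K) : {subset s <= rs} -> O (\prod_(x <- s) (z%:~R - iota x)) /\
    phi (\prod_(x <- s) (z%:~R - iota x)) = \prod_(x <- s) (z%:~R - phi (iota x)).
  elim: s => [|x s IH] sr; first by rewrite !big_nil; split=> //; exact: (integers1 Hk).
  have [|Os Es] := IH; first by move=> y ys; apply: sr; rewrite inE ys orbT.
  have Oxz : O (z%:~R - iota x).
    apply: (integersD Hk (integers_int Hk z)); apply: (integersN Hk); apply: Ox.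
    by apply: sr; rewrite inE eqxx.
  rewrite !big_cons; split; first exact: (integersM Hk).
  by rewrite phiM // Es phiB //; apply: Ox; apply: sr; rewrite inE eqxx.
have Ef : zpoly 'F_p f = \prod_(x <- rs) ('X - (phi (iota x))%:P).
  (* The character acts on values, not on polynomials: both sides agree at the p points of F_p, more
     than their degree n + 1. *)
  apply/eqP; rewrite -subr_eq0; apply/eqP; apply: (@roots_geq_poly_eq0 _ _ (enum 'F_p)).
  - apply/allP => a _; rewrite /root hornerD hornerN subr_eq0 horner_prod.
    have -> : a = (a : nat)%:Z%:~R by rewrite -pmulrn natr_Zp.
    move: (Posz _) => z {a}; rewrite horner_map /= -phiz.
    have -> : (f.[z])%:~R = \prod_(x <- rs) (z%:~R - iota x).
      rewrite -(horner_map (intmul (1 : algC))) /= Drs horner_prod.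
      by apply: eq_bigr => x _; rewrite hornerXsubC.
    have [|_ ->] := phi_prod z rs; first by [].
    by apply/eqP; apply: eq_bigr => x _; rewrite hornerXsubC.
  - exact: enum_uniq.
  - rewrite -cardE card_Fp //; have [_ np _ _] := gp; have [[fmon _] _ szf _ _] := PD.
    have szr : size rs = n.+1.
      have := congr1 (fun q : {poly algC} => size q) Drs.
      rewrite size_prod_XsubC size_map_poly_id0 ?szf; first by case.
      by rewrite (monicP fmon) oner_eq0.
    apply: leq_trans np; apply: (leq_trans (size_polyD _ _)).
    by rewrite geq_max size_polyN size_prod_XsubC szr leqnn andbT -szf size_poly.
exists [seq (phi (iota x) : nat)%:Z | x <- rs].
have [|g _ Dg] := @int_combination_dvd p
    (f - \prod_(c <- [seq (phi (iota x) : nat)%:Z | x <- rs]) ('X - c%:P)) (prime_gt0 pp).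
  move=> i; rewrite dvdE -(coef_map (intmul (1 : 'F_p))) /= rmorphB /= Ef rmorph_prod /= big_map.
  rewrite [X in _ - X](eq_bigr (fun x => 'X - (phi (iota x))%:P)) ?subrr ?coef0 // => x _.
  by rewrite rmorphB /= map_polyX map_polyC /= -pmulrn natr_Zp.
by exists g; rewrite -Dg addrC subrK.
Qed.

Lemma normal_nroots r : zroot f p r -> nroots f p = n.+1.
Proof.
move=> fr; have [cs [g Df]] := normal_split_mod fr.
have [F [h _]] := torsion_closure_Fp p.
have [[fmon _] _ szf _ _] := PD; have [_ _ _ fdisc] := gp.
apply: (nroots_of_frob h pp fmon szf fdisc) => x.
have pF : p%:Z%:~R = 0 :> F by have := dvdz_closure h pp p; rewrite dvdzz => /esym/eqP.
rewrite Df rmorphD rmorphM rmorph_prod /= map_polyC /= pF mul0r addr0 /root horner_prod.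
rewrite prodf_seq_eq0 => /hasP[c _] /=.
rewrite rmorphB /= map_polyX map_polyC /= hornerXsubC subr_eq0 => /eqP ->.
exact: (closure_int_frob h _ pp).
Qed.

(** The product of the t - c over the roots c of f modulo p is a multiple of p, hence lies in Q; as
    Q is prime, it contains a factor. *)
Lemma normal_degree1 r Q : zroot f p r -> closed_points A Q -> Q p%:R ->
  abs_inertia_degree A Q 1.
Proof.
move=> fr Qmax Qp; apply/(degree1_point Dk tA PD gp Sp Qmax Qp).
have [cs [g Df]] := normal_split_mod fr; have [_ ft _ _ _] := PD.
have AR := S_integers_subring iota S; have QI := point_ideal Qmax.
have At : A t by apply: integers_S_integers; split=> //; rewrite Dk; exact: mem_adjoin.
have Q1 : ~ Q 1 by case: Qmax.
have : Q (\prod_(c <- cs) (t - c%:~R)).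
  have -> : \prod_(c <- cs) (t - c%:~R) = (- (zpoly algC g).[t]) * p%:R.
    have := rootP ft; rewrite Df rmorphD rmorphM rmorph_prod /= map_polyC /= hornerD hornerM
      hornerC.
    rewrite horner_prod -pmulrn (eq_bigr (fun c : int => t - c%:~R)) => [/eqP|c _].
      by rewrite addr_eq0 => /eqP ->; rewrite mulNr mulrC.
    by rewrite rmorphB /= map_polyX map_polyC /= hornerXsubC.
  by apply: (idealM QI) => //; apply: (subringN AR); exact: (subring_horner AR).
elim: cs {Df} => [|c cs IH]; first by rewrite big_nil.
have Ac (c' : int) : A (t - c'%:~R).
  by case: (AR) => _ AB _; apply: AB => //; exact: (subring_int AR).
rewrite big_cons => /(maximal_prime Qmax)[|||/IH]//; last by exists c.
by elim/big_ind: _ => [||i _] //; [case: AR|exact: (subringM AR)].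
Qed.
End NormalPoints.

Lemma frob_fixed_nroots p n f t : prime p -> f \is monic -> size f = n.+2 -> t \in Aint ->
  root (zpoly algC f) t -> nroots f p = n.+1 -> frob_fixed p t.
Proof. by move=> pp fmon szf tA ft nf; split=> //; exact: (Aint_frob pp fmon szf). Qed.

(** * From splitting of primes to equal images in algC and isomorphic fields *)

Lemma isomorphic_of_range (K1 K2 : fieldExtType rat)
  (iota1 : {rmorphism K1 -> algC}) (iota2 : {rmorphism K2 -> algC}) :
  range iota1 = range iota2 -> exists f : {rmorphism K1 -> K2}, bijective f.
Proof.
move=> E; have /choice[f Hf] : forall x, exists y, iota2 y = iota1 x.
  move=> x; have : range iota1 (iota1 x) by exists x.
  by rewrite E => -[y _ <-]; exists y.
have /choice[g Hg] : forall y, exists x, iota1 x = iota2 y.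
  move=> y; have : range iota2 (iota2 y) by exists y.
  by rewrite -E => -[x _ <-]; exists x.
have fB : zmod_morphism f.
  by move=> x y; apply: (fmorph_inj iota2); rewrite rmorphB !Hf rmorphB.
have fM : monoid_morphism f.
  split; first by apply: (fmorph_inj iota2); rewrite Hf !rmorph1.
  by move=> x y; apply: (fmorph_inj iota2); rewrite rmorphM !Hf rmorphM.
pose fA := GRing.isZmodMorphism.Build K1 K2 f fB.
pose fX := GRing.isMonoidMorphism.Build K1 K2 f fM.
pose F : {rmorphism K1 -> K2} := HB.pack f fA fX.
exists F; apply: (@Bijective _ _ _ g) => [x|y].
  by apply: (fmorph_inj iota1); rewrite (Hg (f x)) Hf.
by apply: (fmorph_inj iota2); rewrite (Hf (g y)) Hg.
Qed.

Theorem corollary1p4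
  (K1 K2 : fieldExtType rat)
  (iota1 : {rmorphism K1 -> algC}) (iota2 : {rmorphism K2 -> algC})
  (S1 : set (place K1)) (S2 : set (place K2))
  (hS1 : prime_set iota1 S1) (hS2 : prime_set iota2 S2)
  (sigma : {multiplicative GKS iota1 S1 -> GKS iota2 S2})
  (tau : GKS iota2 S2 -> GKS iota1 S1)
  (sigmaK : cancel sigma tau) (tauK : cancel tau sigma)
  (sigma_cont : continuous (sigma : GKS iota1 S1 -> GKS iota2 S2))
  (tau_cont : continuous tau)
  (star : set algC -> set algC -> set algC)
  (star_bij : forall L1, KS_subext iota1 S1 L1 ->
     set_bij (closed_points (S_integers iota1 S1 L1))
             (closed_points (S_integers iota2 S2 (corresponding_ext sigma L1)))
             (star L1))
  (star_compat : forall L1 L1', KS_subext iota1 S1 L1 ->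
     KS_subext iota1 S1 L1' -> L1 `<=` L1' ->
     forall P, closed_points (S_integers iota1 S1 L1') P ->
       star L1 (P `&` S_integers iota1 S1 L1) =
       star L1' P `&` S_integers iota2 S2 (corresponding_ext sigma L1))
  (star_decomp : forall P,
     closed_points (S_integers iota1 S1 (max_unramified_ext iota1 S1)) P ->
     sigma @` decomposition_group iota1 S1 P =
     decomposition_group iota2 S2 (lim_star iota1 S1 star P))
  (star_char : forall L1, KS_subext iota1 S1 L1 ->
     forall P, closed_points (S_integers iota1 S1 L1) P ->
     forall p, residue_char P p <-> residue_char (star L1 P) p)
  (star_inertia : forall L1, KS_subext iota1 S1 L1 ->
     forall P, closed_points (S_integers iota1 S1 L1) P ->
     forall f,
       abs_inertia_degree (S_integers iota1 S1 L1) P f <->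
       abs_inertia_degree (S_integers iota2 S2 (corresponding_ext sigma L1))
         (star L1 P) f)
  (K1_normal : normal_over_rat K1) :
  exists f : {rmorphism K1 -> K2}, bijective f.
Proof.
have E2 := corresponding_base tauK.
have base := base_unramified iota1 S1.
have [_ _ surj] := star_bij _ base; rewrite E2 in surj.
have [t1 t1A D1] := range_adjoin iota1; have [t2 t2A D2] := range_adjoin iota2.
have [f1 [n1 [d1 P1]]] := primitive_data_exists t1A.
have [f2 [n2 [d2 P2]]] := primitive_data_exists t2A.
have [y1 G1] := good_prime_bound P1; have [y2 G2] := good_prime_bound P2.
have [v1 V1] := avoids_bound hS1; have [v2 V2] := avoids_bound hS2.
have [[f1mon f1irr] f1t f1s _ f1min] := P1; have [[f2mon f2irr] f2t f2s _ _] := P2.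
pose y := (maxn (maxn y1 y2) (maxn v1 v2)).
have good p : prime p -> (y < p)%N ->
    [/\ good_prime f1 n1 d1 p, good_prime f2 n2 d2 p, avoids S1 p & avoids S2 p].
  by move=> pp; rewrite !gtn_max => /andP[/andP[p1 p2] /andP[q1 q2]]; split;
    [exact: G1|exact: G2|exact: V1|exact: V2].
have back Q p : closed_points (S_integers iota2 S2 (range iota2)) Q -> Q p%:R -> prime p ->
    exists P, [/\ closed_points (S_integers iota1 S1 (range iota1)) P, P p%:R &
      abs_inertia_degree (S_integers iota1 S1 (range iota1)) P 1 <->
      abs_inertia_degree (S_integers iota2 S2 (range iota2)) Q 1].
  move=> /surj[P Pmax <-] Qp pp; exists P; split=> //.
    by have [] := proj2 (star_char _ base _ Pmax p) (conj pp Qp).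
  by have := star_inertia _ base _ Pmax 1%N; rewrite E2.
have le12 : range iota2 `<=` range iota1.
  (* The generator z is a combination of t_1 and t_2 with natural coefficients: it is integral, and
     fixed by Frobenius modulo p as soon as t_1 and t_2 are. *)
  have [z [a Dz] [ps Ds]] := algC_PET [:: t1; t2].
  have psz : size ps = 2%N by have := congr1 size Ds; rewrite size_map.
  case: ps psz Ds => [|q1 [|q2 []]] //= _ [Dq1 Dq2].
  have zA : z \in Aint.
    rewrite Dz; elim/big_ind: _ => [||[[|[|//]] i] _] /=; first exact: Aint0.
    - by move=> u v; exact: rpredD.
    - exact: rpredMn.
    - exact: rpredMn.
  have [g [m [d P]]] := primitive_data_exists zA; have [w G] := good_prime_bound P.
  have [girr gz gs [d0 gd] gmin] := P; have [gmon _] := girr.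
  have bound : (m.+1 < 2 * n1.+1)%N.
    apply: (@splitting_degree_bound n1 m f1 g (maxn y w)) => // p r pp.
    rewrite gtn_max => /andP[py pw] fr.
    have [g1 g2 a1 a2] := good p pp py; have [_ _ pd pg] := G p pp pw.
    have nf1 := normal_nroots D1 P1 g1 K1_normal fr.
    have nf2 : nroots f2 p = n2.+1.
      apply: (degree1_nroots D2 t2A P2 g2 a2) => Q Qmax Qp.
      have [P' [Pmax Pp deg]] := back Q p Qmax Qp pp; apply/deg.
      exact: (normal_degree1 D1 t1A P1 g1 a1 K1_normal fr).
    have F1 := frob_fixed_nroots pp f1mon f1s t1A f1t nf1.
    have F2 := frob_fixed_nroots pp f2mon f2s t2A f2t nf2.
    apply: (nroots_of_frob_fixed pp girr gs gz gd pg pd).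
    rewrite Dz; elim/big_ind: _ => [||[[|[|//]] i] _] /=.
    - by have := frob_fixedMn 0 pp F1.
    - by move=> u v; exact: frob_fixedD.
    - exact: frob_fixedMn.
    - exact: frob_fixedMn.
  have sg : (1 < size g)%N by rewrite gs.
  have sb : ((size g).-1 < 2 * (size f1).-1)%N by rewrite gs f1s.
  have [u [v Ez]] := small_degree_generator (conj f1mon f1irr) f1t gz gmon sg Dq1 sb.
  rewrite D1 D2; have As := adjoin_subfield t1; apply: adjoin_subset => //.
  rewrite Dq2; apply: adjoin_qhorner; rewrite Ez.
  by case: (As) => _ _; apply; exact: (subfield_qhorner _ As (mem_adjoin t1)).
apply: (@isomorphic_of_range _ _ iota1 iota2); apply/seteqP; split=> //.
have [q Dq] : adjoin t1 t2 by rewrite -D1; apply: le12; rewrite D2; exact: mem_adjoin.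
have bound : (n1.+1 < 2 * n2.+1)%N.
  apply: (@splitting_degree_bound n2 n1 f2 f1 y) => // p r pp py fr.
  have [g1 g2 a1 a2] := good p pp py.
  (* A root of f_2 modulo p gives a point of degree 1 for K_2; at its preimage t_1 is congruent to
     an integer, which is a root of f_1 modulo p. *)
  have [Q [Qmax Qp] Qdeg] := root_degree1_point D2 t2A P2 g2 a2 fr.
  have [P [Pmax Pp deg]] := back Q p Qmax Qp pp.
  have [c Pc] := proj1 (degree1_point D1 t1A P1 g1 a1 Pmax Pp) (proj2 deg Qdeg).
  have [s fs] := point_root D1 t1A P1 g1 Pmax Pp Pc.
  exact: (normal_nroots D1 P1 g1 K1_normal fs).
have sg : (1 < size f1)%N by rewrite f1s.
have sb : ((size f1).-1 < 2 * (size f2).-1)%N by rewrite f1s f2s.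
have [u [v Ez]] := small_degree_generator (conj f2mon f2irr) f2t f1t f1mon sg Dq sb.
rewrite D1 D2; have As := adjoin_subfield t2; apply: adjoin_subset => //.
by rewrite Ez; case: (As) => _ _; apply; exact: (subfield_qhorner _ As (mem_adjoin t2)).
Qed.
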